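(* Let $G=\mathrm{Aut}(\mathfrak{so}(8))$, and let $F_{13},\dots,F_{21}$ be the finite abelian subgroups of $\mathrm{O}(8)/\langle -I\rangle\subset G$ defined in the context. Then: (1) In $G$, the subgroups $F_{13},F_{14},F_{16},F_{17},F_{18},F_{19},F_{20},F_{21}$ are pairwise non-conjugate. (2) $F_{15}$ and $F_{19}$ are conjugate in $G$, and the normalizer of $F_{17}$ in $G$ meets all connected components of $G$. (3) Any diagonalizable finite abelian subgroup $F$ of $\mathrm{SO}(8)/\langle -I\rangle$ satisfying condition $(\ast)$: $\dim\mathfrak{so}(8)^F=\dim F$ (i.e. $\mathfrak{so}(8)^F=0$), is conjugate in $G$ to one of $F_{13},F_{14},F_{16},F_{21}$.
   Context: $\mathfrak{so}(8)$ is the compact real Lie algebra; $G_0\cong\mathrm{SO}(8)/\langle -I\rangle$, $G/G_0\cong S_3$, and $\mathrm{O}(8)/\langle -I\rangle$ is regarded as a subgroup of $G$ via conjugation on $\mathfrak{so}(8)$. A subgroup of $\mathrm{O}(8)/\langle -I\rangle$ is diagonalizable if it is conjugate in $\mathrm{O}(8)/\langle -I\rangle$ to a subgroup of the image of the diagonal matrices. $[X]$ is the class of $X\in\mathrm{O}(8)$ in $\mathrm{O}(8)/\langle -I\rangle$. Put $I_{p,q}=\mathrm{diag}(-I_p,I_q)$, $J_n=\left(\begin{array}{cc}0&I_n\\ -I_n&0\end{array}\right)$, $J'_n=\left(\begin{array}{cc}0&I_n\\ I_n&0\end{array}\right)$. Abbreviate $D=[\mathrm{diag}\{I_{1,1},I_{1,1},I_{1,1},I_{1,1}\}]$,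 $E=[\mathrm{diag}\{J'_1,J'_1,J'_1,J'_1\}]$. Then $F_{13}=\langle[I_{4,4}],[J'_4],[\mathrm{diag}\{I_{2,2},I_{2,2}\}],[\mathrm{diag}\{J'_2,J'_2\}],D,E\rangle$, $F_{14}=\langle[I_{4,4}],[\mathrm{diag}\{I_{2,2},I_{2,2}\}],[\mathrm{diag}\{J'_2,J'_2\}],D,E\rangle$, $F_{15}=\langle[I_{4,4}],[\mathrm{diag}\{I_{2,2},I_{2,2}\}],[\mathrm{diag}\{J'_2,J'_2\}],D,[\mathrm{diag}\{J'_1,J'_1,J_1,J_1\}]\rangle$, $F_{16}=\langle[I_{4,4}],[\mathrm{diag}\{I_{2,2},I_{2,2}\}],D,E\rangle$, $F_{17}=\langle[I_{4,4}],[I_{2,6}],[I_{6,2}],D,E\rangle$, $F_{18}=\langle[I_{4,4}],[I_{2,6}],[I_{6,2}],D,[\mathrm{diag}\{J'_1,J'_1,J'_1,J_1\}]\rangle$, $F_{19}=\langle[I_{4,4}],[I_{2,6}],[I_{6,2}],D,[\mathrm{diag}\{J'_1,J'_1,J_1,J_1\}]\rangle$, $F_{20}=\langle[I_{4,4}],[I_{2,6}],[I_{6,2}],[\mathrm{diag}\{I_{1,1},I_{1,1},I_{1,1},J_1\}],[\mathrm{diag}\{J'_1,J'_1,J_1,I_{1,1}\}]\rangle$, $F_{21}=\langle[I_{4,4}],[\mathrm{diag}\{I_{2,2},I_{2,2}\}],D\rangle$. *)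

(* Defs.v *)
From HB Require Import structures.
From mathcomp Require Import all_boot all_order all_algebra all_fingroup.
From mathcomp Require Import all_classical all_reals all_analysis.
Set Implicit Arguments.
Unset Strict Implicit.
Unset Printing Implicit Defensive.
Import Order.TTheory GRing.Theory Num.Theory.
Import numFieldNormedType.Exports.
Local Open Scope classical_set_scope.
Local Open Scope ring_scope.

Section LieAlgebra.
Variable R : realType.

Definition skew_part (X : 'M[R]_8) : 'M[R]_8 := X^T + X.

Fact skew_part_linear : linear skew_part.
Proof. by move=> a X Y; rewrite /skew_part linearP scalerDr addrACA. Qed.

HB.instance Definition _ :=
  GRing.isLinear.Build R 'M[R]_8 'M[R]_8 _ skew_part skew_part_linear.

Definition so8_space : {vspace 'M[R]_8} := lker (linfun skew_part).

Definition so8 := subvs_of so8_space.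

Lemma mem_so8 (X : 'M[R]_8) : (X \in so8_space) = (X^T == - X).
Proof. by rewrite memv_ker lfunE /= /skew_part addr_eq0. Qed.

Definition lie_bracket (u v : so8) : so8 :=
  vsproj so8_space (vsval u *m vsval v - vsval v *m vsval u).

Lemma lie_bracketE (u v : so8) :
  vsval (lie_bracket u v) = vsval u *m vsval v - vsval v *m vsval u.
Proof.
apply: vsprojK; rewrite mem_so8 linearB /= !trmx_mul.
have := subvsP u; have := subvsP v.
rewrite !mem_so8 => /eqP -> /eqP ->.
by rewrite !mulmxN !mulNmx !opprK opprB.
Qed.

(* An injective endomorphism of a finite-dimensional space is bijective. *)
Definition is_lie_aut : pred 'End(so8) := fun f =>
  (lker f == 0%VS) &&
  `[< forall u v, f (lie_bracket u v) = lie_bracket (f u) (f v) >].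

Record autso8 := AutSO8 { aut_val :> 'End(so8); _ : is_lie_aut aut_val }.

HB.instance Definition _ := [isSub for aut_val].
HB.instance Definition _ := [Choice of autso8 by <:].

Lemma autP (f : autso8) : is_lie_aut f.
Proof. by case: f. Qed.

Lemma aut_bracket (f : autso8) u v :
  f (lie_bracket u v) = lie_bracket (f u) (f v).
Proof. by have /andP[_ /asboolP] := autP f; apply. Qed.

Lemma aut_lker (f : autso8) : lker f == 0%VS.
Proof. by have /andP[] := autP f. Qed.

Fact aut_one_subproof : is_lie_aut \1%VF.
Proof.
apply/andP; split.
  by apply/lker0P => u v; rewrite !id_lfunE.
by apply/asboolP => u v; rewrite !id_lfunE.
Qed.

Fact aut_mul_subproof (f g : autso8) : is_lie_aut (f \o g)%VF.
Proof.
apply/andP; split.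
  apply/lker0P => u v; rewrite !comp_lfunE.
  by move=> /(lker0P (aut_lker f)) /(lker0P (aut_lker g)).
by apply/asboolP => u v; rewrite !comp_lfunE !aut_bracket.
Qed.

Fact aut_inv_subproof (f : autso8) : is_lie_aut (f^-1)%VF.
Proof.
have fK := lker0_lfunK (aut_lker f).
have fVK := lker0_lfunVK (aut_lker f).
apply/andP; split.
  by apply/lker0P; exact: can_inj fVK.
apply/asboolP => u v; apply: (lker0P (aut_lker f)).
by rewrite aut_bracket !fVK.
Qed.

Definition aut_one := AutSO8 aut_one_subproof.
Definition aut_mul f g := AutSO8 (aut_mul_subproof f g).
Definition aut_inv f := AutSO8 (aut_inv_subproof f).

Fact aut_mulA : associative aut_mul.
Proof. by move=> f g h; apply/val_inj; rewrite /= comp_lfunA. Qed.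

Fact aut_1mul : left_id aut_one aut_mul.
Proof. by move=> f; apply/val_inj; rewrite /= comp_lfun1l. Qed.

Fact aut_mul1 : right_id aut_one aut_mul.
Proof. by move=> f; apply/val_inj; rewrite /= comp_lfun1r. Qed.

Fact aut_Vmul : left_inverse aut_one aut_inv aut_mul.
Proof. by move=> f; apply/val_inj; rewrite /= (lker0_compVf (aut_lker f)). Qed.

Fact aut_mulV : right_inverse aut_one aut_inv aut_mul.
Proof. by move=> f; apply/val_inj; rewrite /= (lker0_compfV (aut_lker f)). Qed.

HB.instance Definition _ :=
  isGroup.Build autso8 aut_mulA aut_1mul aut_mul1 aut_Vmul aut_mulV.

(* Aut(so(8)) carries the topology of pointwise convergence; as so(8) is
   finite-dimensional, this is its topology as a subgroup of GL(so(8)). *)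
Definition aut_eval (f : autso8) : {ptws so8 -> 'M[R]_8} :=
  fun u => vsval (f u).

HB.instance Definition _ := Topological.copy autso8 (initial_topology aut_eval).

End LieAlgebra.

Section Subgroups.
Local Open Scope group_scope.
Variable gT : groupType.
Implicit Types (A H K : set gT) (x y : gT).

Definition is_subgroup H :=
  [/\ H 1, (forall x y, H x -> H y -> H (x * y)) & (forall x, H x -> H x^-1)].

Definition generated A : set gT := smallest is_subgroup A.

Definition conj_set A x : set gT := [set y ^ x | y in A].

Definition conjugate_sets H K := exists x, conj_set H x = K.

Definition set_normalizer H : set gT := [set x | conj_set H x = H].

Definition commutative_set H := forall x y, H x -> H y -> commute x y.

End Subgroups.

Section Orthogonal.
Variable R : realType.

Definition orthogonal_mx n (X : 'M[R]_n) := X *m X^T = 1%:M.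

Definition O8 : set 'M[R]_8 := [set X | orthogonal_mx X].
Definition SO8 : set 'M[R]_8 := [set X | O8 X /\ \det X = 1].

(* cls X is the class [X] of X in O(8) / {I, -I}, seen in Aut(so(8)) as
   conjugation by X (see clsE and cls_eq).  It is only meaningful for
   orthogonal X. *)
Definition conj_end (X : 'M[R]_8) : 'End(so8 R) :=
  linfun (fun u : so8 R => vsproj (so8_space R) (X *m vsval u *m invmx X)).

Definition cls (X : 'M[R]_8) : autso8 R := insubd (1%g : autso8 R) (conj_end X).

Lemma O8_invmx X : O8 X -> invmx X = X^T.
Proof.
move=> XX; have [uX _] := mulmx1_unit XX.
by rewrite -[LHS]mulmx1 -XX mulmxA mulVmx // mul1mx.
Qed.

Lemma conj_endE X (u : so8 R) : O8 X ->
  vsval (conj_end X u) = X *m vsval u *m invmx X.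
Proof.
move=> OX.
pose f (u : so8 R) := vsproj (so8_space R) (X *m vsval u *m invmx X).
have lin_f : linear f.
  move=> a v w.
  by rewrite /f [vsval _]linearP mulmxDr mulmxDl -scalemxAr -scalemxAl linearP.
pose fM := GRing.isLinear.Build R (so8 R) (so8 R) _ f lin_f.
pose fL : {linear so8 R -> so8 R} := HB.pack f fM.
rewrite /conj_end (lfunE fL) /= /f vsprojK // mem_so8 (O8_invmx OX).
rewrite !trmx_mul trmxK; have := subvsP u; rewrite mem_so8 => /eqP ->.
by rewrite mulNmx mulmxN mulmxA.
Qed.

Lemma conj_end_aut X : O8 X -> is_lie_aut (conj_end X).
Proof.
move=> OX; have [uX _] := mulmx1_unit OX.
apply/andP; split.
  apply/lker0P => u v /(congr1 vsval); rewrite !conj_endE // => uv.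
  apply: val_inj; move/(congr1 (fun Y => invmx X *m Y *m X)): uv => /=.
  by rewrite !mulmxA mulVmx // !mul1mx -!mulmxA mulVmx // !mulmx1.
apply/asboolP => u v; apply: val_inj => /=.
rewrite conj_endE // !lie_bracketE !conj_endE //.
by rewrite mulmxBr mulmxBl !mulmxA !(mulmxKV uX).
Qed.

Lemma clsE X (u : so8 R) : O8 X ->
  vsval (cls X u) = X *m vsval u *m invmx X.
Proof.
by move=> OX; rewrite /cls val_insubd conj_end_aut // conj_endE.
Qed.

Lemma commute_so8_scalar (Z : 'M[R]_8) :
  (forall u : so8 R, Z *m vsval u = vsval u *m Z) -> Z = (Z 0 0)%:M.
Proof.
move=> ZC.
have skewP i j : delta_mx i j - delta_mx j i \in so8_space R.
  by rewrite mem_so8 linearB /= !trmx_delta opprB.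
have ZE i j k l : Z k i *+ (l == j) - Z k j *+ (l == i)
                  = Z j l *+ (k == i) - Z i l *+ (k == j).
  have /matrixP /(_ k l) := ZC (Subvs (skewP i j)); rewrite /= !mxE.
  under eq_bigr do rewrite !mxE mulrBr !mulr_natr.
  under [in RHS]eq_bigr do rewrite !mxE mulrBl !mulr_natl.
  rewrite !sumrB => e; transitivity (\sum_(m < 8) Z k m *+ ((m == i) && (l == j))
      - \sum_(m < 8) Z k m *+ ((m == j) && (l == i))).
    congr (_ - _); [rewrite (bigD1 i)|rewrite (bigD1 j)] => //=;
    by rewrite eqxx /= big1 ?addr0 // => m /negPf ->; rewrite mulr0n.
  rewrite {}e; congr (_ - _); [rewrite (bigD1 j)|rewrite (bigD1 i)] => //=;
  by rewrite eqxx andbT big1 ?addr0 // => m /negPf ->; rewrite andbF mulr0n.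
apply/matrixP => k i; rewrite mxE.
have [<-|neq_ki] := eqVneq k i; rewrite ?mulr1n ?mulr0n.
  have [->//|neq_k0] := eqVneq k 0.
  have := ZE k 0 k 0; rewrite eqxx eq_sym (negPf neq_k0).
  by rewrite eqxx !mulr0n !subr0 !mulr1n.
have [j /andP[/negPf neq_jk /negPf neq_ji]] : exists j, (j != k) && (j != i).
  have : (0 < #|~: [set k; i]|)%N.
    by have := cardsC [set k; i]; rewrite cards2 neq_ki card_ord; case: #|_|.
  by case/card_gt0P => j; rewrite !inE negb_or; exists j.
have := ZE i j k j; rewrite eqxx neq_ji (negPf neq_ki) eq_sym in neq_jk *.
by rewrite neq_jk !mulr0n !subr0 mulr1n.
Qed.

Lemma cls_eq X Y : O8 X -> O8 Y -> cls X = cls Y <-> Y = X \/ Y = - X.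
Proof.
move=> OX OY; have [uX _] := mulmx1_unit OX; have [uY _] := mulmx1_unit OY.
split=> [XY|[->//|eY]]; last first.
  apply: val_inj; apply/lfunP => u; apply: val_inj.
  change (vsval (cls X u) = vsval (cls Y u)).
  rewrite !clsE // !O8_invmx // eY linearN /=.
  by rewrite mulNmx mulmxN mulNmx opprK.
have ZC (u : so8 R) : X^T *m Y *m vsval u = vsval u *m (X^T *m Y).
  have : vsval (cls X u) = vsval (cls Y u) by rewrite XY.
  rewrite !clsE // -(O8_invmx OX) => e.
  have {}e : X *m vsval u *m invmx X *m Y = Y *m vsval u.
    by rewrite e mulmxKV.
  by rewrite -mulmxA -e !mulmxA mulVmx // mul1mx.
have := commute_so8_scalar ZC; set c := (X^T *m Y) 0 0 => eZ.
have YX : Y = c *: X.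
  by rewrite -mul_mx_scalar -eZ mulmxA OX mul1mx.
have : c ^+ 2 = 1.
  have := OY; rewrite /O8 /= /orthogonal_mx {1 2}YX linearZ /=.
  rewrite -scalemxAl -scalemxAr OX scalerA => /matrixP /(_ 0 0).
  by rewrite !mxE eqxx !mulr1n mulr1 -expr2.
move/eqP; rewrite sqrf_eq1 => /orP[] /eqP cE; [left|right].
  by rewrite YX cE scale1r.
by rewrite YX cE scaleN1r.
Qed.

(* The image of O(8) in Aut(so(8)), i.e. O(8) / {I, -I}, and its subgroup
   SO(8) / {I, -I}. *)
Definition PO8 : set (autso8 R) := cls @` O8.
Definition PSO8 : set (autso8 R) := cls @` SO8.

Definition diagonal_classes : set (autso8 R) :=
  [set cls X | X in [set X | O8 X /\ is_diag_mx X]].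

Definition diagonalizable_classes (F : set (autso8 R)) :=
  exists2 g, PO8 g & conj_set F g `<=` diagonal_classes.

Definition fixed_points (F : set (autso8 R)) : set (so8 R) :=
  [set u | forall f, F f -> f u = u].

End Orthogonal.

Arguments PO8 : clear implicits.
Arguments PSO8 : clear implicits.

Section Families.
Variable R : realType.

Definition Ipq p q : 'M[R]_(p + q) := block_mx (- 1%:M) 0 0 1%:M.
Definition Jn n : 'M[R]_(n + n) := block_mx 0 1%:M (- 1%:M) 0.
Definition Jn' n : 'M[R]_(n + n) := block_mx 0 1%:M 1%:M 0.

Definition diag2 (A B : 'M[R]_4) : 'M[R]_8 :=
  block_mx A 0 0 B : 'M[R]_(4 + 4).
Definition diag4 (A B C D : 'M[R]_2) : 'M[R]_8 :=
  block_mx A 0 0 (block_mx B 0 0 (block_mx C 0 0 D))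
    : 'M[R]_(2 + (2 + (2 + 2))).

Notation I11 := (Ipq 1 1).
Notation J1 := (Jn 1).
Notation J1' := (Jn' 1).

Lemma orthogonal_block m n (A : 'M[R]_m) (B : 'M[R]_n) :
  orthogonal_mx A -> orthogonal_mx B -> orthogonal_mx (block_mx A 0 0 B).
Proof.
rewrite /orthogonal_mx => OA OB; rewrite tr_block_mx mulmx_block !trmx0.
by rewrite !mulmx0 !mul0mx !addr0 add0r OA OB -scalar_mx_block.
Qed.

Lemma orthogonal_Ipq p q : orthogonal_mx (Ipq p q).
Proof.
apply: orthogonal_block; rewrite /orthogonal_mx; last by rewrite trmx1 mulmx1.
by rewrite [_^T]linearN /= trmx1 mulNmx mulmxN opprK mulmx1.
Qed.

Lemma orthogonal_Jn n : orthogonal_mx (Jn n).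
Proof.
rewrite /orthogonal_mx tr_block_mx mulmx_block !trmx0 [(- _)^T]linearN /= !trmx1.
rewrite !mulmx0 !mul0mx !add0r !addr0 mulNmx mulmxN opprK mulmx1.
by rewrite -scalar_mx_block.
Qed.

Lemma orthogonal_Jn' n : orthogonal_mx (Jn' n).
Proof.
rewrite /orthogonal_mx tr_block_mx mulmx_block !trmx0 !trmx1.
by rewrite !mulmx0 !mul0mx !add0r !addr0 mulmx1 -scalar_mx_block.
Qed.

Lemma O8_diag2 A B : orthogonal_mx A -> orthogonal_mx B -> O8 (diag2 A B).
Proof. exact: orthogonal_block. Qed.

Lemma O8_diag4 A B C D :
  orthogonal_mx A -> orthogonal_mx B -> orthogonal_mx C -> orthogonal_mx D ->
  O8 (diag4 A B C D).
Proof.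
move=> OA OB OC OD; apply: (@orthogonal_block 2 6) => //.
by apply: (@orthogonal_block 2 4) => //; apply: (@orthogonal_block 2 2).
Qed.

Definition class_group (s : seq 'M[R]_8) : set (autso8 R) :=
  generated [set cls X | X in [set` s]].

Definition mxD := diag4 I11 I11 I11 I11.
Definition mxE := diag4 J1' J1' J1' J1'.

Definition F13 := class_group
  [:: Ipq 4 4; Jn' 4; diag2 (Ipq 2 2) (Ipq 2 2); diag2 (Jn' 2) (Jn' 2);
      mxD; mxE].
Definition F14 := class_group
  [:: Ipq 4 4; diag2 (Ipq 2 2) (Ipq 2 2); diag2 (Jn' 2) (Jn' 2); mxD; mxE].
Definition F15 := class_group
  [:: Ipq 4 4; diag2 (Ipq 2 2) (Ipq 2 2); diag2 (Jn' 2) (Jn' 2); mxD;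
      diag4 J1' J1' J1 J1].
Definition F16 := class_group
  [:: Ipq 4 4; diag2 (Ipq 2 2) (Ipq 2 2); mxD; mxE].
Definition F17 := class_group
  [:: Ipq 4 4; Ipq 2 6; Ipq 6 2; mxD; mxE].
Definition F18 := class_group
  [:: Ipq 4 4; Ipq 2 6; Ipq 6 2; mxD; diag4 J1' J1' J1' J1].
Definition F19 := class_group
  [:: Ipq 4 4; Ipq 2 6; Ipq 6 2; mxD; diag4 J1' J1' J1 J1].
Definition F20 := class_group
  [:: Ipq 4 4; Ipq 2 6; Ipq 6 2; diag4 I11 I11 I11 J1;
      diag4 J1' J1' J1 I11].
Definition F21 := class_group
  [:: Ipq 4 4; diag2 (Ipq 2 2) (Ipq 2 2); mxD].

End Families.

Arguments F13 : clear implicits.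
Arguments F14 : clear implicits.
Arguments F15 : clear implicits.
Arguments F16 : clear implicits.
Arguments F17 : clear implicits.
Arguments F18 : clear implicits.
Arguments F19 : clear implicits.
Arguments F20 : clear implicits.
Arguments F21 : clear implicits.

(* Main.v *)
Require Import Defs.
From HB Require Import structures.
From mathcomp Require Import all_boot all_order all_algebra all_fingroup.
From mathcomp Require Import all_classical all_reals all_analysis.
From mathcomp Require Import ring lra.
Set Implicit Arguments.
Unset Strict Implicit.
Unset Printing Implicit Defensive.
Import Order.TTheory GRing.Theory Num.Theory.
Import numFieldNormedType.Exports.
Local Open Scope classical_set_scope.

(** The nine groups consist of classes of signed permutation matrices, so every
    question about their elements is a finite computation with such matrices up to
    sign ([sperm], [slist], [sgroupE]).

    Non-conjugacy. An automorphism f of so(8) has a trace, and a class [X] has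
    trace ((tr X)^2 - tr X^2) / 2. Four numbers attached to a finite group are
    therefore invariant under conjugation ([profile_conj]): its order, the number
    of its elements of square 1, the number of its elements whose square has trace
    4 (such as [I_(2,6)]), and the number of its elements whose translation
    preserves the set of elements of trace 4. The first two separate most of the
    groups, the third separates F18 from F19 and the last one F14 from F17.

    Triality. Eight real Pauli matrices g_0, ..., g_7 on the third tensor power of
    R^2 satisfy the Clifford relations g_i g_j^T + g_j g_i^T = 2 delta_ij, and
    E_ij - E_ji |-> g_i g_j^T / 2 is an automorphism of so(8), a half-spin
    representation ([triality]). Conjugation by it carries the classes of the
    signed permutation matrices at hand to classes of signed permutation matrices.
    It fixes F21 pointwise, normalizes F17, carries F19 to a coordinate permutation
    of F15, and carries certain diagonal groups to F13, F14 and F16.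

    Components. The rotation generator u = E_01 - E_10 satisfies
    ad(u)^3 = - ad(u), hence so does its image M under an automorphism. In terms
    of matrices this forces M to be a rotation generator of another plane or half
    of an orthogonal complex structure ([cubic_dichotomy]). In the first case the
    automorphism is conjugation by an orthogonal matrix ([PO8_plane]). In the
    second case M is orthogonally conjugate to the image of u under triality, so
    the automorphism lies in O(8) triality O(8) ([aut_structure]). Orthogonal
    matrices are products of reflections, and all reflections are connected to
    each other, so each component contains a product of powers of triality and of
    the reflection in the first coordinate, both of which normalize F17.

    Diagonalizable groups. Up to conjugation such a group is given by a binary
    code C of length 8. It contains the all-one word because -I has trivial class,
    it is even because its matrices have determinant 1, and any two coordinates
    differ on it because no E_ij - E_ji is fixed. So the words of the dual code
    have weight 0, 4 or 8, which leaves, up to a permutation of the coordinates, a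
    chain of four codes of dimension 1 to 4 ([classify_doubly_even]). The four
    dual groups are the diagonal groups that triality carries to F13, F14, F16 and
    F21. *)

(** * Generated subgroups, conjugation, and classes of orthogonal matrices *)

Section Groups.
Local Open Scope group_scope.
Local Notation generated := Defs.generated.
Variable gT : groupType.
Implicit Types (A H K : set gT) (x y : gT).

Lemma sub_generated A : A `<=` generated A.
Proof. exact: sub_gen_smallest. Qed.

Lemma generated_subgroup A : is_subgroup (generated A).
Proof.
split.
- by move=> H [[]].
- move=> x y gx gy H HA; case: (HA) => -[_ HM _] _.
  by apply: HM; [apply: gx | apply: gy].
- move=> x gx H HA; case: (HA) => -[_ _ HV] _.
  by apply: HV; apply: gx.
Qed.

Lemma generated_sub A H : is_subgroup H -> A `<=` H -> generated A `<=` H.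
Proof. by move=> sH AH x; apply. Qed.

Lemma conj_setM A x y : conj_set (conj_set A x) y = conj_set A (x * y).
Proof.
rewrite /conj_set; apply/seteqP; split=> z.
  by move=> [_ [a Aa <-] <-]; exists a => //; rewrite conjgM.
by move=> [a Aa <-]; exists (a ^ x); [exists a | rewrite conjgM].
Qed.

Lemma conj_set1 A : conj_set A 1 = A.
Proof.
apply/seteqP; split=> z; first by move=> [a Aa <-]; rewrite conjg1.
by move=> Az; exists z; rewrite ?conjg1.
Qed.

Lemma conj_setK A x : conj_set (conj_set A x) x^-1 = A.
Proof. by rewrite conj_setM mulgV conj_set1. Qed.

Lemma conj_setKV A x : conj_set (conj_set A x^-1) x = A.
Proof. by rewrite conj_setM mulVg conj_set1. Qed.

Lemma conj_setS A B x : A `<=` B -> conj_set A x `<=` conj_set B x.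
Proof. by move=> AB _ [a /AB Ba <-]; exists a. Qed.

Lemma conj_set_subgroup H x : is_subgroup H -> is_subgroup (conj_set H x).
Proof.
move=> [H1 HM HV]; split.
- by exists 1 => //; rewrite conj1g.
- by move=> _ _ [a Ha <-] [b Hb <-]; exists (a * b); [exact: HM | rewrite conjMg].
- by move=> _ [a Ha <-]; exists a^-1; [exact: HV | rewrite conjVg].
Qed.

Lemma conj_generated A x : conj_set (generated A) x = generated (conj_set A x).
Proof.
have sub y B : generated (conj_set B y) `<=` conj_set (generated B) y.
  apply: generated_sub; first exact/conj_set_subgroup/generated_subgroup.
  by apply: conj_setS; apply: sub_generated.
apply/seteqP; split; last exact: sub.
rewrite -[X in _ `<=` X](conj_setKV _ x); apply: conj_setS.
by rewrite -{1}[A](conj_setK _ x); apply: sub.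
Qed.

Lemma conjugate_sets_sym H K : conjugate_sets H K -> conjugate_sets K H.
Proof. by move=> [x <-]; exists x^-1; rewrite conj_setK. Qed.

End Groups.

Section Orthogonal.
Local Open Scope ring_scope.
Variable R : realType.
Implicit Types X Y : 'M[R]_8.

Lemma aut_ext (f g : autso8 R) :
  (forall u, vsval (f u) = vsval (g u)) -> f = g.
Proof. by move=> fg; apply/val_inj/lfunP => u; apply: val_inj; apply: fg. Qed.

Lemma aut_mulE (f g : autso8 R) u : (f * g)%g u = f (g u).
Proof. by rewrite [LHS]comp_lfunE. Qed.

Lemma aut_1E (u : so8 R) : (1%g : autso8 R) u = u.
Proof. by rewrite [LHS]id_lfunE. Qed.

Lemma O8_tr X : O8 X -> O8 X^T.
Proof. by move=> OX; rewrite /O8 /= /orthogonal_mx trmxK; apply: mulmx1C. Qed.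

Lemma O8_mul X Y : O8 X -> O8 Y -> O8 (X *m Y).
Proof.
move=> OX OY; rewrite /O8 /= /orthogonal_mx trmx_mul mulmxA -(mulmxA X).
by rewrite [Y *m _]OY mulmx1 [LHS]OX.
Qed.

Lemma O8_1 : O8 (1%:M : 'M[R]_8).
Proof. by rewrite /O8 /= /orthogonal_mx trmx1 mulmx1. Qed.

Lemma O8_opp X : O8 X -> O8 (- X).
Proof.
by move=> OX; rewrite /O8 /= /orthogonal_mx linearN /= mulNmx mulmxN opprK.
Qed.

Lemma clsTE X (u : so8 R) : O8 X -> vsval (cls X u) = X *m vsval u *m X^T.
Proof. by move=> OX; rewrite clsE // O8_invmx. Qed.

Lemma clsM X Y : O8 X -> O8 Y -> (cls X * cls Y)%g = cls (X *m Y).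
Proof.
move=> OX OY; apply: aut_ext => u.
by rewrite aut_mulE !clsTE //; [rewrite trmx_mul !mulmxA | exact: O8_mul].
Qed.

Lemma cls1 : cls 1%:M = 1%g :> autso8 R.
Proof.
apply: aut_ext => u.
by rewrite clsTE ?aut_1E ?mul1mx ?trmx1 ?mulmx1 //; apply: O8_1.
Qed.

Lemma clsV X : O8 X -> ((cls X)^-1)%g = cls X^T.
Proof.
move=> OX; have OT := O8_tr OX.
apply: (@mulgI _ (cls X)); rewrite mulgV clsM //.
by rewrite [X in cls X]OX cls1.
Qed.

Lemma clsN X : O8 X -> cls (- X) = cls X.
Proof. by move=> OX; apply/(cls_eq (O8_opp OX) OX); right; rewrite opprK. Qed.

Lemma clsJ X Y : O8 X -> O8 Y -> (cls X ^ cls Y)%g = cls (Y^T *m X *m Y).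
Proof.
move=> OX OY; have OT := O8_tr OY.
by rewrite /conjg clsV // clsM // clsM ?mulmxA //; apply: O8_mul.
Qed.

End Orthogonal.

(** * Signed permutation matrices *)

(** The i-th pair (j, b) of a table says that row i of the matrix has its only
    nonzero entry in column j, equal to -1 if b and to 1 otherwise. Operations on
    tables mirror operations on matrices and compute inside the kernel. *)
Definition sperm := seq (nat * bool).

Section SignedPermutations.

Definition entry (s : sperm) i : nat * bool := nth (0, false)%N s i.

Definition smul (s t : sperm) : sperm :=
  [seq ((entry t p.1).1, p.2 (+) (entry t p.1).2) | p <- s].

Definition sneg (s : sperm) : sperm := [seq (p.1, ~~ p.2) | p <- s].

Definition sdiag (v : seq bool) : sperm := zip (iota 0 (size v)) v.

Definition sone : sperm := sdiag (nseq 8 false).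

Definition row_of_col (s : sperm) j := find (fun p => p.1 == j) s.

Definition str (s : sperm) : sperm :=
  mkseq (fun j => let i := row_of_col s j in (i, (entry s i).2)) 8.

Definition sok (s : sperm) :=
  [&& size s == 8, all (fun p => p.1 < 8) s & uniq (unzip1 s)].

(** A matrix and its opposite have the same class; the representative chosen here
    has a positive entry in its first row. *)
Definition canon (s : sperm) := if (entry s 0).2 then sneg s else s.

Lemma sok_size s : sok s -> size s = 8. Proof. by case/and3P=> /eqP. Qed.

Lemma sok_entry s i : sok s -> i < 8 -> (entry s i).1 < 8.
Proof.
case/and3P=> /eqP ss /allP all8 _ i8; apply: (all8 (entry s i)).
by rewrite mem_nth // ss.
Qed.

Lemma sok_inj s i j : sok s -> i < 8 -> j < 8 ->
  (entry s i).1 = (entry s j).1 -> i = j.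
Proof.
case/and3P=> /eqP ss _ us i8 j8.
rewrite -!(nth_map _ 0) ?ss // => /eqP.
by rewrite nth_uniq ?size_map ?ss // => /eqP.
Qed.

Definition srow s (ok : sok s) (i : 'I_8) : 'I_8 :=
  Ordinal (sok_entry ok (ltn_ord i)).

Lemma srow_inj s (ok : sok s) : injective (srow ok).
Proof. by move=> i j [] /(sok_inj ok) e; apply/val_inj/e. Qed.

Lemma entry_smul s t i : size s = 8 -> i < 8 ->
  entry (smul s t) i =
  ((entry t (entry s i).1).1, (entry s i).2 (+) (entry t (entry s i).1).2).
Proof. by move=> ss i8; rewrite /entry /smul (nth_map (0, false)%N) ?ss. Qed.

Lemma entry_sneg s i : size s = 8 -> i < 8 ->
  entry (sneg s) i = ((entry s i).1, ~~ (entry s i).2).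
Proof. by move=> ss i8; rewrite /entry /sneg (nth_map (0, false)%N) ?ss. Qed.

Lemma entry_str s j : j < 8 ->
  entry (str s) j = (row_of_col s j, (entry s (row_of_col s j)).2).
Proof. by move=> j8; rewrite /entry /str nth_mkseq. Qed.

Lemma sok_row s (j : nat) : sok s -> j < 8 ->
  exists2 i, i < 8 & (entry s i).1 = j.
Proof.
move=> ok j8.
have /codomP[i ij] : Ordinal j8 \in codom (srow ok) by exact: (inj_card_onto (@srow_inj _ ok)).
by exists i => //; apply: esym (congr1 val ij).
Qed.

Lemma entry_row_of_col s j : sok s -> j < 8 ->
  row_of_col s j < 8 /\ (entry s (row_of_col s j)).1 = j.
Proof.
move=> ok j8; have [k k8 kj] := sok_row ok j8.
have hs : has (fun p => p.1 == j) s.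
  by apply/hasP; exists (entry s k); rewrite ?kj // mem_nth // sok_size.
split; first by rewrite -(sok_size ok) -has_find.
by apply/eqP; exact: (nth_find (0, false)%N hs).
Qed.

Lemma row_of_colP s i j : sok s -> i < 8 -> j < 8 ->
  (row_of_col s j == i) = ((entry s i).1 == j).
Proof.
move=> ok i8 j8; have [r8 rE] := entry_row_of_col ok j8.
by apply/eqP/eqP => [<-|] //; rewrite -[in RHS]rE => /(sok_inj ok) ->.
Qed.

Lemma sok_smul s t : sok s -> sok t -> sok (smul s t).
Proof.
move=> oks okt; have ss := sok_size oks.
apply/and3P; split; first by rewrite size_map ss.
  apply/allP => p /(nthP (0, false)%N)[i]; rewrite size_map ss => i8 <-.
  by rewrite [nth _ _ _]entry_smul //=; do 2!apply: sok_entry => //.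
apply/(uniqP 0) => i j; rewrite !inE !size_map ss => i8 j8.
rewrite !(nth_map (0, false)%N) ?size_map ?ss // => e.
by apply: (sok_inj oks) => //; apply: (sok_inj okt); rewrite ?sok_entry.
Qed.

Lemma sok_str s : sok s -> sok (str s).
Proof.
move=> ok; apply/and3P; split; first by rewrite size_mkseq.
  apply/allP => p /(nthP (0, false)%N)[j]; rewrite size_mkseq => j8 <-.
  by rewrite [nth _ _ _]entry_str //=; have [] := entry_row_of_col ok j8.
apply/(uniqP 0) => i j; rewrite !inE !size_map size_iota => i8 j8.
rewrite !(nth_map (0, false)%N) ?size_mkseq // !nth_mkseq //= => e.
have [_ <-] := entry_row_of_col ok i8; have [_ <-] := entry_row_of_col ok j8.
by rewrite e.
Qed.

Lemma sok_sneg s : sok s -> sok (sneg s).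
Proof.
case/and3P=> ss all8 us; rewrite /sok size_map ss all_map /= all8 /=.
by rewrite /unzip1 -map_comp.
Qed.

Lemma sok_sdiag v : size v = 8 -> sok (sdiag v).
Proof.
move=> v8; rewrite /sok /sdiag size_zip size_iota minnn v8 /=.
rewrite unzip1_zip ?iota_uniq ?size_iota ?v8 // andbT.
by rewrite -(all_map fst (fun i => i < 8)) [map _ _]unzip1_zip ?size_iota ?v8.
Qed.

Lemma entry_sdiag v i : i < size v -> entry (sdiag v) i = (i, nth false v i).
Proof. by move=> iv; rewrite /entry /sdiag nth_zip ?size_iota // nth_iota. Qed.

Lemma sok_canon s : sok s -> sok (canon s).
Proof. by rewrite /canon; case: ifP => // _ /sok_sneg. Qed.

Lemma snegK s : sneg (sneg s) = s.
Proof. by rewrite /sneg -map_comp -[RHS]map_id; apply: eq_map => -[i b] /=; rewrite negbK. Qed.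

Lemma canon_sneg s : size s = 8 -> canon (sneg s) = canon s.
Proof.
by move=> ss; rewrite /canon entry_sneg //=; case: (_.2) => //=; rewrite snegK.
Qed.

End SignedPermutations.

Section SignedMatrices.
Local Open Scope ring_scope.
Variable R : realType.

Definition smx_n n (s : sperm) : 'M[R]_n :=
  \matrix_(i, j) ((-1) ^+ (entry s i).2 *+ ((entry s i).1 == j)).
Definition smx s : 'M[R]_8 := smx_n 8 s.

Lemma smxE s i j : smx s i j = (-1) ^+ (entry s i).2 *+ ((entry s i).1 == j).
Proof. by rewrite mxE. Qed.

Lemma smx_mulmx s (ok : sok s) m (A : 'M[R]_(8, m)) i j :
  (smx s *m A) i j = (-1) ^+ (entry s i).2 * A (srow ok i) j.
Proof.
rewrite mxE (bigD1 (srow ok i)) //= smxE eqxx mulr1n big1 ?addr0 // => k.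
by rewrite -val_eqE /= eq_sym smxE => /negPf ->; rewrite mulr0n mul0r.
Qed.

Lemma mulmx_trsmx s (ok : sok s) m (A : 'M[R]_(m, 8)) i j :
  (A *m (smx s)^T) i j = (-1) ^+ (entry s j).2 * A i (srow ok j).
Proof.
by rewrite -[A]trmxK -trmx_mul mxE (smx_mulmx ok) !mxE.
Qed.

Lemma smx_smul s t : sok s -> smx (smul s t) = smx s *m smx t.
Proof.
move=> ok; apply/matrixP => i j.
by rewrite (smx_mulmx ok) !smxE entry_smul ?sok_size // signr_addb mulrnAr.
Qed.

Lemma smx_sneg s : sok s -> smx (sneg s) = - smx s.
Proof.
move=> ok; apply/matrixP => i j.
by rewrite [RHS]mxE !smxE entry_sneg ?sok_size //= signrN mulNrn.
Qed.

Lemma smx_str s : sok s -> smx (str s) = (smx s)^T.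
Proof.
move=> ok; apply/matrixP => j i; rewrite [RHS]mxE !smxE entry_str //=.
case: eqP (row_of_colP ok (ltn_ord i) (ltn_ord j)) => [->|_] <- //.
Qed.

Lemma smx_sdiag v : size v = 8 ->
  smx (sdiag v) = \matrix_(i, j) ((-1) ^+ nth false v i *+ (i == j)).
Proof. by move=> v8; apply/matrixP => i j; rewrite !mxE entry_sdiag ?v8. Qed.

Lemma smx_sone : smx sone = 1%:M.
Proof.
rewrite smx_sdiag //; apply/matrixP => i j; rewrite !mxE.
by rewrite nth_nseq if_same.
Qed.

Lemma O8_smx s : sok s -> O8 (smx s).
Proof.
move=> ok; apply/matrixP => i j; rewrite (mulmx_trsmx ok) smxE mxE.
have -> : ((entry s i).1 == srow ok j) = (i == j).
  by rewrite -[(entry s i).1]/(val (srow ok i)) val_eqE (inj_eq (@srow_inj _ ok)).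
by case: eqP => [->|_]; rewrite ?mulr0n ?mulr0 // !mulr1n -signr_addb addbb.
Qed.

Lemma smx_inj s t : sok s -> sok t -> smx s = smx t -> s = t.
Proof.
move=> oks okt st; apply: (@eq_from_nth _ (0, false)%N).
  by rewrite !sok_size.
move=> i; rewrite sok_size // => i8.
have /matrixP/(_ (Ordinal i8) (srow oks (Ordinal i8))) := st.
rewrite !smxE eqxx mulr1n /=.
case: eqP => [e|_]; last by move/eqP; rewrite mulr0n signr_eq0.
rewrite mulr1n => /signr_inj e2.
by rewrite -!/(entry _ _) [LHS]surjective_pairing -e e2 -surjective_pairing.
Qed.
Definition scls s : autso8 R := cls (smx s).

Lemma scls_canon s : sok s -> scls (canon s) = scls s.
Proof.
move=> ok; rewrite /canon; case: ifP => // _.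
by rewrite /scls smx_sneg // clsN //; apply: O8_smx.
Qed.

Lemma scls_eq s t : sok s -> sok t -> (scls s == scls t) = (canon s == canon t).
Proof.
move=> oks okt; apply/eqP/eqP => [|st]; last first.
  by rewrite -(scls_canon oks) st scls_canon.
move/(cls_eq (O8_smx oks) (O8_smx okt)) => -[/esym/smx_inj ->//|].
rewrite -smx_sneg // => /smx_inj -> //; last exact: sok_sneg.
by rewrite canon_sneg ?sok_size.
Qed.

Lemma scls_smul s t : sok s -> sok t -> (scls s * scls t)%g = scls (smul s t).
Proof. by move=> oks okt; rewrite /scls clsM ?smx_smul //; apply: O8_smx. Qed.

Lemma scls_sone : scls sone = 1%g.
Proof. by rewrite /scls smx_sone cls1. Qed.

Lemma sclsV s : sok s -> ((scls s)^-1)%g = scls (str s).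
Proof. by move=> ok; rewrite /scls smx_str // clsV //; apply: O8_smx. Qed.

End SignedMatrices.

(** * The nine groups as groups of signed permutation matrices *)

Section Tables.

Definition sblock (s t : sperm) : sperm :=
  s ++ [seq (size s + p.1, p.2) | p <- t].
Definition sblock4 (s t u v : sperm) := sblock s (sblock t (sblock u v)).
Definition sI p q : sperm := mkseq (fun i => (i, i < p)) (p + q).
Definition sJ n : sperm :=
  mkseq (fun i => if i < n then (n + i, false) else (i - n, true)) (n + n).
Definition sJ' n : sperm :=
  mkseq (fun i => if i < n then (n + i, false) else (i - n, false)) (n + n).

Definition tD := sblock4 (sI 1 1) (sI 1 1) (sI 1 1) (sI 1 1).
Definition tE := sblock4 (sJ' 1) (sJ' 1) (sJ' 1) (sJ' 1).

Definition gens13 := [:: sI 4 4; sJ' 4; sblock (sI 2 2) (sI 2 2);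
  sblock (sJ' 2) (sJ' 2); tD; tE].
Definition gens14 := [:: sI 4 4; sblock (sI 2 2) (sI 2 2);
  sblock (sJ' 2) (sJ' 2); tD; tE].
Definition gens15 := [:: sI 4 4; sblock (sI 2 2) (sI 2 2);
  sblock (sJ' 2) (sJ' 2); tD; sblock4 (sJ' 1) (sJ' 1) (sJ 1) (sJ 1)].
Definition gens16 := [:: sI 4 4; sblock (sI 2 2) (sI 2 2); tD; tE].
Definition gens17 := [:: sI 4 4; sI 2 6; sI 6 2; tD; tE].
Definition gens18 := [:: sI 4 4; sI 2 6; sI 6 2; tD;
  sblock4 (sJ' 1) (sJ' 1) (sJ' 1) (sJ 1)].
Definition gens19 := [:: sI 4 4; sI 2 6; sI 6 2; tD;
  sblock4 (sJ' 1) (sJ' 1) (sJ 1) (sJ 1)].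
Definition gens20 := [:: sI 4 4; sI 2 6; sI 6 2;
  sblock4 (sI 1 1) (sI 1 1) (sI 1 1) (sJ 1);
  sblock4 (sJ' 1) (sJ' 1) (sJ 1) (sI 1 1)].
Definition gens21 := [:: sI 4 4; sblock (sI 2 2) (sI 2 2); tD].

End Tables.

Section TableMatrices.
Local Open Scope ring_scope.
Variable R : realType.
Notation smx_n := (smx_n R).

Lemma smx_n_block m n s t : size s = m -> size t = n ->
    all (fun p => p.1 < m)%N s ->
  block_mx (smx_n m s) 0 0 (smx_n n t) = smx_n (m + n) (sblock s t).
Proof.
move=> sm tn sall; apply/matrixP => i j.
rewrite -(fintype.splitK i) -(fintype.splitK j).
case: (fintype.split i) => {}i; case: (fintype.split j) => {}j;
  rewrite ?block_mxEul ?block_mxEur ?block_mxEdl ?block_mxEdr !mxE /=;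
  rewrite /entry nth_cat sm ?ltn_ord //.
- have /(allP sall) : nth (0, false)%N s i \in s by rewrite mem_nth ?sm.
  by case: eqP => // ->; rewrite -ltn_subRL subnn.
- rewrite -[X in (_ < X)%N]addn0 ltn_add2l ltn0 addKn.
  rewrite (nth_map (0, false)%N) ?tn //=.
  by case: eqP (ltn_ord j) => // <-; rewrite -ltn_subRL subnn.
- rewrite -[X in (_ < X)%N]addn0 ltn_add2l ltn0 addKn.
  by rewrite (nth_map (0, false)%N) ?tn //= eqn_add2l.
Qed.

Lemma smx_n_I p q : Ipq R p q = smx_n (p + q) (sI p q).
Proof.
apply/matrixP => i j; rewrite [RHS]mxE /entry nth_mkseq //=.
rewrite -(fintype.splitK i) -(fintype.splitK j).
case: (fintype.split i) => {}i; case: (fintype.split j) => {}j;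
  rewrite ?block_mxEul ?block_mxEur ?block_mxEdl ?block_mxEdr ?mxE /=.
- by rewrite ltn_ord -mulNrn.
- by case: eqP (ltn_ord i) => // ->; rewrite -ltn_subRL subnn.
- by case: eqP (ltn_ord j) => // <-; rewrite -ltn_subRL subnn.
- by rewrite -[X in (_ < X)%N]addn0 ltn_add2l ltn0 eqn_add2l.
Qed.

Lemma smx_n_J n : Jn R n = smx_n (n + n) (sJ n).
Proof.
apply/matrixP => i j; rewrite [RHS]mxE /entry nth_mkseq //=.
rewrite -(fintype.splitK i) -(fintype.splitK j).
case: (fintype.split i) => {}i; case: (fintype.split j) => {}j;
  rewrite ?block_mxEul ?block_mxEur ?block_mxEdl ?block_mxEdr ?mxE /=.
- rewrite ltn_ord /=.
  by case: eqP (ltn_ord j) => // <-; rewrite -ltn_subRL subnn.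
- by rewrite ltn_ord /= eqn_add2l.
- by rewrite -[X in (_ < X)%N]addn0 ltn_add2l ltn0 addKn /= -mulNrn.
- rewrite -[X in (_ < X)%N]addn0 ltn_add2l ltn0 addKn /=.
  by case: eqP (ltn_ord i) => // ->; rewrite -ltn_subRL subnn.
Qed.

Lemma smx_n_J' n : Jn' R n = smx_n (n + n) (sJ' n).
Proof.
apply/matrixP => i j; rewrite [RHS]mxE /entry nth_mkseq //=.
rewrite -(fintype.splitK i) -(fintype.splitK j).
case: (fintype.split i) => {}i; case: (fintype.split j) => {}j;
  rewrite ?block_mxEul ?block_mxEur ?block_mxEdl ?block_mxEdr ?mxE /=.
- rewrite ltn_ord /=.
  by case: eqP (ltn_ord j) => // <-; rewrite -ltn_subRL subnn.
- by rewrite ltn_ord /= eqn_add2l.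
- by rewrite -[X in (_ < X)%N]addn0 ltn_add2l ltn0 addKn /=.
- rewrite -[X in (_ < X)%N]addn0 ltn_add2l ltn0 addKn /=.
  by case: eqP (ltn_ord i) => // ->; rewrite -ltn_subRL subnn.
Qed.

Lemma diag2_smx s t : size s = 4%N -> size t = 4%N ->
    all (fun p => p.1 < 4)%N s ->
  diag2 (smx_n 4 s) (smx_n 4 t) = smx R (sblock s t).
Proof. by move=> *; apply: (@smx_n_block 4 4). Qed.

Lemma diag4_smx s t u v :
    all (fun s => (size s == 2%N) && all (fun p => p.1 < 2)%N s) [:: s; t; u; v] ->
  diag4 (smx_n 2 s) (smx_n 2 t) (smx_n 2 u) (smx_n 2 v) = smx R (sblock4 s t u v).
Proof.
rewrite /= andbT => /and4P[/andP[/eqP s2 ls] /andP[/eqP t2 lt]].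
move=> /andP[/eqP u2 lu] /andP[/eqP v2 lv].
rewrite /diag4 (smx_n_block u2 v2 lu).
rewrite (@smx_n_block 2 (2 + 2)) // ?size_cat ?size_map ?u2 ?v2 //.
by apply: (@smx_n_block 2 6) => //; rewrite !size_cat !size_map t2 size_cat size_map u2 v2.
Qed.

Definition sgroup gens : set (autso8 R) := class_group [seq smx R s | s <- gens].

Let tableE := (diag4_smx, diag2_smx, smx_n_I, smx_n_J, smx_n_J').

Lemma F13E : F13 R = sgroup gens13.
Proof. by rewrite /F13 /mxD /Defs.mxE !tableE. Qed.
Lemma F14E : F14 R = sgroup gens14.
Proof. by rewrite /F14 /mxD /Defs.mxE !tableE. Qed.
Lemma F15E : F15 R = sgroup gens15.
Proof. by rewrite /F15 /mxD /Defs.mxE !tableE. Qed.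
Lemma F16E : F16 R = sgroup gens16.
Proof. by rewrite /F16 /mxD /Defs.mxE !tableE. Qed.
Lemma F17E : F17 R = sgroup gens17.
Proof. by rewrite /F17 /mxD /Defs.mxE !tableE. Qed.
Lemma F18E : F18 R = sgroup gens18.
Proof. by rewrite /F18 /mxD /Defs.mxE !tableE. Qed.
Lemma F19E : F19 R = sgroup gens19.
Proof. by rewrite /F19 /mxD /Defs.mxE !tableE. Qed.
Lemma F20E : F20 R = sgroup gens20.
Proof. by rewrite /F20 /mxD /Defs.mxE !tableE. Qed.
Lemma F21E : F21 R = sgroup gens21.
Proof. by rewrite /F21 /mxD /Defs.mxE !tableE. Qed.

End TableMatrices.

Arguments sgroup : clear implicits.

(** * Listing a finite group, and the trace of an automorphism *)

Section ReflectedGroups.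

(** All products of subsets of the generators. The groups below are abelian and the
    squares of their generators are products of earlier generators up to sign, so
    these products exhaust the group; [sgroup_ok] checks it. *)
Definition sprods (gens : seq sperm) : seq sperm :=
  foldr (fun g l => l ++ map (smul g) l) [:: sone] gens.

Definition slist gens := [seq canon s | s <- sprods gens].

Definition sgroup_ok gens :=
  let l := slist gens in
  [&& all sok gens, all (fun g => canon g \in l) gens,
      all (fun s => canon (str s) \in l) l &
      all (fun s => all (fun t => canon (smul s t) \in l) l) l].

Lemma sok_sprods gens : all sok gens -> all sok (sprods gens).
Proof.
elim: gens => //= g gens IH /andP[okg /IH okl].
rewrite all_cat okl all_map; apply/allP => s /(allP okl) oks /=.
exact: sok_smul.
Qed.

Lemma sok_slist gens : all sok gens -> all sok (slist gens).
Proof.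
move=> /sok_sprods/allP ok; rewrite all_map; apply/allP => s /ok /=.
exact: sok_canon.
Qed.

Variable R : realType.
Local Notation scls := (scls R).

Lemma sgroupE gens : sgroup_ok gens ->
  sgroup R gens = [set` [seq scls s | s <- slist gens]].
Proof.
case/and4P=> okg /allP gl /allP Vl /allP Ml.
have /allP okl := sok_slist okg.
apply/seteqP; split.
  apply: generated_sub => [|_ [_ /mapP[g gin ->] <-]]; last first.
    apply/mapP; exists (canon g); first exact: gl.
    by rewrite scls_canon //; apply: (allP okg).
  split.
  - apply/mapP; exists (canon sone); last by rewrite scls_sone.
    apply/map_f; elim: (gens) => //= g l IH.
    by rewrite mem_cat IH.
  - move=> _ _ /mapP[s sl ->] /mapP[t tl ->].
    apply/mapP; exists (canon (smul s t)); first exact: (allP (Ml s sl)).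
    by rewrite scls_canon ?scls_smul ?sok_smul ?okl.
  - move=> _ /mapP[s sl ->]; apply/mapP; exists (canon (str s)).
      exact: Vl.
    by rewrite sclsV ?okl // scls_canon // sok_str ?okl.
move=> _ /mapP[_ /mapP[s sin ->] ->].
rewrite scls_canon; last exact: (allP (sok_sprods okg)).
have [G1 GM _] : is_subgroup (sgroup R gens) by apply: generated_subgroup.
have GS : {in gens, forall g, sgroup R gens (scls g)}.
  by move=> g gin; apply: sub_generated; exists (smx R g) => //; apply: map_f.
move: (sgroup R gens) G1 GM GS => G G1 GM GS.
elim: (gens) okg GS s sin => /= [|g l IH] okg GS s.
  by rewrite inE => /eqP ->; rewrite scls_sone.
case/andP: okg => okg okl'.
have {}IH := IH okl' (fun h hl => GS h (@mem_behead _ (g :: l) h hl)).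
rewrite mem_cat => /orP[/IH//|/mapP[t tl ->]].
rewrite -scls_smul //; last exact: (allP (sok_sprods okl')).
by apply: GM; [apply: GS; rewrite mem_head | apply: IH].
Qed.

End ReflectedGroups.

Section Invariants.
Local Open Scope ring_scope.
Variable R : realType.
Implicit Types (f g : autso8 R) (u : so8 R).

Lemma vsvalZ (a : R) u : vsval (a *: u) = a *: vsval u.
Proof. exact: linearZ. Qed.

Lemma vsvalMn u n : vsval (u *+ n) = vsval u *+ n.
Proof. exact: raddfMn. Qed.

Lemma vsval_sum I r P (F : I -> so8 R) :
  vsval (\sum_(i <- r | P i) F i) = \sum_(i <- r | P i) vsval (F i).
Proof. exact: raddf_sum. Qed.

Lemma autMn f u n : f (u *+ n) = f u *+ n.
Proof. exact: raddfMn. Qed.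

Lemma aut_sum f I r P (F : I -> so8 R) :
  f (\sum_(i <- r | P i) F i) = \sum_(i <- r | P i) f (F i).
Proof. exact: linear_sum. Qed.

Lemma autZ f (a : R) u : f (a *: u) = a *: f u.
Proof. exact: linearZ. Qed.

Definition skew_delta (i j : 'I_8) : 'M[R]_8 := delta_mx i j - delta_mx j i.

Definition so8_delta i j : so8 R := vsproj (so8_space R) (skew_delta i j).

Lemma so8_deltaE i j : vsval (so8_delta i j) = skew_delta i j.
Proof. by rewrite vsprojK // mem_so8 linearB /= !trmx_delta opprB. Qed.

Lemma so8_skew u i j : vsval u i j = - vsval u j i.
Proof. by have := subvsP u; rewrite mem_so8 => /eqP/matrixP/(_ j i); rewrite !mxE. Qed.

Lemma so8_sum_delta u :
  u *+ 2 = \sum_i \sum_j vsval u i j *: so8_delta i j.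
Proof.
apply: val_inj; rewrite [LHS]vsvalMn [RHS]vsval_sum.
under eq_bigr do rewrite vsval_sum.
under eq_bigr do under eq_bigr do rewrite vsvalZ so8_deltaE scalerBr.
under eq_bigr do rewrite sumrB.
rewrite sumrB -matrix_sum_delta exchange_big /= -sumrN mulr2n; congr (_ + _).
rewrite [LHS]matrix_sum_delta; apply: eq_bigr => i _; rewrite -sumrN.
by apply: eq_bigr => j _; rewrite so8_skew scaleNr.
Qed.

(** Twice the trace of an automorphism, as the entries (i, j) and (j, i) of a skew
    matrix are opposite. Summing over all pairs avoids choosing a basis. *)
Definition adtrace f : R := \sum_i \sum_j vsval (f (so8_delta i j)) i j.

(** The right-hand side is symmetric in f and g up to renaming the indices, which
    is the trace property. *)
Lemma adtraceM f g : adtrace (f * g)%g *+ 2 =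
  \sum_i \sum_j \sum_k \sum_l
    vsval (g (so8_delta i j)) k l * vsval (f (so8_delta k l)) i j.
Proof.
rewrite -sumrMnl; apply: eq_bigr => i _; rewrite -sumrMnl; apply: eq_bigr => j _.
rewrite aut_mulE -mulmxnE -vsvalMn -autMn so8_sum_delta.
rewrite aut_sum vsval_sum summxE; apply: eq_bigr => k _.
rewrite aut_sum vsval_sum summxE; apply: eq_bigr => l _.
by rewrite autZ vsvalZ mxE.
Qed.


Lemma adtraceC f g : adtrace (f * g)%g = adtrace (g * f)%g.
Proof.
apply: (@pmulrnI R 2) => //; rewrite !adtraceM.
under eq_bigr do rewrite exchange_big.
rewrite exchange_big; apply: eq_bigr => k _.
under eq_bigr do rewrite exchange_big.
rewrite exchange_big; apply: eq_bigr => l _.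
by apply: eq_bigr => i _; apply: eq_bigr => j _; rewrite mulrC.
Qed.

Lemma adtraceJ f g : adtrace (f ^ g)%g = adtrace f.
Proof. by rewrite /conjg adtraceC mulgK. Qed.

Lemma mulmx_delta (X Y : 'M[R]_8) i j k l :
  (X *m delta_mx i j *m Y) k l = X k i * Y j l.
Proof.
rewrite mxE (bigD1 j) //= big1 ?addr0 => [|m /negPf mj].
  rewrite mxE (bigD1 i) //= big1 ?addr0 => [|m /negPf mi].
    by rewrite mxE !eqxx mulr1.
  by rewrite mxE mi mulr0.
by rewrite mxE big1 ?mul0r // => n _; rewrite mxE mj andbF mulr0.
Qed.

Lemma adtrace_cls X : O8 X -> adtrace (cls X) = (\tr X) ^+ 2 - \tr (X *m X).
Proof.
move=> OX; rewrite /adtrace expr2 [\tr X]/mxtrace mulr_suml -sumrB.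
apply: eq_bigr => i _; rewrite mulr_sumr mxE -sumrB; apply: eq_bigr => j _.
by rewrite clsTE // so8_deltaE mulmxBr mulmxBl [LHS]mxE [X in _ + X]mxE
  !mulmx_delta ![_^T _ _]mxE.
Qed.

End Invariants.

Section TableInvariants.
Local Open Scope ring_scope.

Definition strace (s : sperm) : int :=
  foldr (fun i z => (-1) ^+ (entry s i).2 *+ ((entry s i).1 == i) + z) 0 (iota 0 8).
Definition sadtrace s : int := strace s ^+ 2 - strace (smul s s).

Lemma straceE (R : realType) s : \tr (smx R s) = (strace s)%:~R.
Proof.
rewrite /strace -(foldr_map (fun i => (-1) ^+ (entry s i).2 *+ ((entry s i).1 == i)) +%R).
rewrite foldrE big_map -[iota 0 8]/(index_iota 0 8) big_mkord rmorph_sum.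
by apply: eq_bigr => i _; rewrite smxE rmorphMn rmorph_sign.
Qed.

Lemma sadtraceE (R : realType) s : sok s -> adtrace (scls R s) = (sadtrace s)%:~R.
Proof.
move=> ok; rewrite adtrace_cls; last exact: O8_smx.
by rewrite -smx_smul // !straceE rmorphB rmorphXn.
Qed.

End TableInvariants.

(** * Conjugation invariants of finite groups *)

Section Profile.
Local Open Scope ring_scope.
Variable R : realType.
Implicit Types (l : seq (autso8 R)) (f x : autso8 R).

(** The value 8 of [adtrace] is that of the classes of I_(2,6) and of J_4, which
    are conjugate by means of triality; the other involutions below have value -8. *)
Definition profile l : seq nat :=
  [:: size l;
      count (fun f => f * f == 1)%g l;
      count (fun f => adtrace (f * f)%g == 8%:R) l;
      count (fun z => all (fun f =>
        (adtrace (z * f)%g == 8%:R) == (adtrace f == 8%:R)) l) l].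

Lemma profile_conj l1 l2 x : uniq l1 -> uniq l2 ->
  conj_set [set` l1] x = [set` l2] -> profile l1 = profile l2.
Proof.
move=> u1 u2 l12.
have p12 : perm_eq [seq (f ^ x)%g | f <- l1] l2.
  apply: uniq_perm => //; first by rewrite map_inj_uniq //; apply: conjg_inj.
  move=> f; apply/mapP/idP => [[g gl ->]|fl].
    by have : [set` l2] (g ^ x)%g by rewrite -l12; exists g.
  have : conj_set [set` l1] x f by rewrite l12.
  by case=> g gl <-; exists g.
have cE (p q : pred (autso8 R)) : (forall f, q (f ^ x)%g = p f) ->
    count p l1 = count q l2.
  by move=> pq; rewrite -(seq.permP p12) count_map; apply: eq_count => f /=.
congr [:: _; _; _; _].
- by rewrite -(perm_size p12) size_map.
- by apply: cE => f; rewrite -conjMg -{1}(conj1g x) (inj_eq (@conjg_inj _ x)).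
- by apply: cE => f; rewrite -conjMg adtraceJ.
- apply: cE => f; rewrite -(perm_all _ p12) all_map.
  by apply: eq_all => g /=; rewrite -conjMg !adtraceJ.
Qed.

Definition sprofile (l : seq sperm) : seq nat :=
  [:: size l;
      count (fun s => canon (smul s s) == sone) l;
      count (fun s => sadtrace (smul s s) == 8) l;
      count (fun z => all (fun s =>
        (sadtrace (smul z s) == 8) == (sadtrace s == 8)) l) l].

Lemma profile_scls (l : seq sperm) : all sok l ->
  profile [seq scls R s | s <- l] = sprofile l.
Proof.
move/allP=> okl.
have trE s : sok s -> (adtrace (scls R s) == 8%:R) = (sadtrace s == 8).
  by move=> ok; rewrite sadtraceE // -[8%:R]/((8 : int)%:~R) eqr_int.
rewrite /profile size_map !count_map; congr [:: _; _; _; _].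
- apply: eq_in_count => s /okl ok /=.
  by rewrite scls_smul // -scls_sone scls_eq // sok_smul.
- by apply: eq_in_count => s /okl ok /=; rewrite scls_smul // trE // sok_smul.
- apply: eq_in_count => z /okl okz /=; rewrite all_map.
  by apply: eq_in_all => s /okl ok /=; rewrite scls_smul // !trE // sok_smul.
Qed.

Lemma uniq_scls (l : seq sperm) : all sok l -> uniq [seq canon s | s <- l] ->
  uniq [seq scls R s | s <- l].
Proof.
elim: l => //= s l IH /andP[ok okl] /andP[sl ul].
rewrite IH // andbT; apply: contra sl => /mapP[t tl /eqP].
rewrite scls_eq // ?(allP okl) // => /eqP st.
by apply/mapP; exists t.
Qed.

Lemma canonK s : sok s -> canon (canon s) = canon s.
Proof.
by move=> /sok_size ss; rewrite {2}/canon; case: ifP; rewrite // canon_sneg.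
Qed.

Lemma canon_slist gens : all sok gens ->
  [seq canon s | s <- slist gens] = slist gens.
Proof.
move=> /sok_sprods/allP okg; rewrite /slist -map_comp.
by apply/eq_in_map => s /okg /canonK.
Qed.

Definition group_tables :=
  [:: gens13; gens14; gens16; gens17; gens18; gens19; gens20; gens21].


Lemma group_tables_ok : all (fun g => sgroup_ok g && uniq (slist g)) group_tables.
Proof. by vm_compute. Qed.

(** The profiles are (64, 64, 0, 1), (32, 32, 0, 2), (16, 16, 0, 4),
    (32, 32, 0, 4), (32, 16, 16, 4), (32, 16, 0, 4), (32, 8, 16, 4) and
    (8, 8, 0, 8). *)
Lemma group_profiles_uniq : uniq [seq sprofile (slist g) | g <- group_tables].
Proof. by vm_compute. Qed.

Theorem nonconjugate (i j : nat) :
    let L := [:: F13 R; F14 R; F16 R; F17 R; F18 R; F19 R; F20 R; F21 R] in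
  (i < j < size L)%N -> ~ conjugate_sets (nth set0 L i) (nth set0 L j).
Proof.
move=> L /andP[ij j8] [x].
have -> : L = [seq sgroup R g | g <- group_tables].
  by rewrite /L F13E F14E F16E F17E F18E F19E F20E F21E.
have {}j8 : (j < 8)%N := j8; have i8 := ltn_trans ij j8.
rewrite !(nth_map [::]) //.
have tab k : (k < 8)%N -> let g := nth [::] group_tables k in
    [/\ sgroup_ok g, all sok (slist g) & uniq [seq scls R s | s <- slist g]].
  move=> k8; have /(allP group_tables_ok)/andP[ok ul] := @mem_nth _ [::] group_tables k k8.
  have okl : all sok (slist (nth [::] group_tables k)).
    by apply: sok_slist; case/and4P: ok.
  split=> //; apply: uniq_scls => //.
  by rewrite canon_slist //; case/and4P: ok.
have [oki sli uli] := tab i i8; have [okj slj ulj] := tab j j8.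
rewrite !sgroupE // => /(profile_conj uli ulj); rewrite !profile_scls // => e.
have := @nth_uniq _ [::] [seq sprofile (slist g) | g <- group_tables] i j i8 j8
  group_profiles_uniq.
by rewrite !(nth_map [::]) // e eqxx ltn_eqF.
Qed.

End Profile.

(** * Triality *)

Section CliffordTables.

Definition parity3 n := odd n (+) odd n./2 (+) odd n./2./2.

(** The real Pauli matrix Z^b X^a on the third tensor power of R^2, with rows
    numbered by three bits. The b are chosen so that the eight matrices satisfy the
    Clifford relations: for distinct nonzero a, a' the products a.b and
    a.b' + a'.b are odd. *)
Definition cliff (a : nat) : sperm :=
  let b := nth 0 [:: 0; 1; 3; 6; 7; 4; 5; 2] a in
  [seq (Nat.lxor i a, parity3 (Nat.land b i)) | i <- iota 0 8].

Definition cliff2 i j := smul (cliff i) (str (cliff j)).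

Definition signed (b : bool) s := if b then sneg s else s.

Lemma cliff_ok : all (fun i => sok (cliff i)) (iota 0 8).
Proof. by []. Qed.

Lemma cliff_anticommute : all (fun i => all (fun j => (i != j) ==>
    (cliff2 j i == sneg (cliff2 i j)) &&
    (smul (str (cliff j)) (cliff i) == sneg (smul (str (cliff i)) (cliff j))))
  (iota 0 8)) (iota 0 8).
Proof. by vm_compute. Qed.

(** A product of four distinct Clifford matrices is traceless, so the products
    of two of them are orthogonal for the trace form. *)
Lemma cliff_traces : all (fun i => all (fun j => all (fun k => all (fun l =>
    (i != j) && (k != l) ==>
    (strace (smul (cliff2 i j) (cliff2 l k)) ==
     8 *+ ((i == k) && (j == l)) - 8 *+ ((i == l) && (j == k)))%R)
  (iota 0 8)) (iota 0 8)) (iota 0 8)) (iota 0 8).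
Proof. by vm_compute. Qed.

(** The condition under which conjugation by t acts on the products g_k g_l^T as
    the signed permutation s acts on the index pairs (k, l). *)
Definition intertwined (s t : sperm) := all (fun k => all (fun l =>
    smul (smul t (cliff2 (entry s k).1 (entry s l).1)) (str t) ==
    signed ((entry s k).2 (+) (entry s l).2) (cliff2 k l))
  (iota 0 8)) (iota 0 8).

End CliffordTables.

Section Triality.
Local Open Scope ring_scope.
Variable R : realType.
Implicit Types (u v : 'M[R]_8) (i j k l : 'I_8).

Definition gam i : 'M[R]_8 := smx R (cliff i).

Lemma all_ord8 (P : pred nat) : all P (iota 0 8) -> forall i, P i.
Proof. by move=> /allP allP8 i; apply: allP8; rewrite mem_iota /=. Qed.

Lemma sok_cliff i : sok (cliff i). Proof. exact: (all_ord8 cliff_ok). Qed.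

Lemma sok_cliff2 i j : sok (cliff2 i j).
Proof. by apply: sok_smul; [|apply: sok_str]; apply: sok_cliff. Qed.

Lemma gam2E i j : gam i *m (gam j)^T = smx R (cliff2 i j).
Proof. by rewrite smx_smul ?smx_str // sok_cliff. Qed.

Lemma gam_gamT i j :
  gam i *m (gam j)^T + gam j *m (gam i)^T = (2 *+ (i == j))%:M.
Proof.
case: eqVneq => [<-|ij].
  have -> : gam i *m (gam i)^T = 1%:M by apply/O8_smx/sok_cliff.
  by rewrite -raddfD.
have /(_ i)/all_ord8/(_ j) := all_ord8 cliff_anticommute.
rewrite ij implyTb => /andP[/eqP e _].
by rewrite !gam2E e smx_sneg ?subrr ?scalemx0 ?raddf0 // sok_cliff2.
Qed.

Lemma gamT_gam i j :
  (gam i)^T *m gam j + (gam j)^T *m gam i = (2 *+ (i == j))%:M.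
Proof.
case: eqVneq => [<-|ij].
  have -> : (gam i)^T *m gam i = 1%:M by apply/mulmx1C/O8_smx/sok_cliff.
  by rewrite -raddfD.
have /(_ i)/all_ord8/(_ j) := all_ord8 cliff_anticommute.
rewrite ij implyTb => /andP[_ /eqP e].
rewrite /gam -!smx_str ?sok_cliff // -!smx_smul ?sok_str ?sok_cliff // e.
by rewrite smx_sneg ?subrr ?raddf0 // sok_smul ?sok_str ?sok_cliff.
Qed.

Definition gsum u : 'M[R]_8 :=
  \sum_i \sum_j u i j *: (gam i *m (gam j)^T).

Fact gsum_linear : linear gsum.
Proof.
move=> a u v; rewrite /gsum scaler_sumr -big_split; apply: eq_bigr => i _ /=.
rewrite scaler_sumr -big_split; apply: eq_bigr => j _ /=.
by rewrite !mxE scalerDl scalerA.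
Qed.
HB.instance Definition _ :=
  GRing.isLinear.Build R 'M[R]_8 'M[R]_8 _ gsum gsum_linear.

(** The two half-spin representations of so(8), on the two halves of the Clifford
    module. *)
Definition spin u : 'M[R]_8 := 4^-1 *: gsum u.
Definition cospin u : 'M[R]_8 :=
  4^-1 *: \sum_i \sum_j u i j *: ((gam i)^T *m gam j).

Fact spin_linear : linear spin.
Proof. by move=> a u v; rewrite /spin linearP scalerDr !scalerA mulrC. Qed.
HB.instance Definition _ :=
  GRing.isLinear.Build R 'M[R]_8 'M[R]_8 _ spin spin_linear.

Definition skew u := u^T = - u.

Lemma skewE u i j : skew u -> u i j = - u j i.
Proof. by move=> /matrixP/(_ j i); rewrite !mxE. Qed.

Lemma skew_diag u i : skew u -> u i i = 0.
Proof.
move=> su; have /eqP := skewE i i su.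
by rewrite -addr_eq0 -mulr2n mulrn_eq0 => /eqP.
Qed.

Lemma spin_tr u : (spin u)^T = spin u^T.
Proof.
rewrite /spin [LHS]linearZ /gsum; congr (_ *: _); rewrite [LHS]raddf_sum exchange_big /=.
apply: eq_bigr => i _; rewrite [LHS]raddf_sum; apply: eq_bigr => j _ /=.
by rewrite linearZ /= trmx_mul trmxK mxE.
Qed.

Lemma cospin_tr u : (cospin u)^T = cospin u^T.
Proof.
rewrite /cospin [LHS]linearZ; congr (_ *: _); rewrite [LHS]raddf_sum exchange_big /=.
apply: eq_bigr => i _; rewrite [LHS]raddf_sum; apply: eq_bigr => j _ /=.
by rewrite linearZ /= trmx_mul trmxK mxE.
Qed.

Lemma gam3 i j k : gam i *m (gam j)^T *m gam k =
  gam k *m ((gam i)^T *m gam j) + (2 *+ (j == k)) *: gam i - (2 *+ (i == k)) *: gam j.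
Proof.
have e1 := canRL (addrK _) (gamT_gam j k).
have e2 := canRL (addrK _) (gam_gamT i k).
rewrite -mulmxA e1 mulmxBr mul_mx_scalar (mulmxA (gam i)) e2 mulmxBl.
by rewrite mul_scalar_mx -mulmxA opprB addrCA addrA.
Qed.

(** The Clifford relations move g_k through the products g_i g_j^T at the price of
    the two terms with i or j equal to k: the g_k span the vector representation. *)
Lemma spin_gam u k : skew u ->
  spin u *m gam k = gam k *m cospin u + \sum_i u i k *: gam i.
Proof.
move=> su; rewrite /spin /cospin -scalemxAl -scalemxAr.
have -> : \sum_i u i k *: gam i = 4^-1 *: (4 *: \sum_i u i k *: gam i).
  by rewrite scalerA mulVf ?scale1r.
rewrite -scalerDr; congr (_ *: _).
transitivity (\sum_i \sum_j u i j *: (gam k *m ((gam i)^T *m gam j)) +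
  \sum_i \sum_j ((u i j * (2 *+ (j == k))) *: gam i - (u i j * (2 *+ (i == k))) *: gam j)).
  rewrite mulmx_suml -big_split; apply: eq_bigr => i _ /=.
  rewrite mulmx_suml -big_split; apply: eq_bigr => j _ /=.
  by rewrite -scalemxAl gam3 -addrA !scalerDr scalerN !scalerA.
congr (_ + _).
  rewrite mulmx_sumr; apply: eq_bigr => i _ /=; rewrite mulmx_sumr.
  by apply: eq_bigr => j _; rewrite -scalemxAr.
under eq_bigr do rewrite sumrB.
rewrite sumrB (natrD _ 2 2 : 4 = 2 + 2) scalerDl; congr (_ + _).
  rewrite scaler_sumr; apply: eq_bigr => i _.
  rewrite (bigD1 k) //= big1 => [|j /negPf ->]; last by rewrite mulr0 scale0r.
  by rewrite eqxx mulr1n addr0 scalerA mulrC.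
rewrite (bigD1 k) //= [X in - (_ + X)]big1 => [|i /negPf ->]; last first.
  by rewrite big1 // => j _; rewrite mulr0 scale0r.
rewrite eqxx mulr1n addr0 -sumrN scaler_sumr; apply: eq_bigr => i _.
by rewrite (skewE k i su) mulNr scaleNr opprK scalerA mulrC.
Qed.

Lemma cospin_gamT u k : skew u ->
  cospin u *m (gam k)^T = (gam k)^T *m spin u + \sum_i u i k *: (gam i)^T.
Proof.
move=> su; have := congr1 trmx (spin_gam k su).
rewrite linearD /= !trmx_mul spin_tr cospin_tr su [spin _]linearN /=.
have -> : cospin (- u) = - cospin u.
  rewrite /cospin -scalerN -sumrN; congr (_ *: _); apply: eq_bigr => i _.
  by rewrite -sumrN; apply: eq_bigr => j _; rewrite mxE scaleNr.
have -> : (\sum_i u i k *: gam i)^T = \sum_i u i k *: (gam i)^T.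
  by rewrite raddf_sum; apply: eq_bigr => i _ /=; rewrite linearZ.
rewrite mulmxN mulNmx; set B := cospin u *m _; set S := \sum_i _ => e.
by rewrite -(addKr (- B) S) -e opprK addrC subrK.
Qed.

(** Moving [spin u] through both factors of g_k g_l^T replaces each index by its
    image under u, so bracketing with [spin u] is [spin] of bracketing with u. *)
Lemma spin_bracket u v : skew u -> skew v ->
  spin (u *m v - v *m u) = spin u *m spin v - spin v *m spin u.
Proof.
move=> su sv; have ad k l : spin u *m (gam k *m (gam l)^T) - gam k *m (gam l)^T *m spin u =
    \sum_i u i k *: (gam i *m (gam l)^T) + \sum_i u i l *: (gam k *m (gam i)^T).
  rewrite mulmxA spin_gam // mulmxDl -(mulmxA (gam k)) cospin_gamT //.
  rewrite mulmxDr mulmxA -[X in X - _]addrA [X in X - _]addrC addrK addrC mulmx_suml mulmx_sumr.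
  by congr (_ + _); apply: eq_bigr => i _; rewrite -?scalemxAl -?scalemxAr.
transitivity (4^-1 *: (spin u *m gsum v - gsum v *m spin u)); last first.
  by rewrite scalerBr scalemxAr scalemxAl.
rewrite /spin; congr (_ *: _); rewrite linearB -linearN /= -/(spin u).
transitivity (\sum_k \sum_l v k l *: (\sum_i u i k *: (gam i *m (gam l)^T)) +
              \sum_k \sum_l v k l *: (\sum_i u i l *: (gam k *m (gam i)^T))).
  congr (_ + _); rewrite /gsum.
    rewrite exchange_big [RHS]exchange_big; apply: eq_bigr => l _ /=.
    under [RHS]eq_bigr do rewrite scaler_sumr.
    rewrite [RHS]exchange_big; apply: eq_bigr => i _ /=.
    by rewrite mxE scaler_suml; apply: eq_bigr => k _; rewrite scalerA mulrC.
  apply: eq_bigr => k _; under [RHS]eq_bigr do rewrite scaler_sumr.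
  rewrite [RHS]exchange_big; apply: eq_bigr => i _ /=.
  rewrite !mxE -sumrN scaler_suml; apply: eq_bigr => l _.
  by rewrite scalerA (skewE l i su) mulrN opprK.
rewrite -big_split mulmx_sumr mulmx_suml -sumrB; apply: eq_bigr => k _ /=.
rewrite -big_split mulmx_sumr mulmx_suml -sumrB; apply: eq_bigr => l _ /=.
rewrite -scalerDr -ad scalerBr [in LHS]scalemxAr.
by congr (_ - _); apply: scalemxAl.
Qed.

(** The trace form recovers the coefficients of u, so [spin] is injective. *)
Lemma spin_trace u k l : skew u -> k != l ->
  \tr (spin u *m (gam l *m (gam k)^T)) = 4 * u k l.
Proof.
move=> su kl; rewrite /spin -scalemxAl mxtraceZ.
have -> : 4 * u k l = 4^-1 * (8 * u k l - 8 * u l k).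
  by rewrite (skewE l k su); field.
congr (_ * _); rewrite mulmx_suml raddf_sum.
transitivity (\sum_i \sum_j
    (u i j * (8 *+ ((i == k) && (j == l))) - u i j * (8 *+ ((i == l) && (j == k))))).
  apply: eq_bigr => i _; rewrite mulmx_suml raddf_sum; apply: eq_bigr => j _ /=.
  rewrite -scalemxAl mxtraceZ -mulrBr.
  have [<-|ij] := eqVneq i j; first by rewrite skew_diag // !mul0r.
  rewrite !gam2E -smx_smul ?sok_cliff2 // straceE.
  have /(_ i)/all_ord8/(_ j)/all_ord8/(_ k)/all_ord8/(_ l) := all_ord8 cliff_traces.
  by rewrite ij kl implyTb => /eqP ->; rewrite rmorphB /= !rmorphMn.
have sum_at a b : \sum_i \sum_j u i j * (8 *+ ((i == a) && (j == b))) = 8 * u a b.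
  rewrite (bigD1 a) //= [X in _ + X]big1 ?addr0 => [|i /negPf ->]; last first.
    by rewrite big1 // => j _; rewrite mulr0.
  rewrite (bigD1 b) //= big1 ?addr0 => [|j /negPf ->]; last by rewrite andbF mulr0.
  by rewrite !eqxx mulr1n mulrC.
by rewrite -!sum_at -sumrB; apply: eq_bigr => i _; rewrite -sumrB.
Qed.

Lemma spin_inj u : skew u -> spin u = 0 -> u = 0.
Proof.
move=> su u0; apply/matrixP => k l; rewrite [RHS]mxE.
have [->|kl] := eqVneq k l; first exact: skew_diag.
have /eqP := spin_trace su kl.
by rewrite u0 mul0mx mxtrace0 eq_sym mulf_eq0 (negPf (_ : 4 != 0)) // => /eqP.
Qed.

Lemma skewP (u : so8 R) : skew (vsval u).
Proof. by have := subvsP u; rewrite mem_so8 => /eqP. Qed.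

Lemma skew_mem u : skew u -> u \in so8_space R.
Proof. by move=> su; rewrite mem_so8; apply/eqP. Qed.

Lemma spin_skew u : skew u -> skew (spin u).
Proof. by move=> su; rewrite /skew spin_tr su linearN. Qed.

Definition triality_fun (u : so8 R) : so8 R := vsproj (so8_space R) (spin (vsval u)).

Fact triality_linear : linear triality_fun.
Proof.
by move=> a u v; rewrite /triality_fun [vsval _]linearP [spin _]linearP linearP.
Qed.
HB.instance Definition _ :=
  GRing.isLinear.Build R (so8 R) (so8 R) _ triality_fun triality_linear.

Lemma triality_funE (u : so8 R) : vsval (linfun triality_fun u) = spin (vsval u).
Proof. by rewrite lfunE vsprojK //; apply/skew_mem/spin_skew/skewP. Qed.

Fact triality_is_aut : is_lie_aut (linfun triality_fun).
Proof.
apply/andP; split.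
  apply/lker0P => u v /eqP; rewrite -subr_eq0 -raddfB => /eqP uv0.
  apply/eqP; rewrite -subr_eq0; apply/eqP/val_inj; apply: spin_inj.
    exact: skewP.
  by rewrite -triality_funE uv0.
apply/asboolP => u v; apply: val_inj => /=.
by rewrite triality_funE !lie_bracketE !triality_funE spin_bracket //; apply: skewP.
Qed.

Definition triality : autso8 R := AutSO8 triality_is_aut.

Lemma trialityE (u : so8 R) : vsval (triality u) = spin (vsval u).
Proof. exact: triality_funE. Qed.

Lemma smx_signed b s : sok s -> smx R (signed b s) = (-1) ^+ b *: smx R s.
Proof.
by case: b => ok /=; rewrite ?smx_sneg // ?expr1 ?expr0 ?scale1r ?scaleN1r.
Qed.

Lemma spin_smx s t u : sok s -> sok t -> intertwined s t ->
  spin (smx R s *m u *m (smx R s)^T) = smx R t *m spin u *m (smx R t)^T.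
Proof.
move=> oks okt st; rewrite /spin -scalemxAr -scalemxAl; congr (_ *: _).
rewrite /gsum mulmx_sumr mulmx_suml [RHS](reindex_inj (@srow_inj s oks)).
apply: eq_bigr => k _ /=.
rewrite mulmx_sumr mulmx_suml [RHS](reindex_inj (@srow_inj s oks)).
apply: eq_bigr => l _ /=.
rewrite (mulmx_trsmx oks) (smx_mulmx oks) -scalemxAr -scalemxAl !gam2E.
rewrite -smx_str // -!smx_smul ?sok_smul ?sok_str ?sok_cliff2 ?sok_cliff //.
have stE : smul (smul t (cliff2 (srow oks k) (srow oks l))) (str t) =
    signed ((entry s k).2 (+) (entry s l).2) (cliff2 k l).
  by have /(_ k)/all_ord8/(_ l)/eqP := all_ord8 st.
rewrite stE smx_signed ?sok_cliff2 // scalerA.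
by congr (_ *: _); rewrite signr_addb mulrCA mulrA mulrC.
Qed.

Lemma trialityJ s t : sok s -> sok t -> intertwined s t ->
  (scls R s ^ triality^-1)%g = scls R t.
Proof.
move=> oks okt st; rewrite /conjg invgK; apply: (@mulIg _ triality).
rewrite -!mulgA mulVg mulg1; apply: aut_ext => u.
have [Os Ot] : O8 (smx R s) /\ O8 (smx R t) by split; apply: O8_smx.
by rewrite !aut_mulE trialityE !clsTE // trialityE (spin_smx _ oks okt st).
Qed.


End Triality.

(** * Conjugating the groups by triality *)

Section TableConjugation.
Variable R : realType.
Local Notation scls := (scls R).
Local Notation sgroup := (sgroup R).

Definition same_sgroup gens gens' :=
  [&& sgroup_ok gens, sgroup_ok gens',
      all (mem (slist gens')) (slist gens) & all (mem (slist gens)) (slist gens')].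

Lemma same_sgroupE gens gens' : same_sgroup gens gens' ->
  sgroup gens = sgroup gens'.
Proof.
case/and4P=> ok ok' /allP sub /allP sub'; rewrite !sgroupE //.
apply/seteqP; split=> _ /mapP[s sin ->]; apply/map_f; first exact: sub.
exact: sub'.
Qed.

Lemma conj_sgroup x gens gens' :
    (forall s, s \in zip gens gens' -> (scls s.1 ^ x)%g = scls s.2) ->
    size gens = size gens' ->
  conj_set (sgroup gens) x = sgroup gens'.
Proof.
move=> zx sz; rewrite /sgroup /class_group conj_generated; congr Defs.generated.
have {}zx s t i : i < size gens -> (scls (nth s gens i) ^ x)%g = scls (nth t gens' i).
  move=> ig; rewrite -(zx (nth s gens i, nth t gens' i)) // -nth_zip //.
  by rewrite mem_nth // size_zip -sz minnn.
apply/seteqP; split.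
  move=> _ [_ [_ /mapP[s /(nthP s)[i ig <-] ->] <-] <-].
  exists (smx R (nth s gens' i)); first by apply/map_f/mem_nth; rewrite -sz.
  exact: esym (zx s s i ig).
move=> _ [_ /mapP[s /(nthP s)[i ig <-] ->] <-]; rewrite -sz in ig.
exists (scls (nth s gens i)); last exact: (zx s s i ig).
by exists (smx R (nth s gens i)) => //; apply/map_f/mem_nth.
Qed.

Definition intertwined_gens gens gens' :=
  (size gens == size gens') &&
  all (fun s => [&& sok s.1, sok s.2 & intertwined s.1 s.2]) (zip gens gens').

Lemma triality_sgroup gens gens' : intertwined_gens gens gens' ->
  conj_set (sgroup gens) (triality R)^-1%g = sgroup gens'.
Proof.
move=> /andP[/eqP sz /allP ok]; apply: conj_sgroup => // s /ok /and3P[*].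
exact: trialityJ.
Qed.

Definition sconj (p s : sperm) := smul (smul (str p) s) p.

Lemma scls_sgroup p gens : sok p -> all sok gens ->
  conj_set (sgroup gens) (scls p) = sgroup [seq sconj p s | s <- gens].
Proof.
move=> okp /allP okg; apply: conj_sgroup; last by rewrite size_map.
move=> [s t] /(nthP (s, t))[i]; rewrite size_zip size_map minnn => ig.
rewrite nth_zip ?size_map // (nth_map s) // => -[es <-] /=; rewrite es.
have oks : sok s by apply: okg; rewrite -es mem_nth.
by rewrite /conjg sclsV // mulgA scls_smul ?sok_str // scls_smul ?sok_smul ?sok_str.
Qed.

(** Triality carries F19 to a group of Pauli matrices whose last two tensor factors
    have to be exchanged to obtain F15; this permutation exchanges the last two bits
    of the row numbers. *)
Definition swap_perm : sperm := zip [:: 0; 2; 1; 3; 4; 6; 5; 7] (nseq 8 false).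

(** The reflections in two basis vectors go to products of two Clifford matrices.
    The last table is the solution of [intertwined] for the last generator, which is
    unique up to sign. *)
Definition gens19_image := [:: sI 4 4; cliff2 0 1; cliff2 6 7; tD;
  zip [:: 3; 2; 1; 0; 7; 6; 5; 4]
      [:: false; false; false; false; true; true; false; false]].

Lemma F15_F19_conjugate : conjugate_sets (F15 R) (F19 R).
Proof.
apply: conjugate_sets_sym; exists ((triality R)^-1 * scls swap_perm)%g.
rewrite F15E F19E -conj_setM (@triality_sgroup _ gens19_image); last by vm_compute.
by rewrite scls_sgroup //; apply: same_sgroupE; vm_compute.
Qed.

Definition gens17_image := [:: sI 4 4; cliff2 0 1; cliff2 6 7; tD; smul tE (sI 2 6)].

Lemma triality_normalizes_F17 : set_normalizer (F17 R) (triality R).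
Proof.
suff e : conj_set (F17 R) (triality R)^-1%g = F17 R.
  by rewrite /set_normalizer /= -{1}e conj_setKV.
rewrite F17E (@triality_sgroup _ gens17_image); last by vm_compute.
by apply: same_sgroupE; vm_compute.
Qed.

Lemma reflection_normalizes_F17 : set_normalizer (F17 R) (scls (sI 1 7)).
Proof.
rewrite /set_normalizer /= F17E scls_sgroup //.
by apply: same_sgroupE; vm_compute.
Qed.

End TableConjugation.

(** * Elements whose adjoint satisfies a cubic equation *)

Section Wedge.
Local Open Scope ring_scope.
Variable R : realType.
Implicit Types (M N : 'M[R]_8) (x y z a b : 'cV[R]_8) (s t : R).

Definition dot x y : R := (x^T *m y) 0 0.
Definition wedge x y : 'M[R]_8 := x *m y^T - y *m x^T.
Definition bracket M N : 'M[R]_8 := M *m N - N *m M.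

Lemma dotE x y : dot x y = \sum_i x i 0 * y i 0.
Proof. by rewrite /dot mxE; apply: eq_bigr => i _; rewrite mxE. Qed.

Lemma dotC x y : dot x y = dot y x.
Proof. by rewrite !dotE; apply: eq_bigr => i _; rewrite mulrC. Qed.

Lemma dotDr x y z : dot x (y + z) = dot x y + dot x z.
Proof. by rewrite /dot mulmxDr mxE. Qed.
Lemma dotDl x y z : dot (y + z) x = dot y x + dot z x.
Proof. by rewrite dotC dotDr !(dotC x). Qed.
Lemma dotZr t x y : dot x (t *: y) = t * dot x y.
Proof. by rewrite /dot -scalemxAr mxE. Qed.
Lemma dotZl t x y : dot (t *: x) y = t * dot x y.
Proof. by rewrite dotC dotZr dotC. Qed.
Lemma dotNr x y : dot x (- y) = - dot x y.
Proof. by rewrite /dot mulmxN mxE. Qed.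
Lemma dotNl x y : dot (- x) y = - dot x y.
Proof. by rewrite dotC dotNr dotC. Qed.
Lemma dot0r x : dot x 0 = 0.
Proof. by rewrite /dot mulmx0 mxE. Qed.
Definition dot_lin := (dotDr, dotDl, dotZr, dotZl, dotNr, dotNl).

Lemma dot_mulmxl M x y : dot (M *m x) y = dot x (M^T *m y).
Proof. by rewrite /dot trmx_mul mulmxA. Qed.

Lemma dot_skewl M x y : skew M -> dot (M *m x) y = - dot x (M *m y).
Proof. by move=> sM; rewrite dot_mulmxl sM mulNmx dotNr. Qed.

Lemma dot_skew M x : skew M -> dot x (M *m x) = 0.
Proof. by move=> sM; have := dot_skewl x x sM; rewrite dotC; lra. Qed.

Lemma dot_ge0 x : 0 <= dot x x.
Proof. by rewrite dotE sumr_ge0 // => i _; rewrite -expr2 sqr_ge0. Qed.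

Lemma dot_eq0 x : (dot x x == 0) = (x == 0).
Proof.
apply/eqP/eqP => [|->]; last by rewrite dot0r.
rewrite dotE => /eqP; rewrite psumr_eq0 => [/allP x0|i _]; last first.
  by rewrite -expr2 sqr_ge0.
apply/matrixP => i j; rewrite [j]ord1 mxE.
by have := x0 i (mem_index_enum i); rewrite -expr2 sqrf_eq0 => /eqP.
Qed.

Lemma dot_gt0 x : x != 0 -> 0 < dot x x.
Proof. by move=> x0; rewrite lt_neqAle dot_ge0 andbT eq_sym dot_eq0. Qed.

Lemma outer_apply x y z : x *m y^T *m z = dot y z *: x.
Proof. by rewrite -mulmxA [y^T *m z]mx11_scalar mul_mx_scalar. Qed.

Lemma wedge_apply x y z : wedge x y *m z = dot y z *: x - dot x z *: y.
Proof. by rewrite mulmxBl !outer_apply. Qed.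

Lemma wedgeC x y : wedge y x = - wedge x y.
Proof. by rewrite /wedge opprB. Qed.
Lemma wedgexx x : wedge x x = 0.
Proof. by rewrite /wedge subrr. Qed.
Lemma wedgeDl x y z : wedge (x + y) z = wedge x z + wedge y z.
Proof. by rewrite /wedge mulmxDl linearD mulmxDr opprD addrACA. Qed.
Lemma wedgeDr x y z : wedge z (x + y) = wedge z x + wedge z y.
Proof. by rewrite wedgeC wedgeDl opprD -!wedgeC. Qed.
Lemma wedgeZl t x z : wedge (t *: x) z = t *: wedge x z.
Proof. by rewrite /wedge linearZ /= -scalemxAr -scalemxAl scalerBr. Qed.
Lemma wedgeZr t x z : wedge z (t *: x) = t *: wedge z x.
Proof. by rewrite wedgeC wedgeZl -scalerN -wedgeC. Qed.
Lemma wedgeNr x z : wedge z (- x) = - wedge z x.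
Proof. by rewrite -scaleN1r wedgeZr scaleN1r. Qed.

Lemma wedgeNl x z : wedge (- x) z = - wedge x z.
Proof. by rewrite -scaleN1r wedgeZl scaleN1r. Qed.

Lemma wedge0r x : wedge x 0 = 0.
Proof. by rewrite /wedge trmx0 mulmx0 mul0mx subrr. Qed.

Lemma wedge_skew x y : skew (wedge x y).
Proof. by rewrite /skew /wedge linearB /= !trmx_mul !trmxK opprB. Qed.

Lemma wedge_conj M x y : M *m wedge x y *m M^T = wedge (M *m x) (M *m y).
Proof. by rewrite /wedge mulmxBr mulmxBl !trmx_mul !mulmxA. Qed.

Lemma bracket_wedge M x y : skew M ->
  bracket M (wedge x y) = wedge (M *m x) y + wedge x (M *m y).
Proof.
move=> sM; rewrite /bracket /wedge mulmxBr mulmxBl -!mulmxA !trmx_mul sM.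
by rewrite !mulmxN !opprB !opprK addrACA; congr (_ + _); rewrite addrC.
Qed.

Lemma bracketDr M N N' : bracket M (N + N') = bracket M N + bracket M N'.
Proof. by rewrite /bracket mulmxDr mulmxDl opprD addrACA. Qed.

Lemma bracketZr t M N : bracket M (t *: N) = t *: bracket M N.
Proof. by rewrite /bracket -scalemxAr -scalemxAl scalerBr. Qed.

Lemma bracketNr M N : bracket M (- N) = - bracket M N.
Proof. by rewrite -scaleN1r bracketZr scaleN1r. Qed.

Lemma bracketC M N : bracket N M = - bracket M N.
Proof. by rewrite /bracket opprB. Qed.

Definition basis (i : 'I_8) : 'cV[R]_8 := delta_mx i 0.

Lemma dot_basis i j : dot (basis i) (basis j) = (i == j)%:R.
Proof. by rewrite /dot trmx_delta mul_delta_mx_cond; case: eqP => _; rewrite !mxE. Qed.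

Lemma dot_basisl i x : dot (basis i) x = x i 0.
Proof. by rewrite /dot trmx_delta -rowE mxE. Qed.

Lemma mulmx_basis M i j : (M *m basis j) i 0 = M i j.
Proof. by rewrite /basis -colE mxE. Qed.

Lemma mulmx_ext M N : (forall x, M *m x = N *m x) -> M = N.
Proof. by move=> MN; apply/matrixP => i j; rewrite -!mulmx_basis MN. Qed.

Lemma skew_delta_wedge i j : skew_delta R i j = wedge (basis i) (basis j).
Proof. by rewrite /skew_delta /wedge !trmx_delta !mul_delta_mx. Qed.

(** The rotation generators in the plane of two orthogonal vectors, one of them
    of length one, satisfy this identity; its other nonzero solutions are their
    images under automorphisms. *)
Definition cubic s M := forall N, skew N ->
  bracket M (bracket M (bracket M N)) = - s *: bracket M N.

(** With x = N a and y = N b, the bracket of a /\ b with N is minus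
    x /\ b + a /\ y, and a /\ b maps x and y to multiples of a and b. *)
Lemma wedge_cubic a b : dot a a = 1 -> dot a b = 0 -> cubic (dot b b) (wedge a b).
Proof.
move=> aa ab N sN; set s := dot b b; set M := wedge a b.
have Ma : M *m a = - b by rewrite wedge_apply dotC ab aa scale0r scale1r sub0r.
have Mb : M *m b = s *: a by rewrite wedge_apply ab scale0r subr0.
have sM : skew M := wedge_skew a b.
pose x := N *m a; pose y := N *m b; pose n := dot b x.
have Mx : M *m x = n *: a by rewrite wedge_apply dot_skew // scale0r subr0.
have My : M *m y = n *: b.
  rewrite wedge_apply dot_skew // scale0r sub0r -scaleNr; congr (_ *: _).
  by rewrite /n dotC dot_skewl // opprK.
rewrite (bracketC N M) bracket_wedge // -/x -/y !bracketNr scalerN; congr (- _).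
have -> : bracket M (wedge x b + wedge a y) =
    (n + n) *: M + s *: wedge x a - wedge b y.
  rewrite bracketDr !bracket_wedge // Mx My Ma Mb wedgeZl !wedgeZr wedgeNl.
  rewrite scalerDl -!addrA; congr (_ + _).
  by rewrite [RHS]addrCA; congr (_ + _); rewrite addrC.
rewrite !bracketDr bracketNr !bracketZr !bracket_wedge // Mx My Ma Mb.
rewrite !wedgeZr !wedgeZl !wedgeNr !wedgeNl ?wedgeZl ?wedgeZr.
rewrite !wedgexx !scaler0 !addr0 !add0r oppr0.
by rewrite scaler0 add0r scalerN -opprD -scalerDr -scaleNr.
Qed.

(** If all nonzero vectors of a subspace are eigenvectors, their eigenvalues agree:
    compare two independent vectors with their sum. *)
Lemma scalar_on_image M N :
  (forall x, exists t, N *m (M *m x) = t *: (M *m x)) ->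
  exists t, N *m M = t *: M.
Proof.
move=> NM; have [->|M0] := eqVneq M 0.
  by exists 0; rewrite mulmx0 scaler0.
have [x0 x0P] : exists x, M *m x != 0.
  apply: contrapT => /forallNP M0'; case/eqP: M0; apply: mulmx_ext => x.
  by rewrite mul0mx; apply/eqP; apply: contrapT => /negP; apply: M0'.
have [t tP] := NM x0; exists t; apply: mulmx_ext => x.
rewrite -scalemxAl -mulmxA; have [u uP] := NM x; have [w] := NM (x + x0).
rewrite !mulmxDr uP tP scalerDr => /eqP.
rewrite -subr_eq0 opprD addrACA -!scalerBl => e.
have [<-//|ut] := eqVneq u t.
have [uw|uw] := eqVneq u w.
  move: e; rewrite uw subrr scale0r add0r scaler_eq0 (negPf x0P) orbF subr_eq0.
  by rewrite -uw eq_sym (negPf ut).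
have xE : M *m x = ((w - t) / (u - w)) *: (M *m x0).
  move: e; rewrite addr_eq0 => /eqP e.
  have uw0 : u - w != 0 by rewrite subr_eq0.
  apply: (scalerI uw0).
  by rewrite [LHS]e scalerA mulrC divfK // -scaleNr opprB.
by rewrite -uP xE -scalemxAr tP !scalerA mulrC.
Qed.

(** A matrix commuting with so(8) is scalar, and a skew scalar matrix vanishes. *)
Lemma bracket_neq0 M : skew M -> M != 0 -> exists x y, bracket M (wedge x y) != 0.
Proof.
move=> sM M0; apply: contrapT => none; case/eqP: M0.
have comm (u : so8 R) : M *m vsval u = vsval u *m M.
  apply/eqP; rewrite -subr_eq0 -/(bracket M (vsval u)).
  have e : vsval u *+ 2 = \sum_i \sum_j vsval u i j *: skew_delta R i j.
    rewrite -vsvalMn so8_sum_delta vsval_sum; apply: eq_bigr => i _.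
    by rewrite vsval_sum; apply: eq_bigr => j _; rewrite vsvalZ so8_deltaE.
  have : bracket M (vsval u *+ 2) == 0.
    rewrite e /bracket mulmx_sumr mulmx_suml -sumrB; apply/eqP/big1 => i _.
    rewrite mulmx_sumr mulmx_suml -sumrB; apply: big1 => j _.
    rewrite -/(bracket M _) bracketZr skew_delta_wedge.
    have [->|b0] := eqVneq (bracket M (wedge (basis i) (basis j))) 0.
      by rewrite scaler0.
    by case: none; exists (basis i), (basis j).
  by rewrite -scaler_nat bracketZr scaler_eq0 pnatr_eq0.
have := commute_so8_scalar comm; set c := M 0 0 => Mc.
have : c = 0 by rewrite /c; apply: skew_diag.
by rewrite Mc => ->; rewrite raddf0.
Qed.


Lemma cubic_wedge s M x y : skew M -> cubic s M ->
  let x1 := M *m x in let x2 := M *m x1 in let x3 := M *m x2 in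
  let y1 := M *m y in let y2 := M *m y1 in let y3 := M *m y2 in
  wedge x3 y + 3 *: wedge x2 y1 + 3 *: wedge x1 y2 + wedge x y3 =
  - s *: (wedge x1 y + wedge x y1).
Proof.
move=> sM cM x1 x2 x3 y1 y2 y3; have := cM _ (wedge_skew x y).
rewrite !(bracket_wedge, bracketDr) // => <-.
rewrite -/x1 -/x2 -/x3 -/y1 -/y2 -/y3.
move: (wedge x3 y) (wedge x2 y1) (wedge x1 y2) (wedge x y3) => A B C D.
by apply/matrixP => i j; rewrite !mxE; ring.
Qed.

(** Apply [cubic_wedge] to x and y = M x. Even and odd powers of M applied to x are
    orthogonal, so evaluating the resulting 2-form at M x and at x isolates its two
    terms: each vector M x is an eigenvector of M^2, and each x is an eigenvector
    of M^4 + s M^2. *)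
Lemma cubic_power s M : skew M -> cubic s M ->
  (exists t, M *m M *m M = t *: M) /\
  forall x, exists t, M *m (M *m (M *m (M *m x))) + s *: (M *m (M *m x)) = t *: x.
Proof.
move=> sM cM.
have main x : 2 *: wedge (M *m x) (M *m (M *m (M *m x))) +
    wedge x (M *m (M *m (M *m (M *m x))) + s *: (M *m (M *m x))) = 0.
  have /= := cubic_wedge x (M *m x) sM cM; rewrite !wedgexx wedgeDr wedgeZr.
  rewrite (wedgeC (M *m x) (M *m (M *m (M *m x)))).
  move: (wedge _ _) (wedge _ _) (wedge _ _) => A B C /eqP.
  rewrite -subr_eq0 => /eqP <-; apply/matrixP => i j.
  by rewrite !mxE; ring.
have d01 x : dot x (M *m x) = 0 by apply: dot_skew.
have d03 x : dot x (M *m (M *m (M *m x))) = 0.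
  by rewrite -[LHS]opprK -dot_skewl // -[RHS]oppr0; congr (- _); apply: d01.
split.
  suff [t tP] : exists t, (M *m M) *m M = t *: M by exists t.
  apply: scalar_on_image => x; set x1 := M *m x.
  have [->|x10] := eqVneq x1 0; first by exists 0; rewrite mulmx0 scaler0.
  exists (dot (M *m (M *m x1)) x1 / dot x1 x1); rewrite -mulmxA.
  have /(congr1 (fun A => A *m x1)) := main x.
  rewrite mul0mx mulmxDl -scalemxAl !wedge_apply -/x1.
  rewrite (dotC x x1) [dot x1 x]dotC d01 scale0r subr0.
  have -> : dot (M *m (M *m (M *m x1)) + s *: (M *m x1)) x1 = 0.
    by rewrite !dot_lin dotC d03 [dot _ x1]dotC d01 mulr0 addr0.
  rewrite scale0r addr0 => /eqP; rewrite scaler_eq0 pnatr_eq0 subr_eq0 => /eqP e.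
  rewrite mulrC -scalerA e scalerA mulVf ?scale1r //.
  by rewrite gt_eqF ?dot_gt0.
move=> x; have [->|x0] := eqVneq x 0.
  by exists 0; rewrite !mulmx0 !scaler0 addr0.
set w := _ + _; exists (dot w x / dot x x).
have /(congr1 (fun A => A *m x)) := main x.
rewrite mul0mx mulmxDl -scalemxAl !wedge_apply -/w.
rewrite [dot (M *m x) x]dotC d01 [dot _ x]dotC d03 !scale0r subrr scaler0 add0r => /eqP.
rewrite subr_eq0 => /eqP e; rewrite mulrC -scalerA e scalerA mulVf ?scale1r //.
by rewrite gt_eqF ?dot_gt0.
Qed.

(** By [cubic_power] M^3 = t M, and M^4 + s M^2 acts on each vector as a scalar. If
    t = - s, evaluating [cubic_wedge] for x = a at the vector a determines M. If
    not, M^2 is a scalar c, and then ad(M)^3 = 4 c ad(M), so c = - s / 4. *)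
Lemma cubic_dichotomy s M : skew M -> M != 0 -> s != 0 -> cubic s M ->
  (M *m M *m M = - s *: M /\
   forall a, dot a a = 1 -> M *m (M *m a) = - s *: a -> M = wedge (M *m a) a) \/
  M *m M = (- (s / 4))%:M.
Proof.
move=> sM M0 s0 cM; have [[t M3] M4] := cubic_power sM cM.
have M3E x : M *m (M *m (M *m x)) = t *: (M *m x) by rewrite 2!mulmxA M3 scalemxAl.
have [ts|ts] := eqVneq t (- s).
  left; split=> [|a aa Maa]; first by rewrite M3 ts.
  apply: mulmx_ext => y; have := cubic_wedge a y sM cM.
  rewrite /= !M3E Maa ts.
  set b := M *m a; set y1 := M *m y; set y2 := M *m y1 => e.
  have {}e : 3 *: wedge b y2 = 3 *: (s *: wedge a y1).
    move: e; rewrite !(wedgeZl, wedgeZr).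
    move: (wedge b y) (wedge a y1) (wedge b y2) => A B C /eqP.
    rewrite -subr_eq0 => /eqP e; apply/eqP; rewrite -subr_eq0; apply/eqP.
    rewrite -{}e; apply/matrixP => i j.
    by rewrite !mxE; ring.
  have {e} /scalerI e := e.
  have {}e : wedge b y2 = s *: wedge a y1 by apply: e; rewrite pnatr_eq0.
  move/(congr1 (fun A => A *m a)): e; rewrite -scalemxAl !wedge_apply aa scale1r.
  have -> : dot y2 a = - s * dot a y.
    by rewrite /y2 !dot_skewl // opprK Maa !dot_lin dotC.
  have -> : dot y1 a = - dot b y by rewrite dot_skewl // dotC.
  have -> : dot b a = 0 by rewrite dotC; apply: dot_skew.
  rewrite scale0r subr0 => e; apply: (scalerI s0).
  have -> : y1 = (- dot b y) *: a - (- dot b y *: a - y1) by rewrite subKr.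
  rewrite scalerBr -e.
  by apply/matrixP => i j; rewrite !mxE; ring.
right.
have [c cE] : exists c, (M *m M) *m 1%:M = c *: (1%:M : 'M[R]_8).
  apply: scalar_on_image => x; rewrite mul1mx; have [u uE] := M4 x.
  exists ((t + s)^-1 * u); rewrite -scalerA -uE M3E -scalerDl.
  by rewrite scalerA mulVf ?scale1r ?mulmxA // -[s]opprK subr_eq0.
have {cE} M2 : M *m M = c%:M by rewrite -scalemx1 -cE mulmx1.
have M2E x : M *m (M *m x) = c *: x by rewrite mulmxA M2 mul_scalar_mx.
have [x [y]] := bracket_neq0 sM M0; rewrite bracket_wedge // => K0.
have := cubic_wedge x y sM cM; rewrite /= !M2E -!scalemxAr !(wedgeZl, wedgeZr).
move: K0; move: (wedge _ _) (wedge _ _) => B A AB0 /eqP; rewrite -subr_eq0.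
have -> : c *: A + 3 *: (c *: B) + 3 *: (c *: A) + c *: B - - s *: (A + B) =
   (c * 4 + s) *: (A + B) by apply/matrixP => i j; rewrite !mxE; ring.
rewrite scaler_eq0 (negPf AB0) orbF M2 => /eqP cs; congr (_%:M).
by lra.
Qed.

End Wedge.

(** * Reflections, and automorphisms fixing a rotation generator *)

Section Frames.
Local Open Scope ring_scope.
Variable R : realType.
Implicit Types (M N P : 'M[R]_8) (x y z a b c : 'cV[R]_8) (g h : autso8 R).

Notation e := (basis R).
Local Notation i0 := (@Ordinal 8 0 isT).
Local Notation i1 := (@Ordinal 8 1 isT).
Local Notation i2 := (@Ordinal 8 2 isT).
Local Notation i3 := (@Ordinal 8 3 isT).
Local Notation i4 := (@Ordinal 8 4 isT).
Local Notation A := (so8_delta R i0).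

Definition reflection x : 'M[R]_8 := 1%:M - (2 / dot x x) *: (x *m x^T).

Lemma reflection_apply x y : reflection x *m y = y - (2 * dot x y / dot x x) *: x.
Proof.
rewrite mulmxBl mul1mx -scalemxAl outer_apply scalerA.
by rewrite mulrAC.
Qed.

Lemma reflection_tr x : (reflection x)^T = reflection x.
Proof. by rewrite /reflection linearB linearZ /= trmx1 trmx_mul trmxK. Qed.

Lemma O8_reflection x : x != 0 -> O8 (reflection x).
Proof.
move=> x0; have xx0 : dot x x != 0 by rewrite dot_eq0.
rewrite /O8 /= /orthogonal_mx reflection_tr; apply: mulmx_ext => y.
rewrite -mulmxA !reflection_apply mul1mx !dot_lin.
apply/matrixP => i j; rewrite !mxE; field.
exact: xx0.
Qed.

Lemma O8_dot P x y : O8 P -> dot (P *m x) (P *m y) = dot x y.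
Proof. by move=> OP; rewrite dot_mulmxl mulmxA (mulmx1C OP) mul1mx. Qed.

Definition reflection_or_id P := P = 1%:M \/ exists2 x, x != 0 & P = reflection x.

Lemma O8_reflection_or_id P : reflection_or_id P -> O8 P.
Proof. by case=> [->|[x x0 ->]]; [apply: O8_1 | apply: O8_reflection]. Qed.

(** The reflection exchanging x and y fixes all vectors orthogonal to x - y. *)
Lemma reflection_moving x y : dot x x = dot y y -> exists P,
  [/\ reflection_or_id P, P *m x = y & forall z, dot z x = dot z y -> P *m z = z].
Proof.
move=> xy; have [<-|nxy] := eqVneq x y.
  by exists 1%:M; split=> [||z _]; [left | rewrite mul1mx | rewrite mul1mx].
have v0 : x - y != 0 by rewrite subr_eq0.
have vv0 : dot (x - y) (x - y) != 0 by rewrite dot_eq0.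
exists (reflection (x - y)); split; first by right; exists (x - y).
  rewrite reflection_apply (_ : _ / _ = 1) ?scale1r ?subKr //.
  apply: (mulIf vv0); rewrite divfK // mul1r !dot_lin (dotC y x) -xy; ring.
move=> z zxy; rewrite reflection_apply (_ : dot _ z = 0) ?mulr0 ?mul0r ?scale0r ?subr0 //.
by rewrite !dot_lin !(dotC _ z) zxy subrr.
Qed.

Lemma frame2 a b : dot a a = 1 -> dot b b = 1 -> dot a b = 0 ->
  exists P, [/\ O8 P, P *m a = e i0 & P *m b = e i1].
Proof.
move=> aa bb ab.
have [|P [/O8_reflection_or_id OP Pa _]] := @reflection_moving a (e i0).
  by rewrite dot_basis aa.
have [|Q [/O8_reflection_or_id OQ Qb fix_]] := @reflection_moving (P *m b) (e i1).
  by rewrite dot_basis O8_dot.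
exists (Q *m P); split; [exact: O8_mul | | by rewrite -mulmxA].
by rewrite -mulmxA Pa fix_ // -Pa O8_dot // ab Pa dot_basis.
Qed.

Lemma frame3 a b c : dot a a = 1 -> dot b b = 1 -> dot c c = 1 ->
    dot a b = 0 -> dot a c = 0 -> dot b c = 0 ->
  exists P, [/\ O8 P, P *m a = e i0, P *m b = e i1 & P *m c = e i2].
Proof.
move=> aa bb cc ab ac bc; have [P [OP Pa Pb]] := frame2 aa bb ab.
have [|Q [/O8_reflection_or_id OQ Qc fix_]] := @reflection_moving (P *m c) (e i2).
  by rewrite dot_basis O8_dot.
exists (Q *m P); split; [exact: O8_mul | | | by rewrite -mulmxA].
  by rewrite -mulmxA Pa fix_ // -Pa O8_dot // ac Pa dot_basis.
by rewrite -mulmxA Pb fix_ // -Pb O8_dot // bc Pb dot_basis.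
Qed.

Lemma aut_bracketE g u v :
  vsval (g (lie_bracket u v)) = bracket (vsval (g u)) (vsval (g v)).
Proof. by rewrite aut_bracket lie_bracketE. Qed.

Lemma aut_cubic g u s : cubic s (vsval u) -> cubic s (vsval (g u)).
Proof.
move=> cu N sN; pose w : so8 R := (g^-1)%g (Subvs (skew_mem sN)).
have -> : N = vsval (g w) by rewrite /w -aut_mulE mulgV aut_1E.
rewrite -!aut_bracketE -vsvalZ -autZ; congr (vsval (g _)); apply: val_inj.
change (vsval (lie_bracket u (lie_bracket u (lie_bracket u w))) =
  vsval (- s *: lie_bracket u w)).
by rewrite vsvalZ !lie_bracketE; apply/cu/skewP.
Qed.

Lemma aut_neq0 g u : vsval u != 0 -> vsval (g u) != 0.
Proof.
apply: contraNneq => gu0; suff -> : u = 0 by rewrite raddf0.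
by rewrite -[u]aut_1E -(mulVg g) aut_mulE (_ : g u = 0) ?raddf0 //; apply: val_inj.
Qed.

Lemma cubic_unique s t M : skew M -> M != 0 -> cubic s M -> cubic t M -> s = t.
Proof.
move=> sM M0 cs ct; have [x [y xy]] := bracket_neq0 sM M0.
have := cs _ (wedge_skew x y); rewrite ct; last exact: wedge_skew.
by move=> /eqP; rewrite -subr_eq0 -scalerBl scaler_eq0 (negPf xy) orbF; lra.
Qed.

Lemma AE j : vsval (A j) = wedge (e i0) (e j).
Proof. by rewrite so8_deltaE skew_delta_wedge. Qed.

Lemma wedge_neq0 a b : dot a a = 1 -> dot a b = 0 -> b != 0 -> wedge a b != 0.
Proof.
move=> aa ab; apply: contraNneq => /(congr1 (fun M => M *m a)).
by rewrite wedge_apply mul0mx dotC ab aa scale0r sub0r scale1r => /eqP; rewrite oppr_eq0.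
Qed.

Lemma basis_neq0 j : e j != 0.
Proof. by rewrite -dot_eq0 dot_basis eqxx oner_eq0. Qed.

Lemma vsvalN (u : so8 R) : vsval (- u) = - vsval u.
Proof. exact: raddfN. Qed.

Lemma vsvalD (u v : so8 R) : vsval (u + v) = vsval u + vsval v.
Proof. exact: raddfD. Qed.

Lemma autD g (u v : so8 R) : g (u + v) = g u + g v.
Proof. exact: raddfD. Qed.

Lemma autN g (u : so8 R) : g (- u) = - g u.
Proof. exact: raddfN. Qed.

Lemma so8_inj (u v : so8 R) : vsval u = vsval v -> u = v.
Proof. exact: val_inj. Qed.

Lemma delta_bracket i j : i0 != i -> i0 != j -> i != j ->
  so8_delta R i j = - lie_bracket (A i) (A j).
Proof.
move=> i0' j0' ij; apply: so8_inj; rewrite vsvalN.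
rewrite lie_bracketE !AE so8_deltaE skew_delta_wedge.
rewrite -/(bracket _ _) bracket_wedge; last exact: wedge_skew.
rewrite !wedge_apply !dot_basis [_ == i0]eq_sym !(negPf i0') !(negPf j0') (negPf ij) eqxx.
by rewrite !scale0r scale1r sub0r subr0 wedgeNl wedge0r addr0 opprK.
Qed.

(** The E_0j - E_j0 generate so(8). *)
Lemma aut_ext_A g h : (forall j, i0 != j -> g (A j) = h (A j)) -> g = h.
Proof.
move=> gh.
have ghd i j : g (so8_delta R i j) = h (so8_delta R i j).
  have swap : so8_delta R i j = - so8_delta R j i.
    by apply: so8_inj; rewrite vsvalN !so8_deltaE /skew_delta opprB.
  have [->|ij] := eqVneq i j.
    rewrite (_ : so8_delta R j j = 0) ?raddf0 //; apply: so8_inj.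
    by rewrite so8_deltaE /skew_delta subrr raddf0.
  have [i0E|i0'] := eqVneq i0 i; first by rewrite -i0E gh // i0E.
  have [j0E|j0'] := eqVneq i0 j; first by rewrite swap !autN -j0E gh // j0E eq_sym.
  by rewrite delta_bracket // !autN !aut_bracket !gh.
apply: aut_ext => u; apply/matrixP => k l; apply: (@pmulrnI R 2) => //.
rewrite -!mulmxnE -!vsvalMn -!autMn so8_sum_delta !aut_sum.
rewrite (eq_bigr (fun i => h (\sum_j vsval u i j *: so8_delta R i j))) // => i _.
by rewrite !aut_sum; apply: eq_bigr => j _; rewrite !autZ ghd.
Qed.

(** The eigenvalue -1 of ad(E_ij - E_ji)^2 occurs only on the matrices that exchange
    the plane of i and j with its orthogonal complement. *)
Lemma eigen_block i j M : skew M -> i != j ->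
    bracket (wedge (e i) (e j)) (bracket (wedge (e i) (e j)) M) = - M ->
  (forall k l, i != k -> j != k -> i != l -> j != l -> M k l = 0) /\ M i j = 0.
Proof.
set W := wedge _ _ => sM ij MW; have sW : skew W := wedge_skew _ _.
have sX : skew (bracket W M).
  by rewrite /skew /bracket linearB /= !trmx_mul sM sW !mulmxN !mulNmx !opprK opprB.
move: (bracket W M) sX MW => X sX MW.
have ME k l : M k l = dot (W *m e k) (X *m e l) + dot (e k) (X *m (W *m e l)).
  rewrite -[M]opprK -MW mxE -mulmx_basis -dot_basisl mulmxBl -!mulmxA.
  by rewrite dot_skewl // !dot_lin opprD opprK.
have We k : i != k -> j != k -> W *m e k = 0.
  move=> ik jk; rewrite wedge_apply !dot_basis (negPf ik) (negPf jk).
  by rewrite !scale0r subr0.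
split=> [k l ik jk il jl|]; first by rewrite ME !We // mulmx0 dot0r dotC dot0r addr0.
rewrite ME !wedge_apply !dot_basis !eqxx (eq_sym j i) (negPf ij).
by rewrite !scale0r !scale1r sub0r subr0 dotNl !dot_skew // oppr0 addr0.
Qed.

Lemma bracket_AA j k : i0 != j -> i0 != k -> j != k ->
  lie_bracket (A j) (lie_bracket (A j) (A k)) = - A k.
Proof.
move=> j0 k0 jk; apply: so8_inj; rewrite vsvalN !lie_bracketE !AE -!/(bracket _ _).
have sW := wedge_skew (e i0) (e j).
rewrite bracket_wedge // !wedge_apply !dot_basis (eq_sym j i0).
rewrite (negPf j0) (negPf k0) (negPf jk) eqxx.
rewrite !scale0r scale1r !sub0r oppr0 wedge0r addr0 wedgeNl bracketNr.
rewrite bracket_wedge // !wedge_apply !dot_basis eqxx.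
rewrite (negPf j0) (negPf k0) (negPf jk).
by rewrite !scale0r scale1r !subr0 wedge0r addr0.
Qed.

Lemma A_cubic j : i0 != j -> cubic 1 (vsval (A j)).
Proof.
move=> j0; rewrite AE -[X in cubic X](_ : dot (e j) (e j) = 1).
  by apply: wedge_cubic; rewrite dot_basis ?eqxx ?(negPf j0).
by rewrite dot_basis eqxx.
Qed.

Lemma A_neq0 j : i0 != j -> vsval (A j) != 0.
Proof.
move=> j0; rewrite AE; apply: wedge_neq0; rewrite ?basis_neq0 //.
  by rewrite dot_basis eqxx.
by rewrite dot_basis (negPf j0).
Qed.

Section FixingA1.
Variable g : autso8 R.
Hypothesis gA1 : g (A i1) = A i1.

Lemma image_block j : i0 != j -> i1 != j ->
  let M := vsval (g (A j)) in
  (forall k l, i0 != k -> i1 != k -> i0 != l -> i1 != l -> M k l = 0) /\ M i0 i1 = 0.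
Proof.
move=> j0 j1 M; apply: eigen_block => //; first exact: skewP.
by rewrite -AE -gA1 -!aut_bracketE bracket_AA // autN vsvalN.
Qed.

(** The alternative M^2 = - 1/4 of [cubic_dichotomy] is excluded: three columns of M
    of index at least 2 would be nonzero and orthogonal to each other in the plane
    of the first two coordinates. *)
Lemma image_cube j : i0 != j -> i1 != j ->
  let M := vsval (g (A j)) in
  M *m M *m M = - M /\
  forall a, dot a a = 1 -> M *m (M *m a) = - a -> M = wedge (M *m a) a.
Proof.
move=> j0 j1 M; have [blk M01] := image_block j0 j1.
have sM : skew M by apply: skewP.
have [||||[M3 Mw]|M2] := @cubic_dichotomy R 1 M.
- exact: sM.
- exact/aut_neq0/A_neq0.
- exact: oner_neq0.
- exact/aut_cubic/A_cubic.
- split=> [|a aa Ma]; first by rewrite M3 scaleN1r.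
  by apply: Mw => //; rewrite Ma scaleN1r.
have M2E k l : i0 != k -> i1 != k -> i0 != l -> i1 != l ->
    M i0 k * M i0 l + M i1 k * M i1 l = 4^-1 *+ (k == l).
  move=> k0 k1 l0 l1; have /matrixP/(_ k l) := M2.
  rewrite [RHS]mxE mxE (bigD1 i0) //= (bigD1 i1) //= big1 => [|m /andP[m0 m1]].
    rewrite !(skewE k _ sM) addr0 mul1r mulNrn; lra.
  by rewrite blk ?mul0r // eq_sym.
have e22 := M2E i2 i2 isT isT isT isT; have e33 := M2E i3 i3 isT isT isT isT.
have e23 := M2E i2 i3 isT isT isT isT; have e24 := M2E i2 i4 isT isT isT isT.
have e34 := M2E i3 i4 isT isT isT isT; have e44 := M2E i4 i4 isT isT isT isT.
rewrite /= ?mulr1n ?mulr0n in e22 e33 e44 e23 e24 e34.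
exfalso; move: (M i0 i2) (M i0 i3) (M i0 i4) (M i1 i2) (M i1 i3) (M i1 i4)
  e22 e33 e44 e23 e24 e34 => p2 p3 p4 q2 q3 q4 e22 e33 e44 e23 e24 e34.
(* Columns 2 and 3 have a nonzero determinant d, so column 4, being orthogonal to
   both, vanishes. *)
have : (p2 * q3 - p3 * q2) ^+ 2 = 4^-1 ^+ 2.
  transitivity ((p2 * p2 + q2 * q2) * (p3 * p3 + q3 * q3) - (p2 * p3 + q2 * q3) ^+ 2).
    ring.
  by rewrite e22 e33 e23; ring.
have : (p2 * q3 - p3 * q2) * p4 = 0.
  transitivity (q3 * (p2 * p4 + q2 * q4) - q2 * (p3 * p4 + q3 * q4)); first ring.
  by rewrite e24 e34; ring.
have : (p2 * q3 - p3 * q2) * q4 = 0.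
  transitivity (p2 * (p3 * p4 + q3 * q4) - p3 * (p2 * p4 + q2 * q4)); first ring.
  by rewrite e24 e34; ring.
move: (_ - _) => d dq dp dd.
have : d * (p4 * p4 + q4 * q4) = 0 by rewrite mulrDr !mulrA dq dp !mul0r addr0.
move: dd; rewrite e44 => dd /eqP; rewrite mulf_eq0 => /orP[/eqP d0|/eqP]; last lra.
by move: dd; rewrite d0; lra.
Qed.

End FixingA1.

End Frames.

(** * Automorphisms preserving rotation generators *)

Section Structure.
Local Open Scope ring_scope.
Variable R : realType.
Implicit Types (M N P : 'M[R]_8) (x y z a b c : 'cV[R]_8) (g h : autso8 R).

Notation e := (basis R).
Local Notation i0 := (@Ordinal 8 0 isT).
Local Notation i1 := (@Ordinal 8 1 isT).
Local Notation i2 := (@Ordinal 8 2 isT).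
Local Notation A := (so8_delta R i0).

Lemma cls_wedge P u x y : O8 P -> vsval u = wedge x y ->
  vsval (cls P u) = wedge (P *m x) (P *m y).
Proof. by move=> OP uE; rewrite clsTE // uE wedge_conj. Qed.

Lemma PO8_cls P : O8 P -> PO8 R (cls P). Proof. by move=> OP; exists P. Qed.

Lemma PO8_mulVl P g : O8 P -> PO8 R (cls P * g)%g -> PO8 R g.
Proof.
move=> OP [Q OQ QE]; exists (P^T *m Q); first by apply: O8_mul => //; apply: O8_tr.
by rewrite -clsM ?QE; [rewrite -clsV // mulKg | apply: O8_tr |].
Qed.

(** The planes of the images of E_01 - E_10 and E_02 - E_20 meet in a line, spanned by
    f0. A nonzero column of index at least 2 of the second image lies on this line. *)
Lemma image_A2 g : g (A i1) = A i1 -> exists f0 f1 f2 : 'cV[R]_8,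
  [/\ [/\ dot f0 f0 = 1, dot f1 f1 = 1 & dot f2 f2 = 1],
      [/\ dot f0 f1 = 0, dot f0 f2 = 0 & dot f1 f2 = 0],
      wedge (e i0) (e i1) = wedge f0 f1 &
      vsval (g (A i2)) = wedge f0 f2].
Proof.
move=> gA1; have [blk M01] := image_block gA1 (isT : i0 != i2) (isT : i1 != i2).
have [M3 Mw] := image_cube gA1 (isT : i0 != i2) (isT : i1 != i2).
set M := vsval (g (A i2)) in blk M01 M3 Mw *.
have sM : skew M by apply: skewP.
have M0 : M != 0 by exact/aut_neq0/A_neq0.
have [l [l0 l1 Ml]] : exists l, [/\ i0 != l, i1 != l & M *m e l != 0].
  apply: contrapT => /forallNP none; case/eqP: M0.
  have {}none l : i0 != l -> i1 != l -> forall k, M k l = 0.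
    move=> l0 l1 k; rewrite -mulmx_basis.
    have [->|Ml] := eqVneq (M *m e l) 0; first by rewrite mxE.
    by case: (none l).
  have M10 : M i1 i0 = 0 by rewrite skewE // M01 oppr0.
  apply/matrixP => k l; rewrite [RHS]mxE.
  have [l0|l0] := eqVneq i0 l; last first.
    have [l1|l1] := eqVneq i1 l; last exact: none.
    have [k0|k0] := eqVneq i0 k; first by rewrite -l1 -k0.
    have [k1|k1] := eqVneq i1 k; first by rewrite -l1 -k1 skew_diag.
    by rewrite skewE // none ?oppr0.
  have [k0|k0] := eqVneq i0 k; first by rewrite -l0 -k0 skew_diag.
  have [k1|k1] := eqVneq i1 k; first by rewrite -l0 -k1.
  by rewrite skewE // none ?oppr0.
set x := M *m e l in Ml; pose r := Num.sqrt (dot x x).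
have rr : r * r = dot x x by rewrite -expr2 sqr_sqrtr // dot_ge0.
have r0 : r != 0 by rewrite -(sqrf_eq0 r) expr2 rr dot_eq0.
pose f0 := r^-1 *: x.
have f00 : dot f0 f0 = 1 by rewrite !dot_lin -rr; field.
have MMf0 : M *m (M *m f0) = - f0.
  rewrite /f0 -!scalemxAr -scalerN; congr (_ *: _).
  by rewrite /x 2!mulmxA M3 mulNmx.
have f0k k : i0 != k -> i1 != k -> f0 k 0 = 0.
  by move=> k0 k1; rewrite mxE mulmx_basis blk // mulr0.
move: f0 f00 MMf0 f0k => f0 f00 MMf0 f0k; pose f2 := - (M *m f0).
pose al := f0 i0 0; pose be := f0 i1 0.
have f0E : f0 = al *: e i0 + be *: e i1.
  apply/matrixP => k j; rewrite [j]ord1 !mxE !eqxx !andbT.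
  have [->|k0] := eqVneq k i0; first by rewrite /= !mulr1 mulr0 addr0.
  have [->|k1] := eqVneq k i1; first by rewrite mulr1 mulr0 add0r.
  by rewrite !mulr0 addr0 f0k // eq_sym.
have ab : al * al + be * be = 1.
  by rewrite -f00 [in RHS]f0E !dot_lin !dot_basis !eqxx /=; ring.
(* The second vector is f0 turned by a right angle in the plane of e_0 and e_1. *)
exists f0, (al *: e i1 - be *: e i0).
have Me0 : dot (e i0) f2 = 0.
  rewrite /f2 f0E mulmxDr -!scalemxAr !dot_lin !dot_basisl !mulmx_basis.
  by rewrite M01 skew_diag //; ring.
have Me1 : dot (e i1) f2 = 0.
  rewrite /f2 f0E mulmxDr -!scalemxAr !dot_lin !dot_basisl !mulmx_basis.
  by rewrite (skewE i1 i0 sM) M01 skew_diag //; ring.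
have f22 : dot f2 f2 = 1.
  by rewrite /f2 !dot_lin dot_skewl // MMf0 !dot_lin f00; ring.
have MfE : M = wedge f0 f2 by rewrite {1}(Mw f0 f00 MMf0) /f2 wedgeNr wedgeC.
move: f2 Me0 Me1 f22 MfE => f2 Me0 Me1 f22 MfE; exists f2.
split=> //.
- by split=> //; rewrite !dot_lin !dot_basis !eqxx /= -[RHS]ab; ring.
- split.
  + by rewrite f0E !dot_lin !dot_basis !eqxx /=; ring.
  + by rewrite f0E !dot_lin Me0 Me1; ring.
  + by rewrite !dot_lin Me0 Me1; ring.
- rewrite f0E !(wedgeDl, wedgeDr, wedgeNr, wedgeZl, wedgeZr, wedgexx).
  rewrite (wedgeC (e i0) (e i1)); move: (wedge _ _) => W.
  by rewrite -[LHS]scale1r -ab; apply/matrixP => k j; rewrite !mxE; ring.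
Qed.

Lemma wedgeE x y k l : wedge x y k l = x k 0 * y l 0 - y k 0 * x l 0.
Proof. by rewrite !mxE !big_ord1 !mxE. Qed.

(** Both block conditions leave only row and column 0 and the entry (1, 2). If that
    entry were nonzero, the image would be a multiple of E_12 - E_21, which is fixed
    by g, against injectivity. *)
Lemma image_A g j : g (A i1) = A i1 -> g (A i2) = A i2 -> i0 != j ->
  exists2 f, dot (e i0) f = 0 & vsval (g (A j)) = wedge (e i0) f.
Proof.
move=> gA1 gA2 j0.
have [<-|j1] := eqVneq i1 j; first by exists (e i1); rewrite ?gA1 ?AE ?dot_basis.
have [<-|j2] := eqVneq i2 j; first by exists (e i2); rewrite ?gA2 ?AE ?dot_basis.
have [blk M01] := image_block gA1 j0 j1.
have [M3 Mw] := image_cube gA1 j0 j1.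
set M := vsval (g (A j)) in blk M01 M3 Mw *.
have sM : skew M by apply: skewP.
have M0 : M != 0 by exact/aut_neq0/A_neq0.
have [blk2 M02] : (forall k l, i0 != k -> i2 != k -> i0 != l -> i2 != l -> M k l = 0)
    /\ M i0 i2 = 0.
  apply: eigen_block => //.
  by rewrite -AE -gA2 -!aut_bracketE bracket_AA // autN vsvalN.
have Me1 : M *m e i1 = - M i1 i2 *: e i2.
  apply/matrixP => k m; rewrite [m]ord1 mulmx_basis !mxE eqxx andbT.
  have [->|k2] := eqVneq k i2; first by rewrite mulr1 skewE.
  have [->|k0] := eqVneq k i0; first by rewrite M01 mulr0.
  by rewrite mulr0 blk2 // eq_sym.
have Me2 : M *m e i2 = M i1 i2 *: e i1.
  apply/matrixP => k m; rewrite [m]ord1 mulmx_basis !mxE eqxx andbT.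
  have [->|k1] := eqVneq k i1; first by rewrite mulr1.
  have [->|k0] := eqVneq k i0; first by rewrite M02 mulr0.
  by rewrite mulr0 blk // eq_sym.
have M12 : M i1 i2 = 0.
  set c := M i1 i2 in Me1 Me2 *; apply: contrapT => /eqP c0.
  have MMe1 : M *m (M *m e i1) = - (c * c) *: e i1.
    by rewrite Me1 -scalemxAr Me2 scalerA mulNr.
  have cc : c * c = 1.
    have : M *m (M *m (M *m e i1)) = - (M *m e i1) by rewrite 2!mulmxA M3 mulNmx.
    rewrite MMe1 -scalemxAr Me1 => /matrixP/(_ i2 0).
    rewrite !mxE /= !mulr1 => ccE; apply: (mulIf c0); lra.
  have ME : M = c *: wedge (e i1) (e i2).
    rewrite (Mw (e i1)) ?MMe1 ?cc ?scaleN1r ?dot_basis //.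
    by rewrite Me1 wedgeZl (wedgeC (e i1)) scalerN scaleNr opprK.
  have gd : g (so8_delta R i1 i2) = so8_delta R i1 i2.
    by rewrite delta_bracket // autN aut_bracket gA1 gA2.
  suff /(aut_neq0 g) : vsval (A j - c *: so8_delta R i1 i2) != 0.
    rewrite autD autN autZ gd vsvalD vsvalN vsvalZ so8_deltaE skew_delta_wedge.
    by rewrite -/M ME subrr eqxx.
  rewrite vsvalD vsvalN vsvalZ AE so8_deltaE skew_delta_wedge.
  apply/eqP => /matrixP/(_ i0 j)/eqP.
  rewrite !mxE !big_ord1 !mxE !eqxx (eq_sym j i0) (negPf j0) /=.
  by rewrite !(mul0r, mulr0, subr0, mulr1) oner_eq0.
have [f f0 fE] : exists2 f : 'cV[R]_8, dot (e i0) f = 0 & forall k, f k 0 = - M k i0.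
  exists (- (M *m e i0)); first by rewrite dotNr dot_skew // oppr0.
  by move=> k; rewrite mxE mulmx_basis.
exists f => //; apply/matrixP => k l; rewrite wedgeE !fE !mxE !eqxx !andbT.
have [->|k0] := eqVneq k i0.
  have [->|l0] := eqVneq l i0; first by rewrite skew_diag //; ring.
  by rewrite mul1r mulr0 subr0 skewE.
rewrite mul0r; have [->|l0] := eqVneq l i0; first by rewrite mulr1 sub0r opprK.
rewrite mulr0 subr0.
have [->|k1] := eqVneq k i1.
  have [->|l1] := eqVneq l i1; first by rewrite skew_diag.
  have [->|l2] := eqVneq l i2; first by rewrite M12.
  by rewrite blk2 // eq_sym.
have [->|l1] := eqVneq l i1.
  have [->|k2] := eqVneq k i2; first by rewrite skewE // M12 oppr0.
  by rewrite blk2 // eq_sym.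
by rewrite blk // eq_sym.
Qed.

(** The vectors f_j with g (E_0j - E_j0) = e_0 /\ f_j are orthonormal because the
    length of f is read off the cubic equation of e_0 /\ f, also for the sums
    f_i + f_j. The matrix with these columns then induces g. *)
Lemma PO8_fixing_A g : g (A i1) = A i1 -> g (A i2) = A i2 -> PO8 R g.
Proof.
move=> gA1 gA2.
have /choice[f fP] : forall j, exists f : 'cV[R]_8, i0 != j ->
    dot (e i0) f = 0 /\ vsval (g (A j)) = wedge (e i0) f.
  move=> j; have [<-|j0] := eqVneq i0 j; first by exists 0.
  by have [x x0 xE] := image_A gA1 gA2 j0; exists x.
have e00 : dot (e i0) (e i0) = 1 by rewrite dot_basis.
have norm u (x y : 'cV[R]_8) : dot (e i0) x = 0 -> dot (e i0) y = 0 ->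
    vsval u = wedge (e i0) x -> x != 0 -> vsval (g u) = wedge (e i0) y ->
  dot y y = dot x x.
  move=> x0 y0 ux xn0 gu; apply: (@cubic_unique R _ _ (vsval (g u))).
  - exact: skewP.
  - by apply: aut_neq0; rewrite ux wedge_neq0.
  - by rewrite gu; apply: wedge_cubic.
  - by apply: aut_cubic; rewrite ux; apply: wedge_cubic.
have ff j : i0 != j -> dot (f j) (f j) = 1.
  move=> j0; have [fj0 fjE] := fP j j0.
  rewrite (norm (A j) (e j)) ?AE ?dot_basis ?eqxx ?(negPf j0) //.
  exact: basis_neq0.
have fij i j : i0 != i -> i0 != j -> i != j -> dot (f i) (f j) = 0.
  move=> i0' j0 ij; have [fi0 fiE] := fP i i0'; have [fj0 fjE] := fP j j0.
  have : dot (f i + f j) (f i + f j) = dot (e i + e j) (e i + e j).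
    apply: (norm (A i + A j)).
    - by rewrite dotDr !dot_basis (negPf i0') (negPf j0) addr0.
    - by rewrite dotDr fi0 fj0 addr0.
    - by rewrite vsvalD !AE wedgeDr.
    - rewrite -dot_eq0 !dot_lin !dot_basis !eqxx (eq_sym j i) (negPf ij).
      by rewrite !addr0 !add0r -(natrD _ 1 1) pnatr_eq0.
    - by rewrite autD vsvalD fiE fjE wedgeDr.
  rewrite !dot_lin !dot_basis !eqxx (eq_sym j i) (negPf ij) !ff // (dotC (f j)).
  by rewrite /=; lra.
pose F j := if j == i0 then e i0 else f j.
pose P : 'M[R]_8 := \matrix_(k, j) F j k 0.
have PE j : P *m e j = F j.
  by apply/matrixP => k m; rewrite [m]ord1 mulmx_basis mxE.
have OP : O8 P.
  apply: mulmx1C; apply/matrixP => i j; rewrite -mulmx_basis -mulmxA PE.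
  rewrite -dot_basisl -dot_mulmxl PE [RHS]mxE /F.
  have [->|i0'] := eqVneq i i0; have [j0E|j0] := eqVneq j i0; rewrite ?j0E.
  - by rewrite e00.
  - have i0j : i0 != j by rewrite eq_sym.
    by case: (fP j i0j).
  - have i0i : i0 != i by rewrite eq_sym.
    by rewrite (negPf i0') dotC; case: (fP i i0i).
  - have [->|ij] := eqVneq i j; first by rewrite ff 1?eq_sym.
    by rewrite fij // eq_sym.
suff -> : g = cls P by apply: PO8_cls.
apply: aut_ext_A => j j0; apply: so8_inj; have [_ ->] := fP j j0.
by rewrite (cls_wedge OP (AE _ _)) !PE /F eqxx (eq_sym j) (negPf j0).
Qed.

Lemma PO8_plane g a b : dot a a = 1 -> dot b b = 1 -> dot a b = 0 ->
  vsval (g (A i1)) = wedge a b -> PO8 R g.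
Proof.
move=> aa bb ab gA1; have [P [OP Pa Pb]] := frame2 aa bb ab.
apply: (PO8_mulVl OP).
have hA1 : (cls P * g)%g (A i1) = A i1.
  by apply: so8_inj; rewrite aut_mulE (cls_wedge OP gA1) Pa Pb AE.
move: (cls P * g)%g hA1 => {gA1}h hA1.
have [f0 [f1 [f2 [[d00 d11 d22] [d01 d02 d12] W hA2]]]] := image_A2 hA1.
have [Q [OQ Q0 Q1 Q2]] := frame3 d00 d11 d22 d01 d02 d12.
apply: (PO8_mulVl OQ); apply: PO8_fixing_A; apply: so8_inj; rewrite aut_mulE.
  rewrite hA1 (@cls_wedge _ _ f0 f1) ?AE // Q0 Q1 //.
by rewrite (cls_wedge OQ hA2) Q0 Q2 AE.
Qed.


End Structure.

(** * Complex structures and the structure of the automorphism group *)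

Section ComplexStructures.
Local Open Scope ring_scope.
Variable R : realType.
Implicit Types (M N P J : 'M[R]_8) (x y z : 'cV[R]_8) (g h : autso8 R).

Let E n : 'cV[R]_8 := basis R (inord n).

Lemma dot_E m n : (m < 8)%N -> (n < 8)%N -> dot (E m) (E n) = (m == n)%:R.
Proof. by move=> m8 n8; rewrite dot_basis -val_eqE /= !inordK. Qed.

Definition pairs_basis k J := forall m, (m < k)%N ->
  J *m E m.*2 = E m.*2.+1 /\ J *m E m.*2.+1 = - E m.*2.

Lemma pairs_basis_inj J J' : pairs_basis 4 J -> pairs_basis 4 J' -> J = J'.
Proof.
move=> JP JP'; apply/matrixP => i j; rewrite -!mulmx_basis.
have -> : basis R j = E j by rewrite /E inord_val.
have j4 : (j./2 < 4)%N by rewrite ltn_half_double.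
have [J0 J1] := JP _ j4; have [J0' J1'] := JP' _ j4.
rewrite -(odd_double_half j); case: (odd j); first by rewrite J1 J1'.
by rewrite J0 J0'.
Qed.

(** One reflection per pair: it moves J e_2k to e_(2k+1) and fixes the vectors already
    dealt with, since both these vectors are orthogonal to them. *)
Lemma conj_pairs_basis J : skew J -> J *m J = (-1)%:M ->
  exists2 P, O8 P & pairs_basis 4 (P *m J *m P^T).
Proof.
move=> sJ J2; suff : forall k, (k <= 4)%N ->
    exists2 P, O8 P & pairs_basis k (P *m J *m P^T) by apply.
elim=> [_|k IH k4]; first by exists 1%:M => //; apply: O8_1.
have [P OP] := IH (ltnW k4).
have [K KE] : exists K, P *m J *m P^T = K by exists (P *m J *m P^T).
rewrite KE => KP.
have sK : skew K by rewrite -KE /skew !trmx_mul trmxK sJ mulNmx mulmxN mulmxA.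
have K2 : K *m K = (-1)%:M.
  rewrite -KE !mulmxA -(mulmxA _ P^T P) (mulmx1C OP) mulmx1 -(mulmxA P J J) J2.
  by rewrite mul_mx_scalar -scalemxAl OP scalemx1.
have kE : (k.*2.+1 < 8)%N by rewrite -[8%N]/(4.*2) -doubleS leq_double.
have mE m : (m < k)%N -> (m.*2.+1 < k.*2)%N.
  by move=> mk; rewrite -doubleS leq_double.
have K2E x : K *m (K *m x) = - x by rewrite mulmxA K2 mul_scalar_mx scaleN1r.
have [|Q [/O8_reflection_or_id OQ Qx fix_]] :=
    @reflection_moving R (K *m E k.*2) (E k.*2.+1).
  rewrite dot_skewl // K2E !dot_lin ?opprK !dot_E ?eqxx //; exact: ltnW.
exists (Q *m P); first exact: O8_mul.
have -> : Q *m P *m J *m (Q *m P)^T = Q *m K *m Q^T by rewrite -KE trmx_mul !mulmxA.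
have fixT z : Q *m z = z -> Q^T *m z = z.
  by move=> {1}<-; rewrite mulmxA (mulmx1C OQ) mul1mx.
have fixE n : (n <= k.*2)%N -> Q *m E n = E n.
  move=> nk; apply: fix_; have n8 : (n < 8)%N by apply: leq_ltn_trans nk (ltnW kE).
  rewrite dot_E // (ltn_eqF (_ : n < k.*2.+1)%N) //.
  move: nk; rewrite leq_eqVlt => /orP[/eqP ->|nk]; first exact: dot_skew.
  have n2 : (n./2 < k)%N by rewrite ltn_half_double.
  have [KP0 KP1] := KP _ n2.
  rewrite -[LHS]opprK -dot_skewl //; have m1 := mE _ n2.
  move: nk; rewrite -(odd_double_half n).
  move: n./2 n2 KP0 KP1 m1 => m n2 KP0 KP1 m1; have k8 := ltnW kE.
  have m8 := ltn_trans m1 k8; have m8' := ltnW m8; case: (odd n) => /= nk.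
    by rewrite add1n KP1 dotNl dot_E ?ltn_eqF ?oppr0 //; apply: ltnW.
  by rewrite add0n KP0 dot_E ?ltn_eqF ?oppr0.
have step0 : Q *m K *m Q^T *m E k.*2 = E k.*2.+1.
  by rewrite -!mulmxA fixT ?Qx // fixE.
move=> m; rewrite ltnS leq_eqVlt => /orP[/eqP ->|mk].
  split=> //; rewrite -step0 !mulmxA.
  rewrite -(mulmxA _ Q^T Q) (mulmx1C OQ) mulmx1 -(mulmxA Q K K) K2.
  by rewrite mul_mx_scalar -scalemxAl OQ scalemx1 mul_scalar_mx scaleN1r.
have [KP0 KP1] := KP m mk; have m1 := mE m mk.
split; rewrite -!mulmxA (fixT (E _)) ?fixE ?(ltnW m1) ?(ltnW (ltnW m1)) //.
  by rewrite KP0 fixE // ltnW.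
by rewrite KP1 mulmxN fixE // ltnW // ltnW.
Qed.

Lemma spin_delta i j : i != j ->
  spin (skew_delta R i j) = 2^-1 *: (gam R i *m (gam R j)^T).
Proof.
move=> ij; have gE k l : gsum (delta_mx k l) = gam R k *m (gam R l)^T.
  rewrite /gsum (bigD1 k) //= [X in _ + X]big1 ?addr0 => [|m /negPf mk]; last first.
    by rewrite big1 // => n _; rewrite mxE mk scale0r.
  rewrite (bigD1 l) //= big1 ?addr0 => [|m /negPf ml]; last first.
    by rewrite mxE ml andbF scale0r.
  by rewrite mxE !eqxx scale1r.
have ji : gam R j *m (gam R i)^T = - (gam R i *m (gam R j)^T).
  by apply/eqP; rewrite -addr_eq0 addrC gam_gamT (negPf ij) raddf0.
rewrite /spin /skew_delta [gsum _]linearB /= !gE ji opprK.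
by move: (gam R i *m _) => X; apply/matrixP => k l; rewrite !mxE; field.
Qed.

Local Notation i0 := (@Ordinal 8 0 isT).
Local Notation i1 := (@Ordinal 8 1 isT).

Lemma triality_A1 : vsval (triality R (so8_delta R i0 i1)) = 2^-1 *: smx R (cliff2 0 1).
Proof. by rewrite trialityE so8_deltaE spin_delta // gam2E. Qed.

Lemma cliff2_pairs_basis : pairs_basis 4 (smx R (cliff2 0 1)).
Proof.
move=> m m4.
have tab : all (fun i => entry (cliff2 0 1) i == (if odd i then i.-1 else i.+1, ~~ odd i))
  (iota 0 8) by vm_compute.
have e2 n : (n < 8)%N -> smx R (cliff2 0 1) *m E n =
    (-1) ^+ (odd n) *: E (if odd n then n.-1 else n.+1).
  move=> n8; apply/matrixP => i j; rewrite [j]ord1 mulmx_basis smxE !mxE eqxx andbT.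
  rewrite (eqP (all_ord8 tab i)) -val_eqE /= !inordK //; last first.
    by case: n n8 => [|[|[|[|[|[|[|[|]]]]]]]].
  case: i => i i8 /=; rewrite mulr_natr.
  by case: n n8 => [|[|[|[|[|[|[|[|]]]]]]]] // _;
     case: i i8 => [|[|[|[|[|[|[|[|]]]]]]]] .
have m8 : (m.*2.+1 < 8)%N by rewrite -[8%N]/(4.*2) -doubleS leq_double.
rewrite !e2 //; last exact: ltnW.
by rewrite /= odd_double /= expr1 expr0 scaleN1r scale1r.
Qed.

(** If g does not map E_01 - E_10 to a rotation generator, twice the image is a
    complex structure. An orthogonal matrix moves the image to that of E_01 - E_10
    under triality, so that triality^-1 reduces to the first case. *)
Theorem aut_structure g : PO8 R g \/
  exists h1 h2, [/\ PO8 R h1, PO8 R h2 & g = (h1 * triality R * h2)%g].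
Proof.
pose A1 := so8_delta R i0 i1.
have sM : skew (vsval (g A1)) by apply: skewP.
have [||||[M3 Mw]|M2] := @cubic_dichotomy R 1 (vsval (g A1)).
- exact: sM.
- exact/aut_neq0/A_neq0.
- exact: oner_neq0.
- exact/aut_cubic/A_cubic.
- left; have M0 : vsval (g A1) != 0 by exact/aut_neq0/A_neq0.
  have [x x0] : exists x, vsval (g A1) *m x != 0.
    apply: contrapT => /forallNP none; case/eqP: M0; apply: mulmx_ext => x.
    by rewrite mul0mx; apply/eqP/negPn/negP/none.
  pose r := Num.sqrt (dot (vsval (g A1) *m x) (vsval (g A1) *m x)).
  have rr : r * r = dot (vsval (g A1) *m x) (vsval (g A1) *m x).
    by rewrite -expr2 sqr_sqrtr // dot_ge0.
  have r0 : r != 0 by rewrite -(sqrf_eq0 r) expr2 rr dot_eq0.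
  pose a := r^-1 *: (vsval (g A1) *m x).
  have aa : dot a a = 1 by rewrite !dot_lin -rr; field.
  have MMa : vsval (g A1) *m (vsval (g A1) *m a) = - a.
    rewrite /a -!scalemxAr -scalerN; congr (_ *: _).
    by rewrite 2!mulmxA M3 scaleN1r mulNmx.
  (* A unit vector a in the image of M satisfies M^2 a = - a. *)
  apply: (@PO8_plane R _ (vsval (g A1) *m a) a) => //.
  + by rewrite dot_skewl // MMa dotNr aa opprK.
  + by rewrite dotC dot_skew.
  + by rewrite {1}(Mw a aa) ?MMa ?scaleN1r.
right; set M := vsval (g A1) in sM M2.
have [||P OP PJ] := @conj_pairs_basis (2 *: M).
- by rewrite /skew linearZ /= sM scalerN.
- rewrite -scalemxAl -scalemxAr M2 !scale_scalar_mx; congr (_%:M); lra.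
have hA1 : (cls P * g)%g A1 = triality R A1.
  apply: so8_inj; rewrite aut_mulE clsTE // triality_A1.
  rewrite -(pairs_basis_inj PJ cliff2_pairs_basis) -scalemxAr -!scalemxAl scalerA.
  by rewrite mulVf ?scale1r ?pnatr_eq0.
exists (cls P)^-1%g, ((triality R)^-1 * (cls P * g))%g; split.
- by rewrite clsV //; apply/PO8_cls/O8_tr.
- apply: (@PO8_plane R _ (basis R i0) (basis R i1)); rewrite ?dot_basis //.
  by rewrite aut_mulE hA1 -aut_mulE mulVg aut_1E AE.
- by rewrite mulgA mulgK mulKg.
Qed.

End ComplexStructures.

(** * Connected components *)

Section Components.
Local Open Scope ring_scope.
Variable R : realType.
Implicit Types (P Q : 'M[R]_8) (x y a b : 'cV[R]_8) (g h : autso8 R).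

Lemma continuous_to_aut (T : topologicalType) (f : T -> autso8 R) :
    (forall u i j, continuous (fun t => vsval (f t u) i j)) -> continuous f.
Proof.
move=> cf; apply: (@continuous_comp_initial _ T _ (@aut_eval R) f) => t.
apply/cvg_sup => u.
apply: (@continuous_comp_initial _ T _ (fun h : {ptws so8 R -> 'M[R]_8} => h u)
  (@aut_eval R \o f)) => {}t A [B tB sBA].
apply: filterS (_ : \forall t' \near t, forall i j, B i j (vsval (f t' u) i j)).
  by move=> t' Bt'; apply: sBA => i j; apply: Bt'.
apply: filter_forall => i; apply: filter_forall => j.
exact: (cf u i j t _ (tB i j)).
Qed.

Lemma continuous_entry u i j : continuous (fun g : autso8 R => vsval (g u) i j).
Proof.
move=> g; apply: (@continuous_comp _ _ _ (fun h : autso8 R => vsval (h u))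
  (fun M : 'M[R]_8 => M i j)); last exact: coord_continuous.
apply: (@continuous_comp _ _ _ (@aut_eval R) (fun h : {ptws so8 R -> 'M[R]_8} => h u)).
  exact: initial_continuous.
exact: (@proj_continuous _ (fun _ : so8 R => 'M[R]_8) u).
Qed.

Lemma continuous_sum (T : topologicalType) (I : finType) (F : I -> T -> R) :
  (forall i, continuous (F i)) -> continuous (fun t => \sum_i F i t).
Proof.
by move=> cF; apply: continuous_big => // ; apply: add_continuous.
Qed.

Lemma continuous_cst (T : topologicalType) (c : R) : continuous (fun _ : T => c).
Proof. by move=> t; apply: cvg_cst. Qed.

Lemma continuous_mulf (T : topologicalType) (f f' : T -> R) :
  continuous f -> continuous f' -> continuous (fun t => f t * f' t).
Proof. by move=> cf cf' t; apply: cvgM; [apply: cf | apply: cf']. Qed.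

Lemma continuous_subf (T : topologicalType) (f f' : T -> R) :
  continuous f -> continuous f' -> continuous (fun t => f t - f' t).
Proof. by move=> cf cf' t; apply: cvgB; [apply: cf | apply: cf']. Qed.

Lemma continuous_addf (T : topologicalType) (f f' : T -> R) :
  continuous f -> continuous f' -> continuous (fun t => f t + f' t).
Proof. by move=> cf cf' t; apply: cvgD; [apply: cf | apply: cf']. Qed.

Lemma continuous_invf (T : topologicalType) (f : T -> R) :
  (forall t, f t != 0) -> continuous f -> continuous (fun t => (f t)^-1).
Proof. by move=> f0 cf t; apply: cvgV => //; apply: cf. Qed.

Lemma continuous_mull g : continuous (fun h => (g * h)%g).
Proof.
apply: continuous_to_aut => u i j.
have -> : (fun h => vsval ((g * h)%g u) i j) = fun h => 2^-1 *
    \sum_k \sum_l vsval (h u) k l * vsval (g (so8_delta R k l)) i j.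
  apply/funext => h; rewrite aut_mulE; apply: (mulfI (_ : 2 != 0)) => //.
  rewrite mulVKf // mulrC mulr_natr -mulmxnE -vsvalMn -autMn so8_sum_delta.
  rewrite aut_sum vsval_sum summxE; apply: eq_bigr => k _.
  rewrite aut_sum vsval_sum summxE; apply: eq_bigr => l _.
  by rewrite autZ vsvalZ mxE.
apply: continuous_mulf; first exact: continuous_cst.
apply: continuous_sum => k; apply: continuous_sum => l.
by apply: continuous_mulf; [apply: continuous_entry | apply: continuous_cst].
Qed.

Lemma continuous_mulr g : continuous (fun h => (h * g)%g).
Proof.
apply: continuous_to_aut => u i j.
have -> : (fun h => vsval ((h * g)%g u) i j) = fun h => vsval (h (g u)) i j.
  by apply/funext => h; rewrite aut_mulE.
exact: continuous_entry.
Qed.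

Definition conn g h := connected_component [set: autso8 R] g h.

Lemma conn_image (f : autso8 R -> autso8 R) g h :
  continuous f -> conn g h -> conn (f g) (f h).
Proof.
move=> cf [C [Cg _ cC] Ch]; exists (f @` C); last by exists h.
split=> //.
by apply: connected_continuous_connected => //; apply: continuous_subspaceT.
Qed.

Lemma connM g g' h h' : conn g g' -> conn h h' -> conn (g * h)%g (g' * h')%g.
Proof.
move=> gg hh; apply: connected_component_trans (_ : conn _ (g' * h)%g) _.
  exact: conn_image (@continuous_mulr h) gg.
exact: conn_image (@continuous_mull g') hh.
Qed.

Lemma conn_refl g : conn g g. Proof. exact: connected_component_refl. Qed.

Lemma conn_path (f : R -> autso8 R) s t : continuous f -> conn (f s) (f t).
Proof.
move=> cf; exists (f @` setT); last by exists t.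
split=> //.
apply: connected_continuous_connected; last exact: continuous_subspaceT.
by apply/connected_intervalP.
Qed.

Lemma reflection_scale c x : c != 0 -> reflection (c *: x) = reflection x.
Proof.
move=> c0; have [->|x0] := eqVneq x 0; first by rewrite scaler0.
have xx0 : dot x x != 0 by rewrite dot_eq0.
rewrite /reflection [(c *: x)^T]linearZ -scalemxAl -[x *m _]scalemxAr !scalerA !dot_lin.
by congr (_ - _ *: _); field; rewrite c0 xx0.
Qed.

(** The reflections in the vectors of the segment from a to b form a path, unless the
    segment passes through 0; then a and b are proportional and the two reflections
    are equal. *)
Lemma conn_reflections a b : a != 0 -> b != 0 ->
  conn (cls (reflection a)) (cls (reflection b)).
Proof.
move=> a0 b0; pose v (t : R) := a + t *: (b - a).
have [v0|] := pselect (forall t, v t != 0); last first.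
  move=> /existsNP[t /negP/negPn/eqP]; rewrite /v => vt0.
  have ab : (1 - t) *: a = - t *: b.
    apply/eqP; rewrite scaleNr -addr_eq0 -[X in _ == X]vt0.
    by rewrite scalerBl scale1r scalerBr addrAC addrA addrAC.
  have t1 : 1 - t != 0.
    apply/eqP => t1; move: ab; rewrite t1 scale0r => /esym/eqP.
    by rewrite scaler_eq0 (negPf b0) orbF => /eqP; lra.
  have aE : a = (- t / (1 - t)) *: b.
    by apply: (scalerI t1); rewrite ab scalerA mulrC divfK.
  have c0 : - t / (1 - t) != 0.
    by apply: contraNneq a0 => c0; rewrite aE c0 scale0r.
  by rewrite aE reflection_scale //; apply: conn_refl.
have vE (t : R) i : v t i 0 = a i 0 + t * (b i 0 - a i 0) by rewrite !mxE.
suff cf : continuous (fun t => cls (reflection (v t))).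
  have := conn_path 0 1 cf.
  by rewrite /v scale0r addr0 scale1r addrC subrK.
have cv i : continuous (fun t => v t i 0).
  have -> : (fun t => v t i 0) = fun t => a i 0 + t * (b i 0 - a i 0).
    by apply/funext => t; apply: vE.
  apply: continuous_addf; first exact: continuous_cst.
  by apply: continuous_mulf; [move=> t; apply: cvg_id | apply: continuous_cst].
have cr k l : continuous (fun t => reflection (v t) k l).
  have -> : (fun t => reflection (v t) k l) = fun t =>
      (k == l)%:R - 2 * (\sum_i v t i 0 * v t i 0)^-1 * (v t k 0 * v t l 0).
    apply/funext => t; move: (v t) => w.
    by rewrite -dotE !mxE big_ord1 !mxE.
  apply: continuous_subf; first exact: continuous_cst.
  apply: continuous_mulf; last by apply: continuous_mulf; apply: cv.
  apply: continuous_mulf; first exact: continuous_cst.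
  apply: continuous_invf; first by move=> t; rewrite -dotE dot_eq0.
  by apply: continuous_sum => i; apply: continuous_mulf; apply: cv.
apply: continuous_to_aut => u i j.
have -> : (fun t => vsval (cls (reflection (v t)) u) i j) = fun t =>
    \sum_k (\sum_l reflection (v t) i l * vsval u l k) * reflection (v t) j k.
  apply/funext => t; rewrite clsTE; last exact: O8_reflection.
  by rewrite mxE; apply: eq_bigr => k _; rewrite !mxE.
apply: continuous_sum => k; apply: continuous_mulf; last exact: cr.
apply: continuous_sum => l; apply: continuous_mulf; first exact: cr.
exact: continuous_cst.
Qed.

Local Notation i0 := (@Ordinal 8 0 isT).

Definition refl0 : autso8 R := cls (reflection (basis R i0)).

Lemma reflectionK x : x != 0 -> reflection x *m reflection x = 1%:M.
Proof. by move=> x0; rewrite -{2}reflection_tr; apply: O8_reflection. Qed.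

Lemma refl0K : (refl0 * refl0)%g = 1%g.
Proof.
have b0 := basis_neq0 R i0; have Ob := O8_reflection b0.
by rewrite /refl0 clsM // reflectionK // cls1.
Qed.

Definition near_refl0 g := conn g 1%g \/ conn g refl0.

Lemma near_refl0_mul Q P : reflection_or_id Q -> O8 P ->
  near_refl0 (cls P) -> near_refl0 (cls (Q *m P)).
Proof.
case=> [->|[x x0 ->]] OP nP; first by rewrite mul1mx.
rewrite -clsM //; last exact: O8_reflection.
have xb : conn (cls (reflection x)) refl0.
  exact: conn_reflections x0 (basis_neq0 R i0).
case: nP => nP; [right | left].
  by rewrite -(mulg1 refl0); apply: connM.
by rewrite -refl0K; apply: connM.
Qed.

(** Every orthogonal matrix is a product of reflections: induct on the number k of
    basis vectors that are not known to be fixed. *)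
Lemma near_refl0_cls P : O8 P -> near_refl0 (cls P).
Proof.
suff main k Q : (k <= 8)%N -> O8 Q ->
    (forall i : 'I_8, (i < 8 - k)%N -> Q *m basis R i = basis R i) ->
  near_refl0 (cls Q).
  by move=> OP; apply: (main 8) => // i; rewrite subnn.
elim: k Q => [|k IH] Q k8 OQ Qfix.
  rewrite (_ : Q = 1%:M) ?cls1; first by left; apply: conn_refl.
  apply/matrixP => i j; rewrite -!mulmx_basis mul1mx Qfix //.
have n8 : (8 - k.+1 < 8)%N by rewrite ltn_subrL.
pose n := Ordinal n8.
have [|S [rS Sn Sfix]] := @reflection_moving R (Q *m basis R n) (basis R n).
  by rewrite O8_dot.
have OS := O8_reflection_or_id rS.
have -> : Q = S *m (S *m Q).
  case: rS => [->|[x x0 ->]]; first by rewrite !mul1mx.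
  by rewrite mulmxA reflectionK // mul1mx.
apply: near_refl0_mul => //; first exact: O8_mul.
apply: IH; [exact: ltnW | exact: O8_mul |] => i.
rewrite -subnSK // ltnS leq_eqVlt -mulmxA => /orP[/eqP i_n|i_n].
  by rewrite (_ : i = n) //; apply: val_inj.
by rewrite Qfix // Sfix // -[X in dot X (Q *m _)](Qfix i) // O8_dot.
Qed.

Lemma normalizerM (gT : groupType) (H : set gT) (x y : gT) :
  set_normalizer H x -> set_normalizer H y -> set_normalizer H (x * y)%g.
Proof.
by rewrite /set_normalizer /= => xH yH; rewrite -conj_setM xH yH.
Qed.

Lemma refl0E : refl0 = scls R (sI 1 7).
Proof.
rewrite /refl0 /scls; congr cls; apply/matrixP => i j.
rewrite smxE /reflection dot_basis eqxx /entry nth_mkseq // !mxE big_ord1 !mxE !eqxx.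
rewrite !andbT divr1 ltnS leqn0 /=.
have -> : ((i : nat) == j) = (i == j) by [].
have [i_0|i_0] := eqVneq i i0; have [j_0|j_0] := eqVneq j i0.
- by rewrite i_0 j_0 eqxx /= expr1 !mulr1n; ring.
- by rewrite i_0 (eq_sym i0) (negPf j_0) !mulr0 subr0 !mulr0n.
- by rewrite j_0 (negPf i_0) mul0r mulr0 subr0 !mulr0n.
- rewrite (_ : ((i : nat) == 0%N) = false); last exact: negPf i_0.
  by rewrite expr0 !mulr0 subr0.
Qed.

Theorem normalizer_meets_components g :
  set_normalizer (F17 R) `&` connected_component [set: autso8 R] g !=set0.
Proof.
have N1 : set_normalizer (F17 R) 1%g by rewrite /set_normalizer /= conj_set1.
have Ns : set_normalizer (F17 R) refl0.
  by rewrite refl0E; apply: reflection_normalizes_F17.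
have PO8_near h : PO8 R h -> exists2 n, set_normalizer (F17 R) n & conn h n.
  by move=> [P OP <-]; case: (near_refl0_cls OP) => hn; [exists 1%g | exists refl0].
case: (aut_structure g) => [/PO8_near[n Nn gn]|[h1 [h2 []]]]; first by exists n.
move=> /PO8_near[n1 Nn1 hn1] /PO8_near[n2 Nn2 hn2] ->.
exists (n1 * triality R * n2)%g; split.
  apply: normalizerM => //; apply: normalizerM => //.
  exact: triality_normalizes_F17.
by apply: connM => //; apply: connM => //; apply: conn_refl.
Qed.

End Components.

(** * Binary codes of length 8 *)

Section Words.

Fixpoint words n : seq (seq bool) :=
  if n is n'.+1 then [seq b :: w | b <- [:: false; true], w <- words n'] else [:: [::]].

Lemma mem_words n w : (w \in words n) = (size w == n).
Proof.
elim: n w => [|n IH] w; first by case: w.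
have -> : words n.+1 = [seq b :: w | b <- [:: false; true], w <- words n] by [].
case: w => [|b w]; first by apply/negbTE/negP => /allpairsP[p []].
rewrite [size _]/= eqSS -IH; apply/allpairsP/idP => [[p [_ pn [_ ->]]]|wn] //.
by exists (b, w); split=> //; case: b.
Qed.

Definition wxor (v w : seq bool) := [seq p.1 (+) p.2 | p <- zip v w].
Definition wdot (v w : seq bool) := foldr addb false [seq p.1 && p.2 | p <- zip v w].
Definition wzero := nseq 8 false.
Definition wones := nseq 8 true.
Definition weight (w : seq bool) := count id w.

Lemma size_wxor v w : size v = 8 -> size w = 8 -> size (wxor v w) = 8.
Proof. by move=> v8 w8; rewrite size_map size_zip v8 w8. Qed.

Lemma nth_wxor v w i : size v = 8 -> size w = 8 ->
  nth false (wxor v w) i = nth false v i (+) nth false w i.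
Proof.
move=> v8 w8; have [i8|i8] := ltnP i 8.
  by rewrite (nth_map (false, false)) ?size_zip ?v8 ?w8 // nth_zip ?v8.
by rewrite !nth_default ?size_wxor ?v8 ?w8.
Qed.

Lemma wdotE v w : size v = 8 -> size w = 8 ->
  wdot v w = \big[addb/false]_(i < 8) (nth false v i && nth false w i).
Proof.
move=> v8 w8; rewrite /wdot foldrE big_map.
rewrite (big_nth (false, false)) size_zip v8 w8 big_mkord.
by apply: eq_bigr => i _; rewrite nth_zip ?v8.
Qed.

Lemma wdotDr u v w : size u = 8 -> size v = 8 -> size w = 8 ->
  wdot u (wxor v w) = wdot u v (+) wdot u w.
Proof.
move=> u8 v8 w8; rewrite !wdotE ?size_wxor // -big_split.
by apply: eq_bigr => i _; rewrite nth_wxor // andb_addr.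
Qed.

End Words.

Section DoubleDual.
Local Open Scope ring_scope.

Definition wvec (w : seq bool) : 'rV['F_2]_8 := \row_i (nth false w i)%:R.

Lemma F2_bool (x : 'F_2) : x = (x != 0)%:R.
Proof. by case: x => [[|[|//]]] p; apply: val_inj. Qed.

Lemma F2_addb (b c : bool) : (b (+) c)%:R = b%:R + c%:R :> 'F_2.
Proof. by case: b; case: c => //; apply: val_inj. Qed.

Lemma wvec_inj v w : size v = 8%N -> size w = 8%N -> wvec v = wvec w -> v = w.
Proof.
move=> v8 w8 vw; apply: (@eq_from_nth _ false); first by rewrite v8 w8.
move=> i; rewrite v8 => i8; have /rowP/(_ (Ordinal i8)) := vw.
by rewrite !mxE /=; case: nth; case: nth.
Qed.

Lemma wvec_xor v w : size v = 8%N -> size w = 8%N ->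
  wvec (wxor v w) = wvec v + wvec w.
Proof. by move=> v8 w8; apply/rowP => i; rewrite !mxE nth_wxor // F2_addb. Qed.

Lemma F2_big_addb (F : 'I_8 -> bool) :
  (\big[addb/false]_i F i)%:R = \sum_i (F i)%:R :> 'F_2.
Proof. by apply: (big_morph (fun b : bool => b%:R)) => // b c; apply: F2_addb. Qed.

(** A binary linear code is the dual of its dual: a word outside the row space of
    a matrix is detected by a column of its cokernel. *)
Lemma double_dual (C : seq bool -> Prop) v :
    C wzero -> (forall u w, C u -> C w -> C (wxor u w)) ->
    (forall u, C u -> size u = 8%N) -> size v = 8%N ->
    (forall w, size w = 8%N -> (forall u, C u -> wdot u w = false) -> wdot v w = false) ->
  C v.
Proof.
move=> C0 CD C8 v8 vP; pose D := [seq u <- words 8 | `[< C u >]].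
have DP u : u \in D <-> C u.
  rewrite mem_filter mem_words; split=> [/andP[/asboolP]//|Cu].
  by apply/andP; split; [apply/asboolP | apply/eqP/C8].
pose M : 'M['F_2]_(size D, 8) := \matrix_(k, i) wvec (nth [::] D k) 0 i.
have [/submxP[c vE]|vM] := boolP (wvec v <= M)%MS.
  (* Coefficients in F_2 are 0 or 1, so combinations of words are sums of words. *)
  suff [u [Cu uE]] : exists u, C u /\ wvec u = wvec v.
    by rewrite (wvec_inj v8 (C8 u Cu)).
  rewrite vE mulmx_sum_row; elim/big_ind: _ => [|x y [u [Cu <-]] [w [Cw <-]]|k _].
  - by exists wzero; split=> //; apply/rowP => i; rewrite !mxE nth_nseq if_same.
  - by exists (wxor u w); split; [apply: CD | rewrite wvec_xor // C8].
  - have Ck : C (nth [::] D k) by apply/DP; rewrite mem_nth.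
    rewrite [c 0 k]F2_bool; case: (c 0 k != 0).
      by exists (nth [::] D k); split=> //; apply/rowP => i; rewrite !mxE mul1r.
    exists wzero; split=> //; apply/rowP => i.
    by rewrite !mxE mul0r nth_nseq if_same.
have [j vj] : exists j, (wvec v *m cokermx M) 0 j != 0.
  apply: contrapT => /forallNP none; case/negP: vM; rewrite submxE.
  by apply/eqP/rowP => j; rewrite [RHS]mxE; apply/eqP/negPn/negP/none.
move: (cokermx M) (mulmx_coker M) j vj => K MK j vj.
pose w := mkseq (fun i => K (inord i) j != 0) 8.
have w8 : size w = 8%N by rewrite size_mkseq.
have dotE u : size u = 8%N -> (wdot u w)%:R = (wvec u *m K) 0 j :> 'F_2.
  move=> u8; rewrite wdotE // F2_big_addb mxE; apply: eq_bigr => i _.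
  by rewrite nth_mkseq // inord_val mxE [in RHS](F2_bool (K i j)) -natrM mulnb.
suff /(vP w w8) vw : forall u, C u -> wdot u w = false.
  by case/eqP: vj; rewrite -dotE // vw.
move=> u Cu; have /DP uD := Cu.
have : (wdot u w)%:R = 0 :> 'F_2.
  rewrite dotE ?C8 //; have ku : (index u D < size D)%N by rewrite index_mem.
  have -> : wvec u = row (Ordinal ku) M.
    by apply/rowP => i; rewrite !mxE /= nth_index.
  by rewrite -row_mul MK !mxE.
by case: (wdot u w).
Qed.

End DoubleDual.

Section DualClassification.

(** The three coordinate functions on the cube, as words indexed by its vertices: the
    signs of I_(4,4), diag(I_(2,2), I_(2,2)) and D. *)
Definition std_words :=
  [:: [:: true; true; true; true; false; false; false; false];
      [:: true; true; false; false; true; true; false; false];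
      [:: true; false; true; false; true; false; true; false]].

Definition span (ws : seq (seq bool)) :=
  foldr (fun w l => l ++ map (wxor w) l) [:: wzero; wones] ws.

Definition good_weight w := weight w \in [:: 0; 4; 8].

(** The candidates for a further word of a code with weights 0, 4 and 8 that has
    all words of l. *)
Definition fresh l (cand : seq (seq bool)) :=
  [seq w <- cand | (w \notin l) && all (fun v => good_weight (wxor w v)) l].

(** The coordinates, sorted by the values of the words of ws; the position of a
    coordinate then encodes these values. *)
Definition radix_sort (ws : seq (seq bool)) :=
  foldr (fun w s => [seq i <- s | nth false w i] ++ [seq i <- s | ~~ nth false w i])
    (iota 0 8) ws.

Definition rearrange (p : seq nat) (w : seq bool) := [seq nth false w i | i <- p].

Definition normalized ws :=
  map (rearrange (radix_sort ws)) ws == take (size ws) std_words.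

(** The words of [span ws] that were added with the last word of ws; the others have
    already been used to filter the candidates. *)
Definition last_coset ws :=
  if ws is w :: ws' then map (wxor w) (span ws') else span [::].

(** For all extensions of ws by up to k independent candidates, sorting the
    coordinates turns the words into the standard ones. *)
Fixpoint normalizable k ws cand :=
  if k is k'.+1 then
    let cand' := fresh (last_coset ws) cand in
    normalized ws && all (fun w => normalizable k' (w :: ws) cand') cand'
  else normalized ws.

Lemma normalizable3 : normalizable 3 [::] (words 8).
Proof. by vm_compute. Qed.

Lemma std_words_maximal : fresh (span std_words) (words 8) = [::].
Proof. by vm_compute. Qed.

Lemma radix_sort_perm ws : perm_eq (radix_sort ws) (iota 0 8).
Proof.
by elim: ws => //= w ws IH; apply: perm_trans IH; apply/permPl/perm_filterC.
Qed.

Variable p : seq nat.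
Hypothesis p_perm : perm_eq p (iota 0 8).

Lemma size_rearrange w : size (rearrange p w) = 8.
Proof. by rewrite size_map (perm_size p_perm) size_iota. Qed.

Lemma rearrange_xor v w : size v = 8 -> size w = 8 ->
  rearrange p (wxor v w) = wxor (rearrange p v) (rearrange p w).
Proof.
move=> v8 w8; apply: (@eq_from_nth _ false).
  by rewrite size_wxor ?size_rearrange.
move=> i; rewrite size_rearrange => i8; have ip : i < size p.
  by rewrite (perm_size p_perm) size_iota.
by rewrite nth_wxor ?size_rearrange // !(nth_map 0) // nth_wxor.
Qed.

Lemma rearrange_nseq b : rearrange p (nseq 8 b) = nseq 8 b.
Proof.
apply: (@eq_from_nth _ false); rewrite size_rearrange ?size_nseq // => i i8.
have ip : i < size p by rewrite (perm_size p_perm) size_iota.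
rewrite (nth_map 0) // !nth_nseq i8.
by have := mem_nth 0 ip; rewrite (perm_mem p_perm) mem_iota => /andP[_ ->].
Qed.

Lemma rearrange_inj v w : size v = 8 -> size w = 8 ->
  rearrange p v = rearrange p w -> v = w.
Proof.
move=> v8 w8 vw; apply: (@eq_from_nth _ false); first by rewrite v8 w8.
move=> i; rewrite v8 => i8; have ip : i \in p by rewrite (perm_mem p_perm) mem_iota.
have := congr1 (fun s => nth false s (index i p)) vw.
by rewrite !(nth_map 0) ?index_mem // nth_index.
Qed.

Lemma weight_rearrange w : size w = 8 -> weight (rearrange p w) = weight w.
Proof.
move=> w8; rewrite /weight -[in RHS](mkseq_nth false w) w8 /mkseq !count_map.
exact: (seq.permP p_perm).
Qed.

Lemma size_span ws w : all (fun v => size v == 8) ws -> w \in span ws -> size w = 8.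
Proof.
elim: ws w => [|v ws IH] w /=; first by rewrite !inE => _ /orP[] /eqP ->.
case/andP=> /eqP v8 ws8; rewrite mem_cat => /orP[/IH->//|/mapP[u us ->]].
by rewrite size_wxor // IH.
Qed.

Lemma rearrange_span ws : all (fun v => size v == 8) ws ->
  map (rearrange p) (span ws) = span (map (rearrange p) ws).
Proof.
elim: ws => [|w ws IH] /=; first by rewrite !rearrange_nseq.
case/andP=> /eqP w8 ws8; rewrite map_cat -IH //; congr (_ ++ _).
rewrite -!map_comp; apply/eq_in_map => v vs /=.
by rewrite rearrange_xor // (size_span ws8 vs).
Qed.

End DualClassification.

(** Take words of D that are independent modulo the all-one word, as many as possible
    but at most three. Sorting the coordinates by their values makes them standard,
    and no word can be added to all three standard words, so they span D. *)
Lemma classify_doubly_even (D : seq bool -> Prop) :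
    (forall w, D w -> size w = 8) -> D wzero -> D wones ->
    (forall v w, D v -> D w -> D (wxor v w)) ->
    (forall w, D w -> good_weight w) ->
  exists k, exists2 p, k <= 3 /\ perm_eq p (iota 0 8) &
    forall w, size w = 8 -> D w <-> rearrange p w \in span (take k std_words).
Proof.
move=> D8 D0 D1 DX Dgood.
have spanD ws : (forall w, w \in ws -> D w) -> forall w, w \in span ws -> D w.
  elim: ws => [|v ws IH] wsD w /=; first by rewrite !inE => /orP[] /eqP ->.
  have {}IH := IH (fun u us => wsD u (@mem_behead _ (v :: ws) u us)).
  rewrite mem_cat => /orP[/IH//|/mapP[u /IH Du ->]].
  by apply: DX => //; apply: wsD; rewrite mem_head.
have [ws [ws3 wsD wsN wsmax]] : exists ws, [/\ size ws <= 3,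
    (forall w, w \in ws -> D w), normalized ws &
    (forall w, D w -> w \in span ws) \/ size ws = 3].
  have main k ws cand : (forall w, w \in ws -> D w) -> size ws + k = 3 ->
      (forall w, D w -> w \in span (behead ws) \/ w \in cand) ->
      normalizable k ws cand ->
    exists ws', [/\ size ws' <= 3, (forall w, w \in ws' -> D w), normalized ws' &
      (forall w, D w -> w \in span ws') \/ size ws' = 3].
    elim: k ws cand => [|k IH] ws cand wsD sz cover.
      by exists ws; split=> //; rewrite -sz addn0 //; right.
    case/andP=> N /allP next.
    have [sub|] := pselect (forall w, D w -> w \in span ws).
      by exists ws; split=> //; [rewrite -sz leq_addr | left].
    have spanE : {subset span (behead ws) <= span ws} /\ {subset last_coset ws <= span ws}.
      case: (ws) => [|v vs] /=; first by split.
      by split=> u; rewrite mem_cat => ->; rewrite ?orbT.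
    have cand'P w : D w -> w \notin span ws -> w \in fresh (last_coset ws) cand.
      move=> Dw wn; have wc : w \in cand.
        by case: (cover w Dw) => // /(proj1 spanE) ws'; case/negP: wn.
      rewrite mem_filter wc andbT (contra (@proj2 _ _ spanE w) wn).
      apply/allP => u /(proj2 spanE) us; apply: Dgood; apply: DX => //.
      exact: spanD us.
    move=> /existsNP[w /not_implyP[Dw /negP wn]].
    apply: IH (next w (cand'P w Dw wn)) => [v||v Dv].
    - by rewrite inE => /orP[/eqP ->//|/wsD].
    - by rewrite /= addSnnS.
    - by have [vs|/(cand'P v Dv)] := boolP (v \in span ws); [left | right].
  by apply: main normalizable3 => // w Dw; right; rewrite mem_words D8.
have ws8 : all (fun v => size v == 8) ws by apply/allP => v /wsD/D8 ->.
have pp := radix_sort_perm ws.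
exists (size ws), (radix_sort ws) => // w w8.
rewrite -(eqP wsN) -rearrange_span //; split=> [Dw|/mapP[v vs]]; last first.
  move=> /(rearrange_inj pp w8 (size_span ws8 vs)) ->.
  exact: spanD vs.
case: wsmax => [sub|sz3]; first exact/map_f/sub.
apply: contrapT => /negP wn.
have : rearrange (radix_sort ws) w \in fresh (span std_words) (words 8).
  have e : span std_words = [seq rearrange (radix_sort ws) i | i <- span ws].
    by rewrite rearrange_span // (eqP wsN) sz3.
  rewrite mem_filter e wn mem_words size_rearrange // eqxx andbT.
  apply/allP => _ /mapP[v vs ->]; rewrite -rearrange_xor ?(size_span ws8 vs) //.
  rewrite /good_weight weight_rearrange ?size_wxor ?(size_span ws8 vs) //.
  by apply: Dgood; apply: DX => //; apply: spanD vs.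
by rewrite std_words_maximal.
Qed.

(** * Diagonalizable groups *)

Section DiagonalTables.

Definition pair_word i j := mkseq (fun k => (k == i) || (k == j)) 8.

(** Generators of the diagonal group of the dual of the code spanned by the all-one
    word and the first k standard words. The class with sign -1 at 0 and j is
    orthogonal to the standard words on which the vertices 0 and j agree. *)
Definition diag_gens k :=
  gens21 ++ [seq sdiag (pair_word 0 j) | j <- take (3 - k) [:: 1; 2; 4]].

Definition diag_gens_image k :=
  gens21 ++ [seq cliff2 0 j | j <- take (3 - k) [:: 1; 2; 4]].

Definition orthogonal_to ws u := all (fun w => ~~ wdot u w) ws.

Definition dual_table k :=
  let l := slist (diag_gens k) in
  [&& sgroup_ok (diag_gens k),
      all (fun u => orthogonal_to (span (take k std_words)) u ==> (canon (sdiag u) \in l))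
        (words 8) &
      all (fun s => has (fun u => orthogonal_to (span (take k std_words)) u &&
        (canon (sdiag u) == s)) (words 8)) l].

Lemma dual_tables : all dual_table (iota 0 4).
Proof. by vm_compute. Qed.

Lemma image_tables : all (fun k =>
    intertwined_gens (diag_gens k) (diag_gens_image k) &&
    same_sgroup (diag_gens_image k) (nth [::] [:: gens13; gens14; gens16; gens21] k))
  (iota 0 4).
Proof. by vm_compute. Qed.

(** A word of weight 2, or the complement of one, would identify two coordinates of
    the dual code. *)
Lemma even_weight_table : all (fun w => ~~ wdot wones w ==> good_weight w ||
    has (fun i => has (fun j => (i != j) &&
      ((w == pair_word i j) || (w == wxor wones (pair_word i j)))) (iota 0 8)) (iota 0 8))
  (words 8).
Proof. by vm_compute. Qed.

Lemma wdot_pair u (i j : 'I_8) : size u = 8 -> i != j ->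
  wdot u (pair_word i j) = nth false u i (+) nth false u j.
Proof.
move=> u8 ij; rewrite wdotE ?size_mkseq // (bigD1 i) //= (bigD1 j) 1?eq_sym //=.
rewrite !nth_mkseq // !eqxx orbT !andbT big1 ?addbF // => k /andP[ki kj].
by rewrite nth_mkseq // !(inj_eq val_inj) (negPf ki) (negPf kj) andbF.
Qed.

Variable p : seq nat.
Hypothesis p_perm : perm_eq p (iota 0 8).

Lemma wdot_rearrange v w : size v = 8 -> size w = 8 ->
  wdot (rearrange p v) (rearrange p w) = wdot v w.
Proof.
move=> v8 w8; rewrite !wdotE ?size_rearrange //.
rewrite -(big_mkord xpredT (fun i => nth false v i && nth false w i)).
rewrite -(perm_big _ p_perm) (big_nth 0) (perm_size p_perm) size_iota big_mkord.
by apply: eq_bigr => i _; rewrite !(nth_map 0) // (perm_size p_perm) size_iota.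
Qed.

Lemma rearrange_surj w : size w = 8 -> exists2 v, size v = 8 & rearrange p v = w.
Proof.
move=> w8; exists (mkseq (fun i => nth false w (index i p)) 8); first by rewrite size_mkseq.
apply: (@eq_from_nth _ false); rewrite size_rearrange ?w8 // => i i8.
have ip : i < size p by rewrite (perm_size p_perm) size_iota.
rewrite (nth_map 0) // nth_mkseq ?index_uniq //.
  by rewrite (perm_uniq p_perm) iota_uniq.
by have := mem_nth 0 ip; rewrite (perm_mem p_perm) mem_iota.
Qed.

Definition perm_table : sperm := [seq (i, false) | i <- p].

Lemma sok_perm_table : sok perm_table.
Proof.
rewrite /sok size_map (perm_size p_perm) size_iota /= all_map (perm_all _ p_perm) /=.
by rewrite /unzip1 -map_comp map_id (perm_uniq p_perm) iota_uniq.
Qed.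

Lemma perm_table_diag u : size u = 8 ->
  smul perm_table (sdiag u) = smul (sdiag (rearrange p u)) perm_table.
Proof.
move=> u8; have r8 := size_rearrange p_perm u.
have okp := sok_perm_table; have okr := sok_sdiag r8; have oku := sok_sdiag u8.
have s8 := sok_size (sok_smul okp oku); have t8 := sok_size (sok_smul okr okp).
apply: (@eq_from_nth _ (0, false)); rewrite ?s8 ?t8 // => i i8.
have ip : i < size p by rewrite (perm_size p_perm) size_iota.
rewrite -!/(entry _ _) !entry_smul ?(sok_size okp) ?(sok_size okr) //.
have pE : entry perm_table i = (nth 0 p i, false) by rewrite /entry (nth_map 0).
have p8 : nth 0 p i < 8 by have := mem_nth 0 ip; rewrite (perm_mem p_perm) mem_iota.
by rewrite pE !entry_sdiag ?u8 ?r8 //= pE /= addbF (nth_map 0).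
Qed.

End DiagonalTables.

Section Diagonalizable.
Local Open Scope ring_scope.
Variable R : realType.
Local Notation scls := (scls R).

Definition dclass u : autso8 R := scls (sdiag u).

Lemma smul_sdiag u v : size u = 8%N -> size v = 8%N ->
  smul (sdiag u) (sdiag v) = sdiag (wxor u v).
Proof.
move=> u8 v8; have oku := sok_sdiag u8; have x8 := size_wxor u8 v8.
have s8 := sok_size oku; have sx8 := sok_size (sok_sdiag x8).
apply: (@eq_from_nth _ (0, false)%N); first by rewrite size_map s8 sx8.
rewrite size_map s8 => i i8; rewrite -!/(entry _ _) entry_smul // !entry_sdiag ?u8 ?v8 ?x8 //=.
by rewrite nth_wxor.
Qed.

Lemma dclassM u v : size u = 8%N -> size v = 8%N ->
  (dclass u * dclass v)%g = dclass (wxor u v).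
Proof. by move=> u8 v8; rewrite /dclass scls_smul ?sok_sdiag // smul_sdiag. Qed.

Lemma dclass0 : dclass wzero = 1%g. Proof. exact: scls_sone. Qed.

Lemma dclass_ones : dclass wones = 1%g.
Proof. by rewrite /dclass -scls_canon // -scls_sone. Qed.

Lemma det_sdiag u : size u = 8%N -> \det (smx R (sdiag u)) = (-1) ^+ wdot u wones.
Proof.
move=> u8; have -> : smx R (sdiag u) = diag_mx (\row_i (-1) ^+ nth false u i).
  by rewrite smx_sdiag //; apply/matrixP => i j; rewrite !mxE.
rewrite det_diag wdotE // (@big_morph _ _ (fun b : bool => (-1) ^+ b : R) 1 *%R) //.
  by apply: eq_bigr => i _; rewrite mxE nth_nseq ltn_ord andbT.
by move=> b c; rewrite signr_addb.
Qed.

Lemma diagonal_class f : diagonal_classes f -> exists2 u, size u = 8%N & f = dclass u.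
Proof.
move=> [X [OX /is_diag_mxP dX] <-].
exists (mkseq (fun i => X (inord i) (inord i) == -1) 8); first by rewrite size_mkseq.
congr cls; rewrite smx_sdiag ?size_mkseq //; apply/matrixP => i j; rewrite mxE.
have [<-|ij] := eqVneq i j; last by rewrite dX.
rewrite nth_mkseq // inord_val mulr1n.
have : X i i * X i i == 1.
  have /matrixP/(_ i i) := OX; rewrite !mxE eqxx (bigD1 i) //= big1 => [|k ki].
    by rewrite mxE addr0 mulr1n => ->.
  by rewrite dX ?mul0r // eq_sym.
by rewrite -expr2 sqrf_eq1 => /orP[] /eqP ->; rewrite ?eqxx // -subr_eq0 opprK
  -(natrD _ 1 1) pnatr_eq0.
Qed.

Lemma dclass_fixes u (i j : 'I_8) : size u = 8%N ->
  nth false u i = nth false u j -> dclass u (so8_delta R i j) = so8_delta R i j.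
Proof.
move=> u8 uij; apply: so8_inj.
have Xe k : smx R (sdiag u) *m basis R k = (-1) ^+ nth false u k *: basis R k.
  apply/matrixP => l m; rewrite [m]ord1 mulmx_basis smx_sdiag // !mxE eqxx andbT.
  by case: eqVneq => [->|]; rewrite ?mulr1n ?mulr1 ?mulr0n ?mulr0.
rewrite (@cls_wedge _ _ _ (basis R i) (basis R j)).
- rewrite !Xe uij wedgeZl wedgeZr scalerA -signr_addb addbb scale1r.
  by rewrite so8_deltaE skew_delta_wedge.
- by apply/O8_smx/sok_sdiag.
- by rewrite so8_deltaE skew_delta_wedge.
Qed.

Lemma dual_sgroup k : (k < 4)%N ->
  [set dclass u | u in [set u | size u = 8%N /\ orthogonal_to (span (take k std_words)) u]]
  = sgroup R (diag_gens k).
Proof.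
move=> k4; have /(allP dual_tables)/and3P[ok /allP sub /allP sup] : k \in iota 0 4.
  by rewrite mem_iota.
rewrite sgroupE //; apply/seteqP; split.
  move=> f [u [u8 uo] <-]; have uw : u \in words 8 by rewrite mem_words u8.
  by rewrite /dclass -scls_canon ?sok_sdiag //; apply/map_f/(implyP (sub u uw)).
move=> f /mapP[s /sup/hasP[u]]; rewrite mem_words => /eqP u8 /andP[uo /eqP <-] ->.
by exists u => //; rewrite scls_canon ?sok_sdiag.
Qed.

Lemma conj_perm_dclass p u : perm_eq p (iota 0 8) -> size u = 8%N ->
  (dclass u ^ (scls (perm_table p))^-1)%g = dclass (rearrange p u).
Proof.
move=> pp u8; have okp := sok_perm_table pp; have oku := sok_sdiag u8.
have okr : sok (sdiag (rearrange p u)) by rewrite sok_sdiag ?size_rearrange.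
rewrite /conjg invgK; apply: (@mulIg _ (scls (perm_table p))).
by rewrite -!mulgA mulVg mulg1 /dclass !scls_smul // perm_table_diag.
Qed.

Theorem diagonalizable_classification (F : set (autso8 R)) :
    is_subgroup F -> F `<=` PSO8 R -> diagonalizable_classes F ->
    fixed_points F = [set 0] ->
  exists2 k, (k < 4)%N &
    conjugate_sets F (nth set0 [:: F13 R; F14 R; F16 R; F21 R] k).
Proof.
move=> sF FSO [h [H OH hE] hdiag] fixF.
pose F' := conj_set F h; have sF' : is_subgroup F' by apply: conj_set_subgroup.
have [F'1 F'M _] := sF'.
pose C u := size u = 8%N /\ F' (dclass u).
have C0 : C wzero by split; rewrite // dclass0.
have C1 : C wones by split; rewrite // dclass_ones.
have CX u v : C u -> C v -> C (wxor u v).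
  move=> [u8 Fu] [v8 Fv]; split; first by rewrite size_wxor.
  by rewrite -dclassM //; exact: F'M Fu Fv.
(* Both X and - X have the same determinant, as 8 is even. *)
have Ceven u : C u -> wdot u wones = false.
  move=> [u8 [f Ff fE]]; have [Y [OY Y1] YE] := FSO f Ff.
  have OZ : O8 (H^T *m Y *m H) by exact: O8_mul (O8_mul (O8_tr OH) OY) OH.
  have detYZ : \det (H^T *m Y *m H) = 1.
    by rewrite !det_mulmx Y1 mulr1 -det_mulmx (mulmx1C OH) det1.
  have Ou : O8 (smx R (sdiag u)) by apply/O8_smx/sok_sdiag.
  have : cls (H^T *m Y *m H) = cls (smx R (sdiag u)).
    by rewrite -clsJ // YE hE.
  have : \det (smx R (sdiag u)) = 1 -> wdot u wones = false.
    rewrite det_sdiag //; case: (wdot u wones) => // /eqP.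
    by rewrite expr1 eq_sym -subr_eq0 opprK -(natrD _ 1 1) pnatr_eq0.
  move=> even; case/(cls_eq OZ Ou) => uE; apply: even; rewrite uE //.
  by rewrite -scaleN1r detZ detYZ mulr1 -signr_odd.
have Csep (i j : 'I_8) : i != j -> exists2 u, C u & nth false u i != nth false u j.
  move=> ij; apply: contrapT => none.
  have fixA : fixed_points F (h (so8_delta R i j)).
    move=> f Ff; rewrite -!aut_mulE.
    have -> : (f * h = h * (f ^ h))%g by rewrite /conjg mulKVg.
    rewrite aut_mulE; have F'f : F' (f ^ h)%g by exists f.
    have [u u8 uE] := diagonal_class (hdiag _ F'f).
    rewrite uE dclass_fixes //; apply: contrapT => /eqP uij; apply: none.
    by exists u; [split; [exact: u8 | rewrite -uE; exact: F'f] | exact: uij].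
  have : h (so8_delta R i j) = 0 by move: fixA; rewrite fixF.
  move=> /(congr1 vsval) hA0.
  have /(aut_neq0 h)/eqP : vsval (so8_delta R i j) != 0; last exact.
  rewrite so8_deltaE; apply/eqP => /matrixP/(_ i j)/eqP.
  by rewrite !mxE !eqxx (eq_sym j i) (negPf ij) subr0 oner_eq0.
pose D w := size w = 8%N /\ forall u, C u -> wdot u w = false.
have D0 : D wzero.
  split=> // u [u8 _]; rewrite wdotE // big1 // => i _.
  by rewrite nth_nseq if_same andbF.
have DX v w : D v -> D w -> D (wxor v w).
  move=> [v8 Dv] [w8 Dw]; split=> [|u Cu]; first by rewrite size_wxor.
  by rewrite wdotDr ?Dv ?Dw //; case: Cu.
have Dgood w : D w -> good_weight w.
  move=> Dw; have [w8 Dw0] := Dw.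
  have wW : w \in words 8 by rewrite mem_words w8.
  have := allP even_weight_table w wW; rewrite Dw0 // implyTb.
  case/orP=> // /hasP[i i8 /hasP[j j8 /andP[ij wE]]].
  rewrite mem_iota in i8; rewrite mem_iota in j8.
  have {}i8 : (i < 8)%N by []; have {}j8 : (j < 8)%N by [].
  have Dij : D (pair_word i j).
    case/orP: wE => /eqP wE; first by rewrite -wE.
    have -> : pair_word i j = wxor wones w.
      rewrite wE; apply: (@eq_from_nth _ false) => [|l].
        by rewrite !size_wxor ?size_mkseq.
      by rewrite size_mkseq => l8; rewrite !nth_wxor ?size_wxor ?size_mkseq // addKb.
    by apply: DX.
  have [u Cu] := Csep (Ordinal i8) (Ordinal j8) ij.
  have [u8 _] := Cu; have := proj2 Dij u Cu.
  by rewrite (@wdot_pair u (Ordinal i8) (Ordinal j8)) //= => /negbT; rewrite negb_add => ->.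
have D8 w : D w -> size w = 8%N by case.
have D1 : D wones by split.
have [k [p [k3 pp] DP]] := classify_doubly_even D8 D0 D1 DX Dgood.
exists k => //; exists (h * (scls (perm_table p))^-1 * (triality R)^-1)%g.
rewrite -!conj_setM -/F'.
have -> : conj_set F' (scls (perm_table p))^-1%g = sgroup R (diag_gens k).
  rewrite -dual_sgroup //; apply/seteqP; split.
    move=> f' [f0 [f Ff <-] <-]; have F'f : F' (f ^ h)%g by exists f.
    have [u u8 uE] := diagonal_class (hdiag _ F'f).
    exists (rearrange p u); last by rewrite uE conj_perm_dclass.
    split; first exact: size_rearrange.
    apply/allP => w ws; have w8 : size w = 8%N.
      apply: size_span ws; apply/allP => v /mem_take.
      by rewrite !inE => /or3P[] /eqP ->.
    have [v v8 vE] := rearrange_surj pp w8.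
    have [_ Dv] : D v by apply/DP; rewrite ?vE.
    rewrite -vE wdot_rearrange // Dv //.
    by split; [exact: u8 | rewrite -uE; exact: F'f].
  move=> f [v [v8 vo] <-]; have [u u8 uE] := rearrange_surj pp v8.
  have [_ Fu] : C u.
    apply: double_dual => // [w []//|w w8 Dw]; rewrite -(wdot_rearrange pp) // uE.
    by apply/negbTE/(allP vo)/DP.
  by exists (dclass u) => //; rewrite conj_perm_dclass // uE.
have /(allP image_tables)/andP[tri same] : k \in iota 0 4 by rewrite mem_iota.
rewrite (triality_sgroup R tri) (same_sgroupE R same).
by rewrite F13E F14E F16E F21E; case: k k3 {DP tri same} => [|[|[|[|]]]].
Qed.

End Diagonalizable.

Theorem proposition4p8 (R : realType) :
  (let L := [:: F13 R; F14 R; F16 R; F17 R; F18 R; F19 R; F20 R; F21 R] in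
   forall i j : nat, (i < j < size L)%N ->
     ~ conjugate_sets (nth set0 L i) (nth set0 L j)) /\
  (conjugate_sets (F15 R) (F19 R) /\
   forall g : autso8 R,
     set_normalizer (F17 R) `&` connected_component [set: autso8 R] g !=set0) /\
  (forall F : set (autso8 R),
     is_subgroup F -> finite_set F -> commutative_set F ->
     F `<=` PSO8 R -> diagonalizable_classes F ->
     fixed_points F = [set 0%R] ->
     [\/ conjugate_sets F (F13 R), conjugate_sets F (F14 R),
         conjugate_sets F (F16 R) | conjugate_sets F (F21 R)]).
Proof.
split; first by move=> L i j; apply: nonconjugate.
split; first by split; [apply: F15_F19_conjugate | apply: normalizer_meets_components].
move=> F sF _ _ FSO Fdiag fixF.
have [k k4] := diagonalizable_classification sF FSO Fdiag fixF.
by case: k k4 => [|[|[|[|]]]] //=;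
  [constructor 1 | constructor 2 | constructor 3 | constructor 4].
Qed.
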